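(* Assume (SC), $\mathcal D_y<\infty$, and $F^*=\inf_{x\in\mathcal X}F(x)>-\infty$. Let $\mathcal R=\max\{\tilde\mu/\mu,\,L/\tilde l,\,1\}$, $\bar L=\mathcal R\,\tilde l$, $\bar\mu=\max\{\underline\mu/\gamma_1,\,\tilde\mu/\mathcal R\}$, and let $\varsigma=0$ if $\mu$ is known and $\varsigma=1$ otherwise. Then the sequence generated by AGDA+ satisfies, for all $T\in\mathbb N_+$, $$\sum_{t=0}^{T}\Big(\gamma_0\tau_t\|G_x^{\tau_t}(x_t,y_t)\|^2+\sigma_t\|G_y^{\sigma_t}(x_t,y_t)\|^2+\frac{\mu_t\sigma_t^2}{2}\|G_y^{\sigma_t}(x_{t+1},y_t)\|^2\Big)$$ $$\le\mathcal L(x_0,y_0)-F^*+\Big(\Big\lceil\frac1r\log_{1/\gamma}(\mathcal R)\Big\rceil+1\Big)\Big(\big(\bar L/\gamma^r+L\big)\mathcal D_y^2+\bar\Lambda\Big)+60\,\tilde l\cdot\frac{\tilde l}{\tilde\mu}\cdot\frac{\mathcal R^{2+\varsigma}}{1-\gamma^{(2+\varsigma)r}}\,\bar\Delta,$$ where, if $\texttt{max\_solver}=\texttt{True}$, $\bar\Lambda=\zeta+\frac{\bar L}{\sqrt{\bar\mu}}\mathcal D_y\sqrt{\frac{2\zeta}{\gamma^{3r}}}$ and $\bar\Delta=\frac{2\zeta}{\gamma^r}\frac1{\bar\mu}$, while if $\texttt{max\_solver}=\texttt{False}$, $\bar\Lambda=\frac2{\gamma^r}\bar L\mathcal D_y^2$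 and $\bar\Delta=\min\{(1+\frac2{\gamma^{2r}}\frac{\bar L}{\bar\mu})\mathcal D_y,\,\bar{\mathcal D}_y\}^2$.
   Context: Setting. $\mathcal X,\mathcal Y$ are finite-dimensional Euclidean spaces with Euclidean norm $\|\cdot\|$; $\mathbb N=\{0,1,2,\dots\}$, $\mathbb N_+=\mathbb N\setminus\{0\}$. Problem: $\min_{x\in\mathcal X}\max_{y\in\mathcal Y}\mathcal L(x,y)$ with $\mathcal L(x,y)=g(x)+f(x,y)-h(y)$; $F(x)=\max_{y}\mathcal L(x,y)$. Assumption (SC): $g:\mathcal X\to\mathbb R\cup\{+\infty\}$ and $h:\mathcal Y\to\mathbb R\cup\{+\infty\}$ are proper closed convex; $f:\mathcal X\times\mathcal Y\to\mathbb R$ is differentiable on an open set containing $\mathrm{dom}\,g\times\mathrm{dom}\,h$; $\nabla f$ is $L$-Lipschitz on $\mathrm{dom}\,g\times\mathrm{dom}\,h$; and $f(x,\cdot)$ is strongly concave with modulus $\mu>0$ for every $x\in\mathrm{dom}\,g$. Notation: $\mathbf{prox}_{r}(x)=\arg\min_w\{r(w)+\frac12\|w-x\|^2\}$; $G_x^\tau(x,y)=[x-\mathbf{prox}_{\tau g}(x-\tau\nabla_xf(x,y))]/\tau$; $G_y^\sigma(x,y)=[\mathbf{prox}_{\sigma h}(y+\sigma\nabla_yf(x,y))-y]/\sigma$. $\mathcal D_y=\sup_{y_1,y_2\in\mathrm{dom}\,h}\|y_1-y_2\|$. Algorithm AGDA+. Inputs: $(x_0,y_0)\in\mathrm{dom}\,g\times\mathrm{dom}\,h$;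 $\zeta,\tilde\mu,\tilde l>0$ with $\tilde l>\tilde\mu$; $\gamma_0,\gamma\in(0,1)$; $r\in\mathbb N_+$; a Boolean $\texttt{max\_solver}$. Put $\gamma_1=\gamma^r$, $\gamma_2=\gamma$. If $\mu$ is known, $\underline\mu=\tilde\mu=\mu$; otherwise $\underline\mu=0$. $\bar{\mathcal D}_y=\mathcal D_y$ if $\mathcal D_y<\infty$ is known, otherwise $\bar{\mathcal D}_y=+\infty$. Initialize $l_0=L_0=\tilde l$, $\mu_0=\tilde\mu$, $t=0$, $l_0^\circ=l_0$, $\texttt{flag}=\texttt{False}$. Repeat: (1) If $\texttt{max\_solver}=\texttt{True}$ and $\texttt{flag}=\texttt{False}$, replace $y_t$ by a point satisfying $\mathcal L(x_t,y_t)+\zeta\ge\max_{y}\mathcal L(x_t,y)$. If $\texttt{max\_solver}=\texttt{False}$, set $\hat y_t=\mathbf{prox}_{h/L_t}(y_t+\frac1{L_t}\nabla_yf(x_t,y_t))$, $d_t=\|\hat y_t-y_t\|$, then $y_t\leftarrow\hat y_t$. Set $\texttt{flag}\leftarrow\texttt{True}$. (2) While $l_t\le L_t$: (2a) $\sigma_t=1/l_t$, $\tau_t=\frac{1-\gamma_0}{l_t}\Big(4+\frac1{\gamma_2}+\frac{4(1-\sigma_t\mu_t)(2-\sigma_t\mu_t)(15L_t-8\mu_t)L_t^3}{\mu_t^4}\Big)^{-1}$, $\tilde x_{t+1}=\mathbf{prox}_{\tau_tg}(x_t-\tau_t\nabla_xf(x_t,y_t))$, $\tilde y_{t+1}=\mathbf{prox}_{\sigma_th}(y_t+\sigma_t\nabla_yf(\tilde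 x_{t+1},y_t))$. (2b) If $\texttt{flag}=\texttt{True}$: set $R_t=0$ and, if $\texttt{max\_solver}=\texttt{True}$, $\Delta_t=\frac{2\zeta}{\mu_t}$, $\Lambda_t=\zeta+\sqrt{2\zeta/\mu_t}\,L_t\|y_t-\tilde y_{t+1}\|$; if $\texttt{max\_solver}=\texttt{False}$, $\Delta_t=\min\{(1+\frac{2L_t}{\mu_t})^2d_t^2,\bar{\mathcal D}_y^2\}$, $\Lambda_t=2d_tL_t\|y_t-\tilde y_{t+1}\|$. (2c) Check $\mathrm{BC}(t)$. If it holds: $x_{t+1}=\tilde x_{t+1}$, $y_{t+1}=\tilde y_{t+1}$, $l_{t+1}=l_{t+1}^\circ=\max\{\gamma_2l_t,\tilde l\}$, $L_{t+1}=L_t$, $\mu_{t+1}=\mu_t$, $C_t=\frac{(1-\sigma_t\mu_t)(2-\sigma_t\mu_t)}{\sigma_t\mu_t}\frac{L_t^2}{\mu_t^2}\tau_t^2$, $\Delta_{t+1}=(1-\mu_t\sigma_t/2)\Delta_t+C_t\|G_x^{\tau_t}(x_t,y_t)\|^2$, $\Lambda_{t+1}=6l_t(\Delta_{t+1}+2\Delta_t)-8\mu_t\Delta_t$, $R_{t+1}=2\tau_t^2l_t\|G_x^{\tau_t}(x_t,y_t)\|^2-\sigma_t^2\mu_t\|G_y^{\sigma_t}(x_{t+1},y_t)\|^2$, then $t\leftarrow t+1$, $\texttt{flag}\leftarrow\texttt{False}$. If it fails: $l_t\leftarrow l_t/\gamma_2$. (3) (when $l_t>L_t$) $L_t\leftarrow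 L_t/\gamma_1$, $\mu_t\leftarrow\max\{\mu_t\gamma_1,\underline\mu\}$, return to (1). Backtracking condition $\mathrm{BC}(t)$: all four of (i) $(\tau_t-(2+\frac1\gamma)\tau_t^2l_t)\|G_x^{\tau_t}(x_t,y_t)\|^2+\sigma_t\|G_y^{\sigma_t}(x_t,y_t)\|^2+\sigma_t^2\frac{\mu_t}2\|G_y^{\sigma_t}(\tilde x_{t+1},y_t)\|^2\le\Lambda_t+4(3l_t-2\mu_t)\Delta_t+\mathcal L(x_t,y_t)-\mathcal L(\tilde x_{t+1},\tilde y_{t+1})+R_t$; (ii) $f(\tilde x_{t+1},y_t)+\langle\nabla_yf(\tilde x_{t+1},y_t),\tilde y_{t+1}-y_t\rangle\le f(\tilde x_{t+1},\tilde y_{t+1})+\frac{l_t}2\|\tilde y_{t+1}-y_t\|^2$; (iii) $\|\nabla_yf(\tilde x_{t+1},\tilde y_{t+1})-\nabla_yf(\tilde x_{t+1},y_t)\|\le l_t\|\tilde y_{t+1}-y_t\|$; (iv) $\|G_y^{\sigma_t}(\tilde x_{t+1},y_t)\|^2\le2\big(\frac{4(1-\sigma_t\mu_t)}{\sigma_t^2}+2l_t^2\big)\Delta_t+2l_t^2\tau_t^2\|G_x^{\tau_t}(x_t,y_t)\|^2$. Convention: for a completed iteration $t$, the symbols $y_t$ (including $y_0$), $l_t,L_t,\mu_t,\tau_t,\sigma_t$ denote their values at the moment $\mathrm{BC}(t)$ is satisfied (i.e. after any resets in iteration $t$). *)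

(* Defs.v *)
From HB Require Import structures.
From mathcomp Require Import all_boot all_order all_algebra.
From mathcomp Require Import all_classical all_reals all_analysis.
Import Order.TTheory GRing.Theory Num.Theory numFieldNormedType.Exports.

Set Implicit Arguments.
Unset Strict Implicit.
Unset Printing Implicit Defensive.

Local Open Scope classical_set_scope.
Local Open Scope ring_scope.

(* The library norm on 'rV[R]_k is the max norm, which induces the same
   topology (hence the same notions of openness, semicontinuity and
   differentiability) as the Euclidean norm defined here; every metric
   quantity below uses the Euclidean norm. *)
Definition dotp (R : realType) (k : nat) (u v : 'rV[R]_k) : R :=
  \sum_(i < k) u 0 i * v 0 i.

Definition enorm (R : realType) (k : nat) (u : 'rV[R]_k) : R :=
  Num.sqrt (dotp u u).

Definition enorm2 (R : realType) (n m : nat) (u : 'rV[R]_n) (v : 'rV[R]_m) : R :=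
  Num.sqrt (enorm u ^+ 2 + enorm v ^+ 2).

Definition gradient (R : realType) (k : nat) (F : 'rV[R]_k -> R)
    (a : 'rV[R]_k) : 'rV[R]_k :=
  \row_(i < k) 'D_(delta_mx 0 i) F a.

Definition dom (R : realType) (k : nat) (p : 'rV[R]_k -> \bar R) : set 'rV[R]_k :=
  [set x | (p x < +oo)%E].

Definition proper (R : realType) (k : nat) (p : 'rV[R]_k -> \bar R) : Prop :=
  (forall x, (-oo < p x)%E) /\ (exists x, dom p x).

(* At t = 0 and t = 1 this relies on 0 * +oo = 0, as in convex analysis. *)
Definition econvex (R : realType) (k : nat) (p : 'rV[R]_k -> \bar R) : Prop :=
  forall (x y : 'rV[R]_k) (t : R), 0 <= t <= 1 ->
    (p (t *: x + (1 - t) *: y)%R <= t%:E * p x + (1 - t)%:E * p y)%E.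

Definition proper_closed_convex (R : realType) (k : nat)
    (p : 'rV[R]_k -> \bar R) : Prop :=
  [/\ proper p, lower_semicontinuous p & econvex p].

Definition strongly_concave (R : realType) (k : nat) (mu : R)
    (F : 'rV[R]_k -> R) : Prop :=
  forall (x y : 'rV[R]_k) (t : R), 0 <= t <= 1 ->
    t * F x + (1 - t) * F y + mu / 2 * t * (1 - t) * enorm (x - y) ^+ 2
      <= F (t *: x + (1 - t) *: y).

(* The minimiser exists and is unique when p is proper, closed and convex. *)
Definition prox (R : realType) (k : nat) (p : 'rV[R]_k -> \bar R)
    (x : 'rV[R]_k) : 'rV[R]_k :=
  xget 0 [set w | forall v,
    (p w + (2^-1 * enorm (w - x) ^+ 2)%:E
       <= p v + (2^-1 * enorm (v - x) ^+ 2)%:E)%E].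

Definition escale (R : realType) (k : nat) (a : R) (p : 'rV[R]_k -> \bar R)
    (x : 'rV[R]_k) : \bar R := (a%:E * p x)%E.

Record problem (R : realType) (n m : nat) := Problem {
  pg : 'rV[R]_n -> \bar R;
  ph : 'rV[R]_m -> \bar R;
  pf : 'rV[R]_n -> 'rV[R]_m -> R;
  pL : R;
  pmu : R
}.

Record input (R : realType) (n m : nat) := Input {
  x_init : 'rV[R]_n;
  y_init : 'rV[R]_m;
  zeta : R;
  mu_tilde : R;
  l_tilde : R;
  gamma0 : R;
  gamma : R;
  rexp : nat;
  max_solver : bool;
  mu_known : bool;
  diam_known : bool
}.

(* The quantities at outer iteration t.  The running index t is implicit. *)
Record state (R : realType) (n m : nat) := State {
  sx : 'rV[R]_n;
  sy : 'rV[R]_m;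
  sl : R;
  sL : R;
  smu : R;
  sd : R;
  sflag : bool;
  sDelta : R;
  sLambda : R;
  sR : R
}.

Section Problem.
Context (R : realType) (n m : nat) (P : problem R n m).

Definition grad_x (x : 'rV[R]_n) (y : 'rV[R]_m) : 'rV[R]_n :=
  gradient (fun u => pf P u y) x.

Definition grad_y (x : 'rV[R]_n) (y : 'rV[R]_m) : 'rV[R]_m :=
  gradient (fun v => pf P x v) y.

Definition SC : Prop :=
  [/\ proper_closed_convex (pg P),
      proper_closed_convex (ph P),
      (exists U : set ('rV[R]_n * 'rV[R]_m), [/\ open U,
         dom (pg P) `*` dom (ph P) `<=` U &
         forall q, U q -> differentiable (fun z => pf P z.1 z.2) q]),
      (0 <= pL P /\
       forall x x' y y', dom (pg P) x -> dom (pg P) x' ->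
         dom (ph P) y -> dom (ph P) y' ->
         enorm2 (grad_x x y - grad_x x' y') (grad_y x y - grad_y x' y')
           <= pL P * enorm2 (x - x') (y - y')) &
      (0 < pmu P /\
       forall x, dom (pg P) x -> strongly_concave (pmu P) (pf P x))].

(* In \bar R one has +oo - +oo = -oo, so Lag x y = -oo when both g x and h y
   are +oo.  Since h is proper, Fmax x = +oo for x outside dom g all the same,
   and the algorithm evaluates Lag on dom g `*` dom h only. *)
Definition Lag (x : 'rV[R]_n) (y : 'rV[R]_m) : \bar R :=
  (pg P x + (pf P x y)%:E - ph P y)%E.

Definition Fmax (x : 'rV[R]_n) : \bar R := ereal_sup (range (Lag x)).

Definition Fstar : \bar R := ereal_inf (range Fmax).

Definition diam : \bar R :=
  ereal_sup [set (enorm (y1 - y2))%:E | y1 in dom (ph P) & y2 in dom (ph P)].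

Definition Gx (tau : R) (x : 'rV[R]_n) (y : 'rV[R]_m) : 'rV[R]_n :=
  tau^-1 *: (x - prox (escale tau (pg P)) (x - tau *: grad_x x y)).

Definition Gy (sigma : R) (x : 'rV[R]_n) (y : 'rV[R]_m) : 'rV[R]_m :=
  sigma^-1 *: (prox (escale sigma (ph P)) (y + sigma *: grad_y x y) - y).

Section Algorithm.
Context (A : input R n m).

Definition valid_input : Prop :=
  [/\ dom (pg P) (x_init A) /\ dom (ph P) (y_init A),
      [/\ 0 < zeta A, 0 < mu_tilde A & mu_tilde A < l_tilde A],
      (0 < gamma0 A < 1) /\ (0 < gamma A < 1),
      (0 < rexp A)%N &
      (mu_known A -> mu_tilde A = pmu P)].

Definition gamma1 : R := gamma A ^+ rexp A.
Definition gamma2 : R := gamma A.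

Definition mu_low : R := if mu_known A then pmu P else 0.
Definition diam_bar : \bar R := if diam_known A then diam else +oo%E.

(* min {a, b} for a real a and an extended real b >= 0; always finite. *)
Definition min_bar (a : R) (b : \bar R) : R := fine (mine a%:E b).

(* The values 0 for d, Delta, Lambda and R are never read: refresh raises the
   flag, so that these fields are assigned before their first use. *)
Definition init_state : state R n m :=
  State (x_init A) (y_init A) (l_tilde A) (l_tilde A) (mu_tilde A)
    0 false 0 0 0.

Definition y_hat (s : state R n m) : 'rV[R]_m :=
  prox (escale (sL s)^-1 (ph P)) (sy s + (sL s)^-1 *: grad_y (sx s) (sy s)).

(* Update of y_t before entering the backtracking loop.  This is a relation
   because an inexact maximiser is not unique. *)
Variant refresh (s : state R n m) : state R n m -> Prop :=
| RefreshMax y' of max_solver A & ~~ sflag s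
    & (Fmax (sx s) <= Lag (sx s) y' + (zeta A)%:E)%E :
    refresh s (State (sx s) y' (sl s) (sL s) (smu s)
      (sd s) true (sDelta s) (sLambda s) (sR s))
| RefreshKeep of max_solver A & sflag s : refresh s s
| RefreshProx of ~~ max_solver A :
    refresh s (State (sx s) (y_hat s) (sl s) (sL s) (smu s)
      (enorm (y_hat s - sy s)) true (sDelta s) (sLambda s) (sR s)).

Definition sigma (s : state R n m) : R := (sl s)^-1.

Definition tau (s : state R n m) : R :=
  (1 - gamma0 A) / sl s *
  (4 + gamma2^-1
   + 4 * (1 - sigma s * smu s) * (2 - sigma s * smu s)
       * (15 * sL s - 8 * smu s) * sL s ^+ 3 / smu s ^+ 4)^-1.

Definition x_next (s : state R n m) : 'rV[R]_n :=
  prox (escale (tau s) (pg P)) (sx s - tau s *: grad_x (sx s) (sy s)).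

Definition y_next (s : state R n m) : 'rV[R]_m :=
  prox (escale (sigma s) (ph P))
    (sy s + sigma s *: grad_y (x_next s) (sy s)).

(* Lambda depends on y_next s, hence on l: while the flag is up, it is
   recomputed at every trial, before BC is checked. *)
Definition bounds (s : state R n m) : state R n m :=
  if sflag s then
    State (sx s) (sy s) (sl s) (sL s) (smu s) (sd s) (sflag s)
      (if max_solver A then 2 * zeta A / smu s
       else min_bar ((1 + 2 * sL s / smu s) ^+ 2 * sd s ^+ 2)
                    (diam_bar ^+ 2)%E)
      (if max_solver A then
         zeta A + Num.sqrt (2 * zeta A / smu s) * sL s
                  * enorm (sy s - y_next s)
       else 2 * sd s * sL s * enorm (sy s - y_next s))
      0
  else s.

Definition normGx (s : state R n m) : R := enorm (Gx (tau s) (sx s) (sy s)).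
Definition normGy (s : state R n m) : R := enorm (Gy (sigma s) (sx s) (sy s)).
Definition normGy_next (s : state R n m) : R :=
  enorm (Gy (sigma s) (x_next s) (sy s)).

Definition BC (s : state R n m) : Prop :=
  let f := pf P in
  let x' := x_next s in
  let y := sy s in
  let y' := y_next s in
  [/\ (((tau s - (2 + (gamma A)^-1) * tau s ^+ 2 * sl s) * normGx s ^+ 2
        + sigma s * normGy s ^+ 2
        + sigma s ^+ 2 * (smu s / 2) * normGy_next s ^+ 2)%:E
       <= (sLambda s + 4 * (3 * sl s - 2 * smu s) * sDelta s)%:E
          + Lag (sx s) y - Lag x' y' + (sR s)%:E)%E,
      f x' y + dotp (grad_y x' y) (y' - y)
        <= f x' y' + sl s / 2 * enorm (y' - y) ^+ 2,
      enorm (grad_y x' y' - grad_y x' y) <= sl s * enorm (y' - y) &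
      normGy_next s ^+ 2
        <= 2 * (4 * (1 - sigma s * smu s) / sigma s ^+ 2 + 2 * sl s ^+ 2)
             * sDelta s
           + 2 * sl s ^+ 2 * tau s ^+ 2 * normGx s ^+ 2].

Definition C_coef (s : state R n m) : R :=
  (1 - sigma s * smu s) * (2 - sigma s * smu s) / (sigma s * smu s)
  * (sL s ^+ 2 / smu s ^+ 2) * tau s ^+ 2.

Definition Delta_next (s : state R n m) : R :=
  (1 - smu s * sigma s / 2) * sDelta s + C_coef s * normGx s ^+ 2.

Definition advance (s : state R n m) : state R n m :=
  State (x_next s) (y_next s) (Num.max (gamma2 * sl s) (l_tilde A))
    (sL s) (smu s) (sd s) false
    (Delta_next s)
    (6 * sl s * (Delta_next s + 2 * sDelta s) - 8 * smu s * sDelta s)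
    (2 * tau s ^+ 2 * sl s * normGx s ^+ 2
     - sigma s ^+ 2 * smu s * normGy_next s ^+ 2).

Definition shrink_step (s : state R n m) : state R n m :=
  State (sx s) (sy s) (sl s / gamma2) (sL s) (smu s)
    (sd s) (sflag s) (sDelta s) (sLambda s) (sR s).

(* The trial value of l is kept when L and mu are reset. *)
Definition enlarge (s : state R n m) : state R n m :=
  State (sx s) (sy s) (sl s) (sL s / gamma1)
    (Num.max (smu s * gamma1) mu_low)
    (sd s) (sflag s) (sDelta s) (sLambda s) (sR s).

(* search s a: from the head of the backtracking loop in state s, the
   current iteration ends with BC satisfied in state a. *)
Inductive search : state R n m -> state R n m -> Prop :=
| SearchAccept s of sl s <= sL s & BC (bounds s) : search s (bounds s)
| SearchShrink s a of sl s <= sL s & ~ BC (bounds s)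
    & search (shrink_step (bounds s)) a : search s a
| SearchReset s s' a of sL s < sl s & refresh (enlarge s) s'
    & search s' a : search s a.

(* AGDA+ completes the iterations 0, ..., T, and for t <= T the state z t holds
   the values of x_t, y_t, l_t, L_t, mu_t, ... at the moment BC(t) is
   satisfied. *)
Definition generated (T : nat) (z : nat -> state R n m) : Prop :=
  (exists2 s, refresh init_state s & search s (z 0%N)) /\
  (forall t, (t < T)%N -> search (advance (z t)) (z t.+1)).

Definition Rcal : R :=
  Num.max (Num.max (mu_tilde A / pmu P) (pL P / l_tilde A)) 1.

Definition L_bar : R := Rcal * l_tilde A.

Definition mu_bar : R := Num.max (mu_low / gamma1) (mu_tilde A / Rcal).

Definition varsigma : nat := if mu_known A then 0%N else 1%N.

Definition Lambda_bar : R :=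
  if max_solver A then
    zeta A + L_bar / Num.sqrt mu_bar * fine diam
             * Num.sqrt (2 * zeta A / gamma A ^+ (3 * rexp A))
  else 2 / gamma A ^+ rexp A * L_bar * fine diam ^+ 2.

Definition Delta_bar : R :=
  if max_solver A then 2 * zeta A / gamma A ^+ rexp A * mu_bar^-1
  else min_bar ((1 + 2 / gamma A ^+ (2 * rexp A) * (L_bar / mu_bar))
                * fine diam) diam_bar ^+ 2.

(* ceil ((log_{1/gamma} Rcal) / r) *)
Definition reset_bound : int :=
  Num.ceil ((rexp A)%:R^-1 * (ln Rcal / ln (gamma A)^-1)).

End Algorithm.
End Problem.

(* Main.v *)
Require Import Defs.
From mathcomp Require Import all_boot all_order all_algebra.
From mathcomp Require Import ring lra zify.
Import Order.TTheory GRing.Theory Num.Theory.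

(** In iteration [t] let [s = mu_t / l_t], [m = L_t / mu_t] and
    [u = |x_(t+1) - x_t|].  If [Delta_t] bounds the squared distance of [y_t]
    to the maximiser at [x_t], BC(i) and the definition of [tau_t] give, with
    the step size constant chosen so that the [u ^ 2] terms cancel exactly, a
    one-step descent of
      Lag (x_(t+1), y_(t+1)) + H Delta_(t+1) + 2 l_t u ^ 2
        + (12 l_t - 8 mu_t) Delta_t,   H = 60 L_t ^ 2 / mu_t - 32 L_t,
    and this telescopes as long as [(L_t, mu_t)] is not reset.  A reset costs
    at most [Lambda_bar], [(L_bar / gamma ^ r + L) D ^ 2] and
    [(60 L_t ^ 2 / mu_t - 38 L_t) Delta_bar].  Since BC(t) holds as soon as
    [l_t >= L_t >= L] and [mu_t <= mu], there are at most [reset_bound] resets.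

    Summing the geometric series over all epochs would exceed the asserted
    constant: in the last epoch [L_t] may overshoot [L_bar] by almost a factor
    [gamma ^ -r].  But in that epoch [L_t] and [mu_t] are valid constants of the
    problem, so that the gap [e_t = F x_t - Lag (x_t, y_t)] contracts by itself,
    and the cheaper potential
      Lag + 6 e + h mu_t Delta + rt l u ^ 2
    decreases, where [h] depends on [Rcal] rather than on [L_t].  The saving
    [- 38 L_t Delta_bar] of the earlier epochs and the remainder of the geometric
    series pay for [h]. *)

Set Implicit Arguments.
Unset Strict Implicit.
Unset Printing Implicit Defensive.
Local Open Scope ring_scope.

(** * Scalar inequalities for one iteration *)

Section Steps.
Context (R : realFieldType).
Implicit Types s m w x h l u r rb d q A D e ep Del Delp : R.

(** The obstacle in the last epoch is [s = mu_t / l_t] near 1. The [u ^ 2] terms are absorbed by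
    [BB], whose large part carries the factor [cc s]; this vanishes as [s] tends to 1 and only
    [4 + x] remains. Away from 1 the ascent [A] pays for everything ([step_good]). Near 1 a proximal
    ascent step almost solves the inner problem: the new gap is at most [l / 2 (1 - s) d ^ 2], and
    the dual terms can be charged to [Delta]. Then either the old gap pays for [A] ([step_mid]),
    which works for small [Rcal], or BC(i) bounds the step through [Lambda_t + R_t] ([step_bad]),
    where [rt = 2] pays for [R_t]. The weights [h] and [rt] are fixed during the epoch, while the
    kind of step may change at every iteration. Each [h] must also fit what the earlier epochs leave
    of the asserted constant, which depends on whether mu is known and on the number of resets;
    hence the numerical case distinctions. Since [e] contains [F x_t], the last epoch needs no
    closing jump cost, and that cost covers its initial gap instead. *)

Definition cc s : R := (1 - s) * (2 - s).
Definition BB x m s : R := 4 + x + 4 * cc s * (15 * m - 8) * m ^+ 3.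

(* In the next three lemmas [q = u ^ 2 / tau], [r = |y+ - y|], [d] is the
   distance from [y] to the maximiser at [x+], [D = Lag (x, y) - Lag (x+, y)],
   [A = Lag (x+, y+) - Lag (x+, y)], [e] and [ep] are the gaps before and after
   the step, and the Lipschitz constant is written [w * s * l]. *)
Lemma step_good s m w x h rt l u r rb d q A D e ep Del Delp :
  0 < s < 1 -> 0 < l -> 0 <= h -> 0 <= Del -> 0 <= r -> 0 <= rb -> 0 <= u ->
  0 <= w ->
  q - w * s * l / 2 * u ^+ 2 <= D ->
  ep <= e + w * s * l * u * d - A ->
  l / 2 * r ^+ 2 <= A -> s * (s * l / 2) * d ^+ 2 <= A ->
  rb <= r + w * s * u ->
  Delp = (1 - s / 2) * Del + cc s / s * m ^+ 2 * u ^+ 2 ->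
  w * s / 2 + 3 * (w * s) ^+ 2 + 18 * w ^+ 2 / (2 - s) + rt + h * cc s * m ^+ 2
    <= BB x m s ->
  q - l * BB x m s * u ^+ 2 + l * rb ^+ 2 + s * l / 2 * r ^+ 2
    + (A - D) + 6 * ep + h * (s * l) * Delp + rt * l * u ^+ 2
  <= 6 * e + h * (s * l) * Del.
Proof.
move=> /andP[s0 s1] l0 h0 Del0 r0 rb0 u0 w0 hD hep hr hd hrb ->.
have s2 : 0 < 2 - s by lra.
have wsu : 0 <= w * s * u by rewrite !mulr_ge0 // ltW.
(* With the split 3/2 and 3, [l * rb ^+ 2] costs three copies of [l / 2 * r ^+ 2], that is [3 A]. *)
have Arb : rb ^+ 2 <= 3 / 2 * r ^+ 2 + 3 * (w * s * u) ^+ 2.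
  have h1 : rb ^+ 2 <= (r + w * s * u) ^+ 2.
    by rewrite ler_sqr ?nnegrE // addr_ge0.
  have h2 := sqr_ge0 (r - 2 * (w * s * u)).
  lra.
have ccs : s * (cc s / s) = cc s by rewrite mulrC divfK ?gt_eqF.
set y := cc s / s in ccs *; set b := BB x m s; set c := cc s in ccs *.
have zE : (18 * w ^+ 2 / (2 - s)) * (2 - s) = 18 * w ^+ 2 by rewrite divfK ?gt_eqF.
set z := 18 * w ^+ 2 / (2 - s) in zE *; move=> hB.
(* Young's inequality with the share [(2 - s) A]. Together [A] and [6 ep] leave [- 5 A] to spend:
   [3 A] for [rb], [s A] for [r] and [(2 - s) A] here. This is why the gap has weight 6. *)
have hcross : 6 * (w * s * l * u * d) <=
    (2 - s) * (s * (s * l / 2)) * d ^+ 2 + l * z * u ^+ 2.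
  rewrite -(ler_pM2l s2) -subr_ge0.
  have -> : (2 - s) * ((2 - s) * (s * (s * l / 2)) * d ^+ 2 + l * z * u ^+ 2) -
      (2 - s) * (6 * (w * s * l * u * d)) =
      l / 2 * ((2 - s) * s * d - 6 * w * u) ^+ 2
      + l * u ^+ 2 * (z * (2 - s) - 18 * w ^+ 2) by field.
  by rewrite zE subrr mulr0 addr0 mulr_ge0 ?sqr_ge0 // divr_ge0 // ltW.
have k1 : (2 - s) * (s * (s * l / 2) * d ^+ 2) <= (2 - s) * A.
  by rewrite ler_wpM2l // ltW.
have k2 : l * rb ^+ 2 <= l * (3 / 2 * r ^+ 2 + 3 * (w * s * u) ^+ 2).
  by rewrite ler_wpM2l // ltW.
have k3 : s * (l / 2 * r ^+ 2) <= s * A by rewrite ler_wpM2l // ltW.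
have k4 := ler_wpM2l (mulr_ge0 (ltW l0) (sqr_ge0 u)) hB.
have k5 : 0 <= h * (s * l) * (s / 2) * Del.
  by rewrite !mulr_ge0 // ?invr_ge0 ltW.
have k6 : h * (s * l) * (y * m ^+ 2 * u ^+ 2) = h * l * c * m ^+ 2 * u ^+ 2.
  by rewrite -ccs; ring.
rewrite [h * (s * l) * (_ + _)]mulrDr k6; lra.
Qed.

(** Here [A] is bounded from above by the old gap, which [6 e] covers. All remaining dual lengths
    are bounded by [Del] and [u ^+ 2], and the decrease [h s ^ 2 / 2] of the [Delta] term pays for
    the [Del] part. *)
Lemma step_mid s m w x h l u r rb d q A D e ep Del Delp :
  0 < s < 1 -> 0 < l -> 0 <= h -> 0 <= e -> 0 <= w ->
  q - w * s * l / 2 * u ^+ 2 <= D ->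
  A <= e + w * s * l * u * r ->
  ep <= l / 2 * (1 - s) * d ^+ 2 -> d ^+ 2 <= 2 * (Del + w ^+ 2 * u ^+ 2) ->
  rb ^+ 2 <= (1 + w * s) ^+ 2 * Del ->
  r ^+ 2 <= (12 - 8 * s) * Del + 2 * u ^+ 2 -> 0 <= Del ->
  Delp = (1 - s / 2) * Del + cc s / s * m ^+ 2 * u ^+ 2 ->
  s + 2 * (w * s) + 6 * (1 - s) * w ^+ 2 + h * cc s * m ^+ 2 <= BB x m s ->
  (1 + w * s) ^+ 2 + 6 * s - 4 * s ^+ 2 + w * s * (3 - 2 * s) + 6 * (1 - s)
    <= h * s ^+ 2 / 2 ->
  q - l * BB x m s * u ^+ 2 + l * rb ^+ 2 + s * l / 2 * r ^+ 2
    + (A - D) + 6 * ep + h * (s * l) * Delp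
  <= 6 * e + h * (s * l) * Del.
Proof.
move=> /andP[s0 s1] l0 h0 e0 w0 hD hA hep hd hrb hr Del0 ->.
have ccs : s * (cc s / s) = cc s by rewrite mulrC divfK ?gt_eqF.
set y := cc s / s in ccs *; set b := BB x m s; set c := cc s in ccs * => hB hX.
have hs : 0 <= 1 - s by rewrite subr_ge0 ltW.
have sl0 : 0 <= s * l by rewrite mulr_ge0 // ltW.
have wsl0 : 0 <= w * s * l by rewrite -mulrA mulr_ge0.
have k1 : w * s * l * u * r <= w * s * l * (u ^+ 2 + r ^+ 2 / 4).
  rewrite -[_ * u * r]mulrA; apply: ler_wpM2l => //.
  have := sqr_ge0 (u - r / 2); lra.
have k2 : w * s * l / 4 * r ^+ 2 <= w * s * l / 4 * ((12 - 8 * s) * Del + 2 * u ^+ 2).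
  by apply: ler_wpM2l => //; rewrite divr_ge0.
have k3 : s * l / 2 * r ^+ 2 <= s * l / 2 * ((12 - 8 * s) * Del + 2 * u ^+ 2).
  by apply: ler_wpM2l => //; rewrite divr_ge0.
have k4 : l * rb ^+ 2 <= l * ((1 + w * s) ^+ 2 * Del) by rewrite ler_wpM2l // ltW.
have k5 : 6 * (l / 2 * (1 - s) * d ^+ 2)
    <= 6 * (l / 2 * (1 - s) * (2 * (Del + w ^+ 2 * u ^+ 2))).
  by rewrite ler_wpM2l // ler_wpM2l // mulr_ge0 ?divr_ge0 // ltW.
have k6 : h * (s * l) * (y * m ^+ 2 * u ^+ 2) = h * l * c * m ^+ 2 * u ^+ 2.
  by rewrite -ccs; ring.
have k7 := ler_wpM2l (mulr_ge0 (ltW l0) (sqr_ge0 u)) hB.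
have k8 := ler_wpM2l (mulr_ge0 (ltW l0) Del0) hX.
rewrite [h * (s * l) * (_ + _)]mulrDr k6; lra.
Qed.

(** BC(i) cancels [A - D], so the old gap does not occur on the right. The term [2 * l * u ^+ 2]
    kept on the left becomes the [Z] of the next step, where it pays for the positive part of
    [R]. *)
Lemma step_bad s m w x h l u r rb d q A D ep Del Delp LR Z :
  0 < s < 1 -> 0 < l -> 0 <= Del -> 0 <= m -> 0 <= w <= m ->
  q - (2 + x) * l * u ^+ 2 + l * rb ^+ 2 + s * l / 2 * r ^+ 2
    <= LR + 4 * (3 * l - 2 * (s * l)) * Del + (D - A) ->
  LR <= Z + (18 * x - 2 * s) * l * Del ->
  ep <= l / 2 * (1 - s) * d ^+ 2 -> d ^+ 2 <= 2 * (Del + w ^+ 2 * u ^+ 2) ->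
  Delp = (1 - s / 2) * Del + cc s / s * m ^+ 2 * u ^+ 2 ->
  6 + h <= 4 * (15 * m - 8) * m ->
  18 * x + 18 - 16 * s <= h * s ^+ 2 / 2 ->
  q - l * BB x m s * u ^+ 2 + l * rb ^+ 2 + s * l / 2 * r ^+ 2
    + (A - D) + 6 * ep + h * (s * l) * Delp + 2 * l * u ^+ 2
  <= Z + h * (s * l) * Del.
Proof.
move=> /andP[s0 s1] l0 Del0 m0 /andP[w0 wm] hi hLR hep hd -> hm hX.
have ccs : s * (cc s / s) = cc s by rewrite mulrC divfK ?gt_eqF.
have c0 : 0 <= cc s by rewrite /cc mulr_ge0 //; lra.
rewrite /BB; set y := cc s / s in ccs *.
have hs : 0 <= 1 - s by rewrite subr_ge0 ltW.
have k5 : 6 * (l / 2 * (1 - s) * d ^+ 2)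
    <= 6 * (l / 2 * (1 - s) * (2 * (Del + w ^+ 2 * u ^+ 2))).
  by rewrite ler_wpM2l // ler_wpM2l // mulr_ge0 ?divr_ge0 // ltW.
have k6 : h * (s * l) * (y * m ^+ 2 * u ^+ 2) = h * l * cc s * m ^+ 2 * u ^+ 2.
  by rewrite -ccs; ring.
have hw : w ^+ 2 <= m ^+ 2 by rewrite ler_sqr ?nnegrE // (le_trans w0).
have k7 : 6 * (1 - s) * w ^+ 2 + h * cc s * m ^+ 2
    <= 4 * cc s * (15 * m - 8) * m ^+ 3.
  have a1 : 6 * (1 - s) * w ^+ 2 <= 6 * cc s * m ^+ 2.
    apply: (@le_trans _ _ (6 * (1 - s) * m ^+ 2)).
      by rewrite ler_wpM2l // mulr_ge0.
    rewrite ler_wpM2r ?sqr_ge0 // ler_wpM2l // /cc ler_peMr //; lra.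
  have a2 := ler_wpM2l (mulr_ge0 c0 (sqr_ge0 m)) hm.
  lra.
have k8 := ler_wpM2l (mulr_ge0 (ltW l0) Del0) hX.
have k9 := ler_wpM2l (mulr_ge0 (ltW l0) (sqr_ge0 u)) k7.
rewrite [h * (s * l) * (_ + _)]mulrDr k6; lra.
Qed.
End Steps.

(** * Numerical conditions on the weights of the last epoch *)

Section Numeric.
Context (R : realFieldType).
Implicit Types s m w x h t rt : R.

(** [condG], [condI] and [condD] collect the conditions on the weights in [step_good], [step_mid]
    and [step_bad]. *)
Definition condG s m w x h rt :=
  w * s / 2 + 3 * (w * s) ^+ 2 + 18 * w ^+ 2 / (2 - s) + rt + h * cc s * m ^+ 2
    <= BB x m s.

Definition condI s m w x h :=
  s + 2 * (w * s) + 6 * (1 - s) * w ^+ 2 + h * cc s * m ^+ 2 <= BB x m s /\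
  (1 + w * s) ^+ 2 + 6 * s - 4 * s ^+ 2 + w * s * (3 - 2 * s) + 6 * (1 - s)
    <= h * s ^+ 2 / 2.

Definition condD s m x h :=
  6 + h <= 4 * (15 * m - 8) * m /\ 18 * x + 18 - 16 * s <= h * s ^+ 2 / 2.

(** Makes the second half of [condI] hold for [s >= 7 / 10] coefficient by coefficient in [w]: the
    [w ^ 2] terms agree, and there remain [5 s <= 7.15 s ^ 2] and [7 <= 14.3 s ^ 2], both nearly
    tight at [s = 7 / 10]. *)
Definition hI w : R := 2 * w ^+ 2 + 103 / 10 * w + 206 / 10.

(** For [s <= 7 / 10] one has [cc s >= 39 / 100] and [m >= 10 / 7], so the quartic part of [BB]
    dominates even after [w] is replaced by [m]. The polynomial [58 m ^ 2 - 423 / 10 m - 206 / 10]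
    is [60 m ^ 2 - 32 m - hI m]. *)
Lemma condG_slow s m w x : 0 < s <= 7 / 10 -> 1 <= m * s -> 0 <= w <= m -> 1 <= x ->
  condG s m w x (hI w) 0.
Proof.
move=> /andP[s0 s7] ms /andP[w0 wm] x1.
have m0 : 0 <= m by lra.
have m1 : 10 / 7 <= m.
  have : m * s <= m * (7 / 10) by rewrite ler_wpM2l.
  lra.
have c39 : 39 / 100 <= cc s by rewrite /cc; nra.
have P0 : 0 <= 58 * m ^+ 2 - 423 / 10 * m - 206 / 10 by nra.
have wm2 : w ^+ 2 <= m ^+ 2 by rewrite ler_sqr ?nnegrE.
have a1 : w * s / 2 <= 7 / 20 * m.
  have : w * s <= m * (7 / 10) by rewrite ler_pM // ltW.
  lra.
have a2 : 3 * (w * s) ^+ 2 <= 147 / 100 * m ^+ 2.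
  rewrite exprMn.
  have : w ^+ 2 * s ^+ 2 <= m ^+ 2 * (7 / 10) ^+ 2.
    by rewrite ler_pM ?sqr_ge0 // ler_sqr ?nnegrE //; lra.
  lra.
have a3 : 18 * w ^+ 2 / (2 - s) <= 1386 / 100 * m ^+ 2.
  rewrite ler_pdivrMr; last lra.
  have : 1386 / 100 * m ^+ 2 * (13 / 10) <= 1386 / 100 * m ^+ 2 * (2 - s).
    by rewrite ler_wpM2l ?mulr_ge0 ?sqr_ge0 //; lra.
  have := sqr_ge0 m; lra.
have hm : hI w <= hI m by rewrite /hI; lra.
have a4 : hI w * cc s * m ^+ 2 <= hI m * cc s * m ^+ 2.
  by rewrite ler_wpM2r ?sqr_ge0 // ler_wpM2r //; lra.
have a5 : 39 / 100 * m ^+ 2 * (58 * m ^+ 2 - 423 / 10 * m - 206 / 10)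
   <= cc s * m ^+ 2 * (58 * m ^+ 2 - 423 / 10 * m - 206 / 10).
  by rewrite ler_wpM2r // ler_wpM2r ?sqr_ge0.
have a6 : 1533 / 100 * m ^+ 2 + 7 / 20 * m - 5 <=
   39 / 100 * m ^+ 2 * (58 * m ^+ 2 - 423 / 10 * m - 206 / 10).
  (* In [t = m - 10 / 7] the difference of the two sides has only nonnegative coefficients. *)
  have [t t0 ->] : exists2 t, 0 <= t & m = 10 / 7 + t.
    by exists (m - 10 / 7); lra.
  have t2 := mulr_ge0 t0 t0; have t3 := mulr_ge0 t2 t0; have t4 := mulr_ge0 t3 t0.
  lra.
by rewrite /condG /BB; rewrite /hI in a4 hm *; lra.
Qed.

(** The bound on [w s] is what [4 + x] can still cover when [cc s] vanishes:
    [s + 2 w s <= 4 + x]. *)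
Lemma condI_fast s m w x : 7 / 10 <= s < 1 -> 1 <= m * s -> 0 <= w <= m -> 1 <= x ->
  2 * (w * s) <= 3 + x -> condI s m w x (hI w).
Proof.
move=> /andP[s7 s1] ms /andP[w0 wm] x1 hK.
have s0 : 0 <= s by lra.
have hs : 0 <= 1 - s by lra.
have m0 : 0 <= m.
  rewrite leNgt; apply/negP => m0; have : m * s <= 0 by rewrite mulr_le0_ge0 // ltW.
  lra.
have m1 : 1 <= m.
  have : m * s <= m * 1 by rewrite ler_wpM2l // ltW.
  lra.
have wm2 : w ^+ 2 <= m ^+ 2 by rewrite ler_sqr ?nnegrE.
have c0 : 0 <= cc s by rewrite /cc mulr_ge0 //; lra.
split; last first.
  rewrite /hI.
  have : 0 <= w * (s * (715 / 100 * s - 5)) by rewrite mulr_ge0 // mulr_ge0 //; lra.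
  have : 7 <= 143 / 10 * s ^+ 2 by nra.
  lra.
have hm : hI w <= hI m by rewrite /hI; lra.
have a4 : hI w * cc s * m ^+ 2 <= hI m * cc s * m ^+ 2.
  by rewrite ler_wpM2r ?sqr_ge0 // ler_wpM2r.
have a1 : 6 * (1 - s) * w ^+ 2 <= 6 * (1 - s) * m ^+ 2 by rewrite ler_wpM2l // mulr_ge0.
rewrite /BB; set P := 58 * m ^+ 2 - 423 / 10 * m - 206 / 10.
have -> : 4 * cc s * (15 * m - 8) * m ^+ 3 = cc s * m ^+ 2 * P + hI m * cc s * m ^+ 2.
  by rewrite /P /hI; field.
suff : s + 2 * (w * s) + 6 * (1 - s) * m ^+ 2 <= 4 + x + cc s * m ^+ 2 * P by lra.
have [m14|m14] := leP (114 / 100) m.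
  have P6 : 6 <= P by rewrite /P; nra.
  have b1 : cc s * m ^+ 2 * 6 <= cc s * m ^+ 2 * P.
    by rewrite ler_wpM2l // mulr_ge0 ?sqr_ge0.
  have b2 : (1 - s) * m ^+ 2 <= cc s * m ^+ 2.
    by rewrite ler_wpM2r ?sqr_ge0 // /cc ler_peMr //; lra.
  lra.
have c1 : 2 * (w * s) <= 228 / 100.
  have : w * s <= m * 1 by rewrite ler_pM // ltW.
  lra.
(* Since [1 <= m * s], a ratio [m] near 1 forces [s] near 1; a negative [P] is then harmless because
   [cc s] is small. *)
have c2 : 1 - s <= (m - 1) by have := ler_wpM2r s0 (ltW m14); nra.
have mm : m ^+ 2 <= 13 / 10 by nra.
have c3 : 6 * (1 - s) * m ^+ 2 <= 78 / 10 * (1 - s) by nra.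
have [m06|m06] := leP (1064 / 1000) m.
  have P1 : 0 <= P by rewrite /P; nra.
  have : 0 <= cc s * m ^+ 2 * P by apply: mulr_ge0 => //; apply: mulr_ge0; rewrite ?sqr_ge0.
  lra.
have P1 : - 49 / 10 <= P by rewrite /P; nra.
have d1 : cc s <= 13 / 10 * (1 - s) by rewrite /cc mulrC ler_wpM2r //; lra.
have d2 : cc s * m ^+ 2 <= 13 / 10 * (1 - s) * (13 / 10) by rewrite ler_pM ?sqr_ge0.
have d3 : cc s * m ^+ 2 * (- 49 / 10) <= cc s * m ^+ 2 * P.
  by rewrite ler_wpM2l // mulr_ge0 ?sqr_ge0.
lra.
Qed.

End Numeric.

Section Numeric2.
Context (R : realFieldType).
Implicit Types s m w x h t rt : R.

(** If [condG] fails, then [cc s], hence [t = 1 - s], is of order [1 / m ^ 2], and for [s] this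
    close to 1 the weight [72 r - 60] beats [18 x + 2] by a fixed margin. *)
Lemma condG_or_D1 s m w x r : 0 < s < 1 -> 2 <= r -> r <= m -> 0 <= w <= m -> 1 <= x ->
  x <= 2 * r - 3 ->
  condG s m w x (72 * r - 60) 2 \/ condD s m x (72 * r - 60).
Proof.
move=> /andP[s0 s1] r2 rm /andP[w0 wm] x1 xr.
have [|nG] := boolP (w * s / 2 + 3 * (w * s) ^+ 2 + 18 * w ^+ 2 / (2 - s) + 2
   + (72 * r - 60) * cc s * m ^+ 2 <= BB x m s); first by left.
right; rewrite -ltNge in nG; split; first nra.
have m0 : 0 <= m by lra.
have wm2 : w ^+ 2 <= m ^+ 2 by rewrite ler_sqr ?nnegrE.
have a1 : w * s <= m * 1 by rewrite ler_pM // ltW.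
have a2 : (w * s) ^+ 2 <= m ^+ 2.
  by rewrite ler_sqr ?nnegrE //; [lra|rewrite mulr_ge0 // ltW].
have a3 : 18 * w ^+ 2 / (2 - s) <= 18 * m ^+ 2.
  rewrite ler_pdivrMr; last lra.
  have : 18 * m ^+ 2 * 1 <= 18 * m ^+ 2 * (2 - s).
    by rewrite ler_wpM2l ?mulr_ge0 ?sqr_ge0 //; lra.
  lra.
have m2 : 0 < m ^+ 2 by rewrite exprn_gt0 //; lra.
(* [85 / 4 = 1 / 4 + 3 + 18] bounds the [u ^ 2] terms without [h], in units of [m ^ 2]. *)
have a4 : cc s * (60 * m ^+ 2 - 32 * m - (72 * r - 60)) < 85 / 4.
  rewrite -(ltr_pM2l m2); move: nG; rewrite /BB => nG.
  have : m / 2 <= m ^+ 2 / 4 by nra.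
  lra.
have c0 : 0 <= cc s by rewrite /cc mulr_ge0 //; lra.
set t := 1 - s; have t0 : 0 < t by rewrite /t; lra.
have ct : cc s = t * (1 + t) by rewrite /cc /t; ring.
have a5 : t * (1 + t) * (60 * r ^+ 2 - 104 * r + 60) < 85 / 4.
  rewrite -ct; apply: le_lt_trans a4; rewrite ler_wpM2l //; nra.
have st : s = 1 - t by rewrite /t; ring.
(* For [x = 2 r - 3] the second half of [condD] reads [t (72 r - 44) <= 22 + t ^ 2 (36 r - 30)]. The
   opposite case contradicts the upper bound on [cc s]. *)
have [tt|tt] := leP (t * (72 * r - 44)) 22; first by rewrite st; nra.
exfalso.
have q0 : 0 < 72 * r - 44 by lra.
have e1 : 22 * (72 * r - 22) <= t * (1 + t) * (72 * r - 44) ^+ 2.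
  have : 22 * (72 * r - 44 + 22) <= (t * (72 * r - 44)) * (72 * r - 44 + t * (72 * r - 44)).
    by rewrite ler_pM //; lra.
  lra.
have Q0 : 0 <= 60 * r ^+ 2 - 104 * r + 60 by nra.
have e2 := ler_wpM2r Q0 e1.
have e3 : t * (1 + t) * (60 * r ^+ 2 - 104 * r + 60) * (72 * r - 44) ^+ 2
   <= 85 / 4 * (72 * r - 44) ^+ 2 by rewrite ler_wpM2r ?sqr_ge0 // ltW.
have : 85 / 4 * (72 * r - 44) ^+ 2 < 22 * (72 * r - 22) * (60 * r ^+ 2 - 104 * r + 60).
  have [v v0 ->] : exists2 v, 0 <= v & r = 2 + v by exists (r - 2); lra.
  have v2 := mulr_ge0 v0 v0; have v3 := mulr_ge0 v2 v0.
  lra.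
lra.
Qed.

End Numeric2.

Section Numeric2.
Context (R : realFieldType).
Implicit Types s m w x h t rt : R.

(** The second half of [condD] for the weight [38 r + 35] at [r = 2 + v] and [x = 2 r - 3]. *)
Lemma quad_aux t v : 0 <= t -> 0 <= v -> v < 1 ->
  t * (1 + t) * (65 + 170 * v) <= 85 / 4 ->
  0 <= 71 / 2 - 17 * v - t * (127 + 38 * v) + t ^+ 2 * (111 / 2 + 19 * v).
Proof.
move=> t0 v0 v1 ht.
(* The constraint is monotone in [t] and [v], so a lower bound on [v] caps [t]. A staircase of such
   caps makes the claim linear on each piece. *)
have cap a b : 0 <= a -> 0 <= b -> 85 / 4 < b * (1 + b) * (65 + 170 * a) ->
    a <= v -> t <= b.
  move=> a0 b0 hb av; rewrite leNgt; apply/negP => h; move: hb; rewrite ltNge => /negP; apply.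
  apply: le_trans ht; apply: ler_pM; rewrite ?mulr_ge0 ?addr_ge0 ?mulr_ge0 //.
    by apply: ler_pM; rewrite ?addr_ge0 ?lerD2l ?(ltW h).
  by rewrite lerD2l ler_wpM2l.
have c1 : t <= 26 / 100 by apply: (cap 0) => //; lra.
have t20 : 0 <= t ^+ 2 * (111 / 2 + 19 * v) by rewrite mulr_ge0 ?sqr_ge0 //; lra.
have t65 : t * (65 + 170 * v) <= 85 / 4.
  apply: le_trans ht; rewrite ler_wpM2r ?ler_peMr ?lerDl ?addr_ge0 ?mulr_ge0 //.
clear ht; have [w1|w1] := leP v (8 / 100); first lra.
have [w2|w2] := leP v (28 / 100).
  have : t <= 23 / 100 by apply: (cap (8 / 100)); lra.
  lra.
have [w3|w3] := leP v (68 / 100).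
  have : t <= 17 / 100 by apply: (cap (28 / 100)); lra.
  lra.
have : t <= 12 / 100 by apply: (cap (68 / 100)); lra.
lra.
Qed.

(** The same dichotomy for a smaller weight, namely the one that the budget [38 (1 + r)] affords
    after at least two resets: [35 + 5 / 2 <= 38]. *)
Lemma condG_or_D2 s m w x r : 0 < s < 1 -> 2 <= r -> r <= m -> 0 <= w <= m -> 1 <= x ->
  x <= r -> x <= 2 * r - 3 \/ 3 <= r ->
  condG s m w x (38 * r + 35) 2 \/ condD s m x (38 * r + 35).
Proof.
move=> /andP[s0 s1] r2 rm /andP[w0 wm] x1 xr xr'.
have [|nG] := boolP (w * s / 2 + 3 * (w * s) ^+ 2 + 18 * w ^+ 2 / (2 - s) + 2
   + (38 * r + 35) * cc s * m ^+ 2 <= BB x m s); first by left.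
right; rewrite -ltNge in nG; split; first nra.
have m0 : 0 <= m by lra.
have wm2 : w ^+ 2 <= m ^+ 2 by rewrite ler_sqr ?nnegrE.
have a1 : w * s <= m * 1 by rewrite ler_pM // ltW.
have a2 : (w * s) ^+ 2 <= m ^+ 2.
  by rewrite ler_sqr ?nnegrE //; [lra|rewrite mulr_ge0 // ltW].
have a3 : 18 * w ^+ 2 / (2 - s) <= 18 * m ^+ 2.
  rewrite ler_pdivrMr; last lra.
  have : 18 * m ^+ 2 * 1 <= 18 * m ^+ 2 * (2 - s).
    by rewrite ler_wpM2l ?mulr_ge0 ?sqr_ge0 //; lra.
  lra.
have m2 : 0 < m ^+ 2 by rewrite exprn_gt0 //; lra.
have a4 : cc s * (60 * m ^+ 2 - 32 * m - (38 * r + 35)) < 85 / 4.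
  rewrite -(ltr_pM2l m2); move: nG; rewrite /BB => nG.
  have : m / 2 <= m ^+ 2 / 4 by nra.
  lra.
have c0 : 0 <= cc s by rewrite /cc mulr_ge0 //; lra.
set t := 1 - s; have t0 : 0 < t by rewrite /t; lra.
have ct : cc s = t * (1 + t) by rewrite /cc /t; ring.
have a5 : t * (1 + t) * (60 * r ^+ 2 - 70 * r - 35) < 85 / 4.
  rewrite -ct; apply: le_lt_trans a4; rewrite ler_wpM2l //; nra.
have st : s = 1 - t by rewrite /t; ring.
have r20 : 0 < r by lra.
have Q0 : 0 < 60 * r ^+ 2 - 70 * r - 35 by nra.
have [r3|r3] := leP 3 r.
  have Q1 : 97 * r <= 60 * r ^+ 2 - 70 * r - 35 by nra.
  have t1 : t * (97 * r) <= 85 / 4.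
    apply: le_trans (ltW a5); apply: ler_pM => //; [lra|lra|].
    by rewrite ler_peMr //; lra.
  have : 0 <= t ^+ 2 * (19 * r + 35 / 2) by rewrite mulr_ge0 ?sqr_ge0 //; lra.
  have : t * 51 <= t * (17 * r) by rewrite ler_wpM2l; lra.
  rewrite st; lra.
have xr2 : x <= 2 * r - 3 by case: xr' => // ?; lra.
(* Tangent at [r = 2] of a convex quadratic. *)
have Q1 : 65 + 170 * (r - 2) <= 60 * r ^+ 2 - 70 * r - 35 by nra.
have t1 : t * (1 + t) * (65 + 170 * (r - 2)) <= 85 / 4.
  apply: le_trans (ltW a5); apply: ler_wpM2l => //; rewrite mulr_ge0 //; lra.
have t_ge0 := ltW t0; have v0 : 0 <= r - 2 by rewrite subr_ge0.
have v1 : r - 2 < 1 by lra.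
have := quad_aux t_ge0 v0 v1 t1; rewrite st; move: xr2; clear; lra.
Qed.
End Numeric2.

From mathcomp Require Import all_classical all_reals all_analysis.
Import numFieldNormedType.Exports.
Local Open Scope classical_set_scope.
Local Open Scope ring_scope.

(** * Euclidean norm *)

Section Euclid.
Context (R : realType) (k : nat).
Implicit Types (u v w : 'rV[R]_k) (a : R).

Lemma dotpC u v : dotp u v = dotp v u.
Proof. by apply: eq_bigr => i _; rewrite mulrC. Qed.

Lemma dotpDl u v w : dotp (u + v) w = dotp u w + dotp v w.
Proof.
by rewrite -big_split; apply: eq_bigr => i _; rewrite mxE mulrDl.
Qed.

Lemma dotpZl a u v : dotp (a *: u) v = a * dotp u v.
Proof. by rewrite mulr_sumr; apply: eq_bigr => i _; rewrite mxE mulrA. Qed.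

Lemma dotpNl u v : dotp (- u) v = - dotp u v.
Proof. by rewrite -scaleN1r dotpZl mulN1r. Qed.

Lemma dotpBl u v w : dotp (u - v) w = dotp u w - dotp v w.
Proof. by rewrite dotpDl dotpNl. Qed.

Lemma dotpDr u v w : dotp u (v + w) = dotp u v + dotp u w.
Proof. by rewrite dotpC dotpDl ![dotp _ u]dotpC. Qed.

Lemma dotpZr a u v : dotp u (a *: v) = a * dotp u v.
Proof. by rewrite dotpC dotpZl dotpC. Qed.

Lemma dotpNr u v : dotp u (- v) = - dotp u v.
Proof. by rewrite dotpC dotpNl dotpC. Qed.

Lemma dotpBr u v w : dotp u (v - w) = dotp u v - dotp u w.
Proof. by rewrite dotpDr dotpNr. Qed.

Definition dotpE := (dotpDl, dotpDr, dotpBl, dotpBr, dotpNl, dotpNr, dotpZl, dotpZr).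

Lemma dotpp_ge0 u : 0 <= dotp u u.
Proof. by apply: sumr_ge0 => i _; rewrite -expr2 sqr_ge0. Qed.

Lemma enorm_ge0 u : 0 <= enorm u.
Proof. exact: sqrtr_ge0. Qed.

Lemma sqr_enorm u : enorm u ^+ 2 = dotp u u.
Proof. by rewrite sqr_sqrtr // dotpp_ge0. Qed.

Lemma enorm_le u a : 0 <= a -> dotp u u <= a ^+ 2 -> enorm u <= a.
Proof. by move=> a0 h; rewrite -(ler_sqr (enorm_ge0 u) a0) sqr_enorm. Qed.

Lemma dotp_le u v : dotp u v <= enorm u * enorm v.
Proof.
have [v0|v0] := eqVneq (dotp v v) 0.
  suff -> : dotp u v = 0 by rewrite mulr_ge0 ?enorm_ge0.
  apply: big1 => i _.
  have /psumr_eq0P/(_ i isT)/eqP : \sum_(j < k) v 0 j * v 0 j = 0 by [].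
  rewrite -expr2 sqrf_eq0 => h.
  by rewrite (eqP (h _)) ?mulr0 // => j _; rewrite -expr2 sqr_ge0.
have vp : 0 < dotp v v by rewrite lt_def v0 dotpp_ge0.
apply: le_trans (ler_norm _) _.
rewrite -ler_sqr ?nnegrE ?mulr_ge0 ?enorm_ge0 //.
rewrite exprMn !sqr_enorm real_normK ?num_real //.
have := dotpp_ge0 (dotp v v *: u - dotp u v *: v).
rewrite !dotpE (dotpC v u) => h.
by rewrite -subr_ge0 -(pmulr_rge0 _ vp); lra.
Qed.

Lemma enormN u : enorm (- u) = enorm u.
Proof. by rewrite /enorm dotpNl dotpNr opprK. Qed.

Lemma enormBC u v : enorm (u - v) = enorm (v - u).
Proof. by rewrite -enormN opprB. Qed.

Lemma ler_enormD u v : enorm (u + v) <= enorm u + enorm v.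
Proof.
apply: enorm_le; first by rewrite addr_ge0 ?enorm_ge0.
by rewrite sqrrD !sqr_enorm !dotpE (dotpC v u); have := dotp_le u v; lra.
Qed.

Lemma ler_enormB u v w : enorm (u - w) <= enorm (u - v) + enorm (v - w).
Proof. by have := ler_enormD (u - v) (v - w); rewrite addrA subrK. Qed.

Lemma enormZ a u : enorm (a *: u) = `|a| * enorm u.
Proof.
by rewrite /enorm dotpZl dotpZr mulrA -expr2 sqrtrM ?sqr_ge0 // sqrtr_sqr.
Qed.

Lemma enorm0 : enorm (0 : 'rV[R]_k) = 0.
Proof. by rewrite -(scale0r 0) enormZ normr0 mul0r. Qed.

Lemma enorm_eq0 u : enorm u = 0 -> u = 0.
Proof.
move=> h; have : dotp u u = 0 by rewrite -sqr_enorm h expr0n.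
move=> /psumr_eq0P => {}h; apply/rowP => i; rewrite mxE.
apply/eqP; rewrite -sqrf_eq0 expr2; apply/eqP; apply: h => // j _.
by rewrite -expr2 sqr_ge0.
Qed.

Lemma normr_le_enorm u : `|u| <= enorm u.
Proof.
rewrite [X in X <= _]mx_normrE; apply/bigmax_leP; split => [|[i j] _] /=.
  exact: enorm_ge0.
rewrite ord1 -ler_sqr ?nnegrE ?enorm_ge0 ?normr_ge0 //.
rewrite sqr_enorm real_normK ?num_real // /dotp (bigD1 j) //= -expr2 lerDl.
by apply: sumr_ge0 => l _; rewrite -expr2 sqr_ge0.
Qed.

Lemma enorm_le_normr u : enorm u <= Num.sqrt k%:R * `|u|.
Proof.
apply: enorm_le; first by rewrite mulr_ge0 ?sqrtr_ge0.
rewrite exprMn sqr_sqrtr ?ler0n // mulr_natl.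
rewrite -[X in _ <= _ *+ X](card_ord k) -sumr_const; apply: ler_sum => i _.
rewrite -expr2 -(real_normK (num_real (u 0 i))) ler_sqr ?nnegrE //.
by rewrite [X in _ <= X]mx_normrE; apply/bigmax_geP; right => /=; exists (0, i).
Qed.
End Euclid.

(** * Minimisers of closed strongly convex functions *)

Section ClosedConvex.
Context (R : realType) (k : nat) (p : 'rV[R]_k -> \bar R).
Hypothesis hp : proper_closed_convex p.
Implicit Types (u v w y z : 'rV[R]_k) (a t : R).

Lemma dom_fineK y : dom p y -> p y = (fine (p y))%:E.
Proof.
case: hp => [[pN _] _ _]; rewrite /dom /= => py; rewrite fineK //.
by rewrite fin_numElt pN py.
Qed.

Lemma dom_le y a : (p y <= a%:E)%E -> dom p y.
Proof. by move=> /le_lt_trans; apply; rewrite ltry. Qed.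

Lemma fine_convex y z t : dom p y -> dom p z -> 0 <= t <= 1 ->
  dom p (t *: y + (1 - t) *: z) /\
  fine (p (t *: y + (1 - t) *: z)) <= t * fine (p y) + (1 - t) * fine (p z).
Proof.
move=> Dy Dz t01; case: (hp) => [_ _ /(_ y z t t01)].
rewrite (dom_fineK Dy) (dom_fineK Dz) -!EFinM -EFinD => h.
have D := dom_le h; split => //; move: h.
by rewrite (dom_fineK D) lee_fin.
Qed.

Lemma lsc_enorm y a : (a%:E < p y)%E -> exists2 e, 0 < e &
  forall z, enorm (z - y) < e -> (a%:E < p z)%E.
Proof.
move=> ay; case: (hp) => [_ /(_ y a ay)[V /nbhs_ballP[e /= e0 eV] Va] _].
exists e => // z ze; apply/Va/eV; rewrite -ball_normE /=.
by apply: le_lt_trans (normr_le_enorm _) _; rewrite enormBC.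
Qed.

Lemma closed_sublevel y a :
  (forall e, 0 < e -> exists z, [/\ dom p z, enorm (z - y) < e & fine (p z) <= a + e]) ->
  (p y <= a%:E)%E.
Proof.
move=> H; rewrite leNgt; apply/negP => ay.
have [b ab yb] : exists2 b, a < b & (b%:E < p y)%E.
  case: (p y) ay => [r||] //; last by exists (a + 1); rewrite ?ltrDl ?ltry.
  by rewrite lte_fin => ar; exists ((a + r) / 2); rewrite ?lte_fin; lra.
have [e e0 he] := lsc_enorm yb.
have [|z [Dz ze pz]] := H (Num.min e (b - a)); first by rewrite lt_min e0 subr_gt0.
have := he z (lt_le_trans ze _); rewrite ge_min lexx => /(_ isT).
rewrite (dom_fineK Dz) lte_fin ltNge => /negP; apply.
by apply: le_trans pz _; rewrite -lerBrDl ge_min lexx orbT.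
Qed.

(** A substitute for an affine minorant that avoids separation theorems: lower semicontinuity bounds
    [p] below on a ball of radius [e] about [y], and convexity along the segment to a far [z]
    carries the bound outwards with slope [2 / e]. *)
Lemma minorant y : dom p y -> exists2 C, 0 <= C & forall z, dom p z ->
  fine (p y) - 1 - C * enorm (z - y) <= fine (p z).
Proof.
move=> Dy; have [|e e0 he] := @lsc_enorm y (fine (p y) - 1).
  by rewrite [X in (_ < X)%E](dom_fineK Dy) lte_fin ltrBlDr ltrDl.
exists (2 / e); first by rewrite divr_ge0 // ltW.
move=> z Dz; have [ze|ze] := ltP (enorm (z - y)) e.
  have := he _ ze; rewrite (dom_fineK Dz) lte_fin => /ltW; apply: le_trans.
  by rewrite gerBl mulr_ge0 ?enorm_ge0 // divr_ge0 // ltW.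
have n0 : 0 < enorm (z - y) by apply: lt_le_trans ze.
set t := e / (2 * enorm (z - y)).
have t0 : 0 < t by rewrite divr_gt0 // mulr_gt0.
have t1 : t <= 1 by rewrite ler_pdivrMr ?mulr_gt0 // mul1r; lra.
have [Dc hc] := fine_convex Dz Dy (introT andP (conj (ltW t0) t1)).
have := he (t *: z + (1 - t) *: y).
have -> : t *: z + (1 - t) *: y - y = t *: (z - y).
  by apply/rowP => i; rewrite !mxE; ring.
have tn : t * enorm (z - y) = e / 2.
  by rewrite /t; field; rewrite gt_eqF.
rewrite enormZ gtr0_norm // tn (dom_fineK Dc) lte_fin ltr_pdivrMr //.
rewrite ltr_pMr // ltr1n => /(_ isT) h1.
have h2 : -1 < t * (fine (p z) - fine (p y)) by lra.
have tE : t * (2 / e * enorm (z - y)) = 1.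
  by rewrite /t; field; rewrite !gt_eqF.
rewrite -(ler_pM2l t0); lra.
Qed.

Context (psi : 'rV[R]_k -> R) (kap : R).
Hypothesis kap0 : 0 < kap.
Hypothesis hpsi : forall y, dom p y -> exists g, forall z, dom p z ->
  psi y + dotp g (z - y) + kap / 2 * enorm (z - y) ^+ 2 <= psi z.

Let Q y := fine (p y) + psi y.

(** Strong convexity of [psi] is assumed as a supporting paraboloid at each point of [dom p], a form
    that fits both the proximal quadratic and [- pf P x], whose gradient is controlled on the domain
    only. *)
Lemma strong_convex_sum y z t : dom p y -> dom p z -> 0 <= t <= 1 ->
  Q (t *: y + (1 - t) *: z) + kap / 2 * t * (1 - t) * enorm (y - z) ^+ 2
    <= t * Q y + (1 - t) * Q z.
Proof.
move=> Dy Dz /[dup] t01 /andP[t0 t1].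
have [Dw hw] := fine_convex Dy Dz t01.
set w := _ + _ in Dw hw *; have [g hg] := hpsi Dw.
have yw : y - w = (1 - t) *: (y - z).
  by apply/rowP => i; rewrite !mxE; ring.
have zw : z - w = - t *: (y - z).
  by apply/rowP => i; rewrite !mxE; ring.
have := hg _ Dy; have := hg _ Dz.
rewrite yw zw !dotpE !enormZ !exprMn !real_normK ?num_real // sqrrN.
set d := dotp _ _; set n := enorm _ ^+ 2; move: hw; rewrite /Q => hw h1 h2.
have t1' : 0 <= 1 - t by rewrite subr_ge0.
have := ler_wpM2l t0 h2; have := ler_wpM2l t1' h1; lra.
Qed.

(** Comparing values at midpoints shows that points within [e] of the infimum satisfy
    [kap / 8 |z - z'| ^ 2 <= e], so a minimising sequence is Cauchy. Closedness of [p] and the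
    supporting paraboloids of [psi] pass to the limit. *)
Lemma sum_minimizer : exists2 w, dom p w & forall z, dom p z ->
  Q w + kap / 2 * enorm (z - w) ^+ 2 <= Q z.
Proof.
case: (hp) => [[_ [y0 Dy0]] _ _].
have [g0 hg0] := hpsi Dy0; have [C C0 hC] := minorant Dy0.
set S := [set Q z | z in dom p].
have lbS : has_inf S.
  split; first by exists (Q y0); exists y0.
  exists (Q y0 - 1 - (C + enorm g0) ^+ 2 / (2 * kap)) => _ [z Dz <-].
  have h1 := hC _ Dz; have h2 := hg0 _ Dz.
  have h3 : - (enorm g0 * enorm (z - y0)) <= dotp g0 (z - y0).
    by have := dotp_le g0 (- (z - y0)); rewrite dotpNr enormN lerNl.
  have h4 : 0 <= kap / 2 * (enorm (z - y0) - (C + enorm g0) / kap) ^+ 2.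
    by rewrite mulr_ge0 ?sqr_ge0 // divr_ge0 // ltW.
  have h5 : kap / 2 * (enorm (z - y0) - (C + enorm g0) / kap) ^+ 2 =
     kap / 2 * enorm (z - y0) ^+ 2 - (C + enorm g0) * enorm (z - y0)
     + (C + enorm g0) ^+ 2 / (2 * kap) by field; rewrite gt_eqF.
  move: h4; rewrite h5 /Q; lra.
set mn := inf S.
have mnP z : dom p z -> mn <= Q z.
  by move=> Dz; apply: ge_inf; [case: lbS|exists z].
have /choice[y_ hy] n : exists z, dom p z /\ Q z < mn + n.+1%:R^-1.
  have [|_ [z Dz <-] h] := @inf_adherent _ S n.+1%:R^-1 _ lbS.
    by rewrite invr_gt0.
  by exists z.
have hmid z z' e : dom p z -> dom p z' -> Q z <= mn + e -> Q z' <= mn + e ->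
    kap / 8 * enorm (z - z') ^+ 2 <= e.
  move=> Dz Dz' qz qz'; have t01 : 0 <= (2^-1 : R) <= 1 by lra.
  have [Dm _] := fine_convex Dz Dz' t01.
  have := strong_convex_sum Dz Dz' t01; have := mnP _ Dm; lra.
have cy : cvg (y_ @ \oo).
  apply: cauchy_cvg; apply: cauchy_exP => e e0.
  have e1 : 0 < kap / 8 * e ^+ 2 by rewrite !mulr_gt0 ?exprn_gt0.
  have [n0 _ hn0] := near_infty_natSinv_lt (PosNum e1).
  exists (y_ n0); exists n0 => // n /= n0n.
  rewrite -ball_normE /=; apply: le_lt_trans (normr_le_enorm _) _.
  rewrite -(ltr_sqr (enorm_ge0 _)) ?nnegrE ?ltW // -(@ltr_pM2l _ (kap / 8)) ?divr_gt0 //.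
  apply: le_lt_trans (hn0 n0 (leqnn _)).
  have [Dn qn] := hy n; have [Dn0 qn0] := hy n0.
  apply: hmid => //; first exact: ltW.
  apply: le_trans (ltW qn) _; rewrite lerD2l lef_pV2 ?posrE // ler_nat ltnS //.
set w := lim (y_ @ \oo).
have hw e : 0 < e -> exists z, [/\ dom p z, enorm (z - w) < e & Q z < mn + e].
  move=> e0; have k0 : 0 < Num.sqrt (k%:R : R) + 1 by rewrite ltr_wpDl ?sqrtr_ge0.
  have ek : 0 < e / (Num.sqrt k%:R + 1) by rewrite divr_gt0.
  have /cvgrPdist_lt/(_ _ ek) h1 := cy.
  have h2 := near_infty_natSinv_lt (PosNum e0).
  have [n [/= a1 a2]] := filter_ex (filterI h1 h2).
  have [Dn qn] := hy n; exists (y_ n); split => //.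
    apply: le_lt_trans (enorm_le_normr _) _; move: a1.
    rewrite distrC ltr_pdivlMr // mulrC; apply: le_lt_trans.
    by rewrite ler_wpM2r // lerDl.
  by apply: lt_trans qn _; rewrite ltrD2l.
have Gle (g : 'rV[R]_k) v : - (enorm g * enorm v) <= dotp g v.
  by have := dotp_le g (- v); rewrite dotpNr enormN lerNl.
have Dw : dom p w.
  apply: (@dom_le _ (mn + 1 - psi y0 + enorm g0 * (1 + enorm (w - y0)))).
  apply: closed_sublevel => e e0.
  have [|z [Dz zw qz]] := hw (Num.min e 1); first by rewrite lt_min e0 ltr01.
  exists z; split => //; first by apply: lt_le_trans zw _; rewrite ge_min lexx.
  have h1 := hg0 _ Dz; have h2 := Gle g0 (z - y0).
  have h3 : enorm g0 * enorm (z - y0) <= enorm g0 * (1 + enorm (w - y0)).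
    rewrite ler_wpM2l ?enorm_ge0 //; apply: le_trans (ler_enormB _ w _) _.
    rewrite lerD2r; apply/ltW/(lt_le_trans zw); by rewrite ge_min lexx orbT.
  have h4 : 0 <= kap / 2 * enorm (z - y0) ^+ 2.
    by rewrite mulr_ge0 ?sqr_ge0 // divr_ge0 // ltW.
  have h5 : Num.min e 1 <= e by rewrite ge_min lexx.
  have h6 : Num.min e 1 <= 1 by rewrite ge_min lexx orbT.
  move: qz; rewrite /Q; lra.
have Qw : Q w = mn.
  apply/eqP; rewrite eq_le mnP // andbT.
  suff : (p w <= (mn - psi w)%:E)%E by rewrite (dom_fineK Dw) lee_fin /Q lerBrDr.
  have [g hg] := hpsi Dw; apply: closed_sublevel => e e0.
  have G0 : 0 < enorm g + 2 by rewrite ltr_wpDl ?enorm_ge0.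
  have [|z [Dz zw qz]] := hw (e / (enorm g + 2)); first by rewrite divr_gt0.
  have e2 : e / (enorm g + 2) <= e.
    rewrite ler_pdivrMr // ler_peMr ?(ltW e0) //; have := enorm_ge0 g; lra.
  exists z; split => //; first exact: lt_le_trans e2.
  have h1 := hg _ Dz; have h2 := Gle g (z - w).
  have h4 : 0 <= kap / 2 * enorm (z - w) ^+ 2.
    by rewrite mulr_ge0 ?sqr_ge0 // divr_ge0 // ltW.
  have h3 : enorm g * enorm (z - w) <= enorm g * (e / (enorm g + 2)).
    by rewrite ler_wpM2l ?enorm_ge0 // ltW.
  have h5 : e = (enorm g + 2) * (e / (enorm g + 2)) by rewrite mulrC divfK // gt_eqF.
  have h6 : 0 <= e / (enorm g + 2) by rewrite divr_ge0 // ltW.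
  move: qz; rewrite /Q => qz; rewrite [X in _ <= _ + X]h5; lra.
exists w => // z Dz; rewrite leNgt; apply/negP => hlt.
have d0 := mnP _ Dz; rewrite -Qw in d0.
set X := kap / 2 * enorm (z - w) ^+ 2 in hlt *.
have X0 : 0 < X by lra.
(* Minimality along the segment gives [X (1 - t) <= Q z - Q w] for [t] in (0, 1]; half of the
   supposed relative deficit violates this. *)
set t := (X - (Q z - Q w)) / (2 * X).
have tX : t * X = (X - (Q z - Q w)) / 2 by rewrite /t; field; rewrite gt_eqF.
have t0 : 0 < t by rewrite /t divr_gt0 //; lra.
have t1 : t <= 1 by rewrite /t ler_pdivrMr; lra.
have t01 : 0 <= t <= 1 by rewrite ltW.
have := strong_convex_sum Dz Dw t01.
have [Dm _] := fine_convex Dz Dw t01.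
have := mnP _ Dm; rewrite -Qw.
set Y := Q (_ + _) => h1 h2.
have h3 : kap / 2 * t * (1 - t) * enorm (z - w) ^+ 2 = t * X * (1 - t).
  by rewrite /X; ring.
rewrite h3 in h2; have : t * (X * (1 - t)) <= t * (Q z - Q w) by lra.
rewrite ler_pM2l //; lra.
Qed.
End ClosedConvex.

(** * Proximal points *)

Section Prox.
Context (R : realType) (k : nat) (p : 'rV[R]_k -> \bar R).
Hypothesis hp : proper_closed_convex p.
Implicit Types (x u v w y z : 'rV[R]_k) (a t : R).

Lemma sqr_enormD u v : enorm (u + v) ^+ 2 = enorm u ^+ 2 + 2 * dotp u v + enorm v ^+ 2.
Proof. by rewrite !sqr_enorm !dotpE (dotpC v u); ring. Qed.

Lemma sqr_enormB u v : enorm (u - v) ^+ 2 = enorm u ^+ 2 - 2 * dotp u v + enorm v ^+ 2.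
Proof. by rewrite !sqr_enorm !dotpE (dotpC v u); ring. Qed.

(** When the squares are expanded, the quadratic growth at the minimiser cancels the term in
    [|z - w| ^ 2] exactly and leaves the variational inequality, without a limit. *)
Lemma prox_spec a x : 0 < a -> let w := prox (escale a p) x in
  dom p w /\ forall z, dom p z ->
    fine (p w) + a^-1 * dotp (x - w) (z - w) <= fine (p z).
Proof.
move=> a0 w; set q := fun z => (2 * a)^-1 * enorm (z - x) ^+ 2.
have ia0 : 0 < a^-1 by rewrite invr_gt0.
have hq y : dom p y -> exists g, forall z, dom p z ->
    q y + dotp g (z - y) + a^-1 / 2 * enorm (z - y) ^+ 2 <= q z.
  move=> _; exists (a^-1 *: (y - x)) => z _.
  rewrite /q /=; have -> : z - x = (z - y) + (y - x) by rewrite addrA subrK.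
  rewrite [enorm (z - y + _) ^+ 2]sqr_enormD dotpZl (dotpC (y - x)) invfM.
  rewrite -subr_ge0 le_eqVlt; apply/orP; left.
  by rewrite eq_sym; apply/eqP; field; rewrite gt_eqF.
have [w0 Dw0 hw0] := sum_minimizer hp ia0 hq.
pose E z := (escale a p z + (2^-1 * enorm (z - x) ^+ 2)%:E)%E.
have EE z : dom p z -> E z = (a * (fine (p z) + q z))%:E.
  move=> Dz; rewrite /E /escale [in LHS](dom_fineK hp Dz) -EFinM -EFinD /q /=.
  by congr EFin; field; rewrite gt_eqF.
have ENN z : ~ dom p z -> E z = +oo%E.
  rewrite /E /escale /dom /= => /negP; rewrite -leNgt leye_eq => /eqP ->.
  by rewrite gt0_muley ?lte_fin.
have wP : forall v, (E w <= E v)%E.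
  rewrite /w /prox; case: xgetP => [y _ hy//|/(_ w0)[]] => v /=.
  have [Dv|Dv] := pselect (dom p v); last by rewrite -!/(E _) (ENN v) ?leey.
  rewrite -!/(E _) !EE // lee_fin ler_pM2l //; apply: le_trans (hw0 _ Dv).
  by rewrite lerDl mulr_ge0 ?sqr_ge0 // divr_ge0 // ltW.
have Dw : dom p w.
  apply: contrapT => Dw; have := wP w0.
  by rewrite (ENN _ Dw) EE // leye_eq.
have ww0 : w = w0.
  apply/eqP; rewrite -subr_eq0; apply/eqP/enorm_eq0/eqP; rewrite -sqrf_eq0 eq_le sqr_ge0 andbT.
  have := wP w0; rewrite !EE // lee_fin ler_pM2l // => h1; have h2 := hw0 _ Dw.
  have : a^-1 / 2 * enorm (w - w0) ^+ 2 <= 0 by lra.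
  by rewrite pmulr_rle0 // divr_gt0.
split=> // z Dz; have := hw0 _ Dz; rewrite -ww0 /q /=.
have -> : z - x = (z - w) + (w - x) by rewrite addrA subrK.
rewrite [enorm (z - w + _) ^+ 2]sqr_enormD -(opprB w x) dotpNl (dotpC _ (z - w)) invfM => h.
have h3 : a^-1 / 2 * (enorm (z - w) ^+ 2 + 2 * dotp (z - w) (w - x) + enorm (w - x) ^+ 2) =
  a^-1 / 2 * enorm (z - w) ^+ 2 + a^-1 * dotp (z - w) (w - x) + a^-1 / 2 * enorm (w - x) ^+ 2.
  by field; rewrite gt_eqF.
move: h; rewrite [2^-1 * a^-1]mulrC h3; lra.
Qed.
End Prox.

(** * Mean value and descent inequalities *)

Section Gradient.
Context (R : realType) (k : nat).
Implicit Types (F : 'rV[R]_k -> R) (a b v y z : 'rV[R]_k).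

Lemma derive_dotp F a v : differentiable F a -> 'D_v F a = dotp (gradient F a) v.
Proof.
move=> dF; rewrite deriveE // [in LHS](row_sum_delta v) linear_sum /=.
by apply: eq_bigr => i _; rewrite linearZ /= mxE deriveE // mulrC.
Qed.

Lemma is_derive_line F a v t : differentiable F (a + t *: v) ->
  is_derive t 1 (fun s : R => F (a + s *: v)) (dotp (gradient F (a + t *: v)) v).
Proof.
move=> dF; rewrite -derive_dotp //.
have E : (fun h : R => h^-1 *: (F (a + (h *: 1 + t) *: v) - F (a + t *: v))) =
         (fun h => h^-1 *: (F (h *: v + (a + t *: v)) - F (a + t *: v))).
  apply/funext => h; congr (_ *: (F _ - _)).
  by rewrite -[h *: 1]/(h * 1) mulr1 scalerDl addrCA.
apply: DeriveDef.
  by rewrite /derivable /= E; exact: diff_derivable.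
by rewrite /derive /= E.
Qed.

(** The mean value theorem is applied to [F] minus [c t + d t ^ 2]. A bound on the derivative that
    is affine in [t] thus yields the sharp factor 1/2 without integration. *)
Lemma MVT_line F a v : (forall t : R, 0 <= t <= 1 -> differentiable F (a + t *: v)) ->
  forall (c d : R), exists2 t, 0 <= t <= 1 &
  F (a + v) - F a - (c + d) = dotp (gradient F (a + t *: v)) v - (c + 2 * d * t).
Proof.
move=> dF c d; pose h (t : R) := F (a + t *: v) - (c * t + d * t ^+ 2).
have dh (t : R) : 0 <= t <= 1 ->
    is_derive t 1 h (dotp (gradient F (a + t *: v)) v - (c + 2 * d * t)).
  move=> t01; have D1 := is_derive_line (dF _ t01).
  have -> : h = (fun s : R => F (a + s *: v))
      - ((fun s : R => c * s) + (fun s : R => d * s ^+ 2)) by [].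
  apply: is_deriveB; apply: is_derive_eq.
  by rewrite /GRing.scale /= !mulr1; ring.
have [||t] := @MVT _ h (fun t => dotp (gradient F (a + t *: v)) v - (c + 2 * d * t)) 0 1 ltr01.
- by move=> t; rewrite in_itv /= => /andP[/ltW t0 /ltW t1]; apply: dh; rewrite t0.
- apply: derivable_within_continuous => t; rewrite in_itv /= => t01.
  by have [] := dh _ t01.
rewrite in_itv /= => /andP[/ltW t0 /ltW t1] E; exists t; first by rewrite t0.
by move: E; rewrite /h scale1r scale0r addr0 subr0 mulr1 !mulr0 expr0n mulr0 expr1n
  !mulr1 addr0 subr0 => <-; ring.
Qed.

Lemma descent F a b c : (forall t : R, 0 <= t <= 1 -> differentiable F (a + t *: (b - a))) ->
  (forall t : R, 0 <= t <= 1 ->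
    dotp (gradient F (a + t *: (b - a)) - gradient F a) (b - a) <= c * t * enorm (b - a) ^+ 2) ->
  F b <= F a + dotp (gradient F a) (b - a) + c / 2 * enorm (b - a) ^+ 2.
Proof.
move=> dF hF.
have [t t01] := MVT_line dF (dotp (gradient F a) (b - a)) (c / 2 * enorm (b - a) ^+ 2).
have E : a + (b - a) = b by rewrite addrC subrK.
have := hF _ t01; rewrite dotpBl E; lra.
Qed.

Lemma strongly_concave_gradient mu F y z : strongly_concave mu F ->
  differentiable F y ->
  F z <= F y + dotp (gradient F y) (z - y) - mu / 2 * enorm (z - y) ^+ 2.
Proof.
move=> sF dF; rewrite -derive_dotp //.
apply/ler_addgt0Pr => e e0.
have /cvgrPdist_lt/(_ (e / 2)) := @diff_derivable _ _ _ F y (z - y) dF.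
rewrite divr_gt0 // => /(_ isT) /nbhs_ballP[r /= r0 hr].
set N := enorm (z - y) ^+ 2; have N0 : 0 <= N by rewrite sqr_ge0.
(* Small enough for the difference quotient to be within [e / 2] of the derivative and for the lost
   [mu / 2 t N] to be at most [e / 2]. *)
set t := Num.min (r / 2) (Num.min 1 (e / (`|mu| * N + 1))).
have q0 : 0 < `|mu| * N + 1 by rewrite ltr_wpDl // mulr_ge0.
have t0 : 0 < t by rewrite !lt_min ltr01 !divr_gt0.
have tr : t < r.
  apply: (@le_lt_trans _ _ (r / 2)); first by rewrite ge_min lexx.
  by rewrite ltr_pdivrMr // ltr_pMr // ltr1n.
have t1 : t <= 1 by rewrite !ge_min lexx orbT.
have te : t * (`|mu| * N) <= e.
  have : t <= e / (`|mu| * N + 1) by rewrite !ge_min lexx !orbT.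
  rewrite ler_pdivlMr // mulrDr mulr1; lra.
have := hr t; rewrite /ball /= sub0r normrN gtr0_norm // => /(_ tr).
rewrite gt_eqF // => /(_ isT).
rewrite -/('D_(z - y) F y); set D := 'D_(z - y) F y => h1.
have t01 : 0 <= t <= 1 by rewrite ltW.
have := sF z y t t01.
have -> : t *: z + (1 - t) *: y = t *: (z - y) + y.
  by apply/rowP => i; rewrite !mxE; ring.
rewrite -/N => h2.
have h3 : t^-1 * (F (t *: (z - y) + y) - F y) < D + e / 2.
  by move: h1; rewrite distrC ltr_norml => /andP[_]; rewrite /GRing.scale /= ltrBlDl.
have h4 : F (t *: (z - y) + y) - F y < t * (D + e / 2).
  by rewrite -ltr_pdivrMl.
have h5 : t * (F z - F y + mu / 2 * (1 - t) * N) <= t * (D + e / 2) by lra.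
move: h5; rewrite ler_pM2l // => h5.
have h6 : t * (mu * N) <= t * (`|mu| * N).
  by rewrite ler_wpM2l ?(ltW t0) // ler_wpM2r // ler_norm.
lra.
Qed.
End Gradient.

(** * The smooth coupling and the Lagrangian *)

Lemma ler_of_small (R : realFieldType) (a b c : R) :
  (forall t, 0 < t <= 1 -> a - t * c <= b) -> a <= b.
Proof.
move=> H; apply/ler_addgt0Pr => e e0.
have c0 : 0 < `|c| + 1 by rewrite ltr_wpDl.
have t0 : 0 < Num.min 1 (e / (`|c| + 1)) by rewrite lt_min ltr01 divr_gt0.
have := H (Num.min 1 (e / (`|c| + 1))); rewrite t0 ge_min lexx => /(_ isT).
set t := Num.min _ _ in t0 *.
have te : t <= e / (`|c| + 1) by rewrite ge_min lexx orbT.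
have h1 : t * c <= t * `|c| by rewrite ler_wpM2l ?(ltW t0) // ler_norm.
move: te; rewrite ler_pdivlMr // mulrDr mulr1; lra.
Qed.

Lemma enorm_le_enorm2l (R : realType) n m (u : 'rV[R]_n) (v : 'rV[R]_m) :
  enorm u <= enorm2 u v.
Proof.
rewrite /enorm2 -{1}[enorm u]ger0_norm ?enorm_ge0 // -sqrtr_sqr.
by rewrite ler_sqrt ?lerDl ?addr_ge0 ?sqr_ge0.
Qed.

Lemma enorm_le_enorm2r (R : realType) n m (u : 'rV[R]_n) (v : 'rV[R]_m) :
  enorm v <= enorm2 u v.
Proof.
rewrite /enorm2 -{1}[enorm v]ger0_norm ?enorm_ge0 // -sqrtr_sqr.
by rewrite ler_sqrt ?lerDr ?addr_ge0 ?sqr_ge0.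
Qed.

Lemma enorm20r (R : realType) n m (u : 'rV[R]_n) : enorm2 u (0 : 'rV[R]_m) = enorm u.
Proof. by rewrite /enorm2 enorm0 expr0n addr0 sqrtr_sqr ger0_norm ?enorm_ge0. Qed.

Lemma enorm20l (R : realType) n m (v : 'rV[R]_m) : enorm2 (0 : 'rV[R]_n) v = enorm v.
Proof. by rewrite /enorm2 enorm0 expr0n add0r sqrtr_sqr ger0_norm ?enorm_ge0. Qed.

Section Problem.
Context (R : realType) (n m : nat) (P : problem R n m).
Hypothesis hSC : SC P.
Context (L : R).
Hypothesis hL : pL P <= L.
Implicit Types (x : 'rV[R]_n) (y z w : 'rV[R]_m).

Local Notation Dg := (dom (pg P)).
Local Notation Dh := (dom (ph P)).

Definition phi x y : R := fine (pg P x) + pf P x y - fine (ph P y).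

Lemma pg_closed : proper_closed_convex (pg P). Proof. by case: hSC. Qed.
Lemma ph_closed : proper_closed_convex (ph P). Proof. by case: hSC. Qed.
Lemma pmu_gt0 : 0 < pmu P. Proof. by case: hSC => _ _ _ _ []. Qed.
Lemma L_ge0 : 0 <= L. Proof. by case: hSC => _ _ _ [+ _] _; move/le_trans; apply. Qed.

Lemma Lag_phi x y : Dg x -> Dh y -> Lag P x y = (phi x y)%:E.
Proof.
by move=> Dx Dy; rewrite /Lag [in LHS](dom_fineK pg_closed Dx) [in LHS](dom_fineK ph_closed Dy).
Qed.

Lemma pf_diff x y : Dg x -> Dh y -> differentiable (fun q : _ * _ => pf P q.1 q.2) (x, y).
Proof. by case: hSC => _ _ [U [_ DU dU]] _ _ Dx Dy; apply/dU/DU. Qed.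

Lemma pf_diffl x y : Dg x -> Dh y -> differentiable (fun u => pf P u y) x.
Proof.
move=> Dx Dy.
apply: (@differentiable_comp _ _ _ _ (fun u => (u, y)) (fun q : _ * _ => pf P q.1 q.2)).
  exact: differentiable_pair.
exact: pf_diff.
Qed.

Lemma pf_diffr x y : Dg x -> Dh y -> differentiable (pf P x) y.
Proof.
move=> Dx Dy.
apply: (@differentiable_comp _ _ _ _ (fun v => (x, v)) (fun q : _ * _ => pf P q.1 q.2)).
  exact: differentiable_pair.
exact: pf_diff.
Qed.

Lemma dom_line (k : nat) (p : 'rV[R]_k -> \bar R) a b (t : R) :
  proper_closed_convex p -> dom p a -> dom p b -> 0 <= t <= 1 -> dom p (a + t *: (b - a)).
Proof.
move=> hp Da Db t01; have [+ _] := fine_convex hp Db Da t01.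
by congr (dom p _); apply/rowP => i; rewrite !mxE; ring.
Qed.

Lemma grad_xx_lip x x' y : Dg x -> Dg x' -> Dh y ->
  enorm (grad_x P x y - grad_x P x' y) <= L * enorm (x - x').
Proof.
move=> Dx Dx' Dy; case: hSC => _ _ _ [_ /(_ x x' y y Dx Dx' Dy Dy)] + _.
rewrite subrr enorm20r => h; apply: le_trans (enorm_le_enorm2l _ _) (le_trans h _).
by rewrite ler_wpM2r ?enorm_ge0.
Qed.

Lemma grad_yx_lip x x' y : Dg x -> Dg x' -> Dh y ->
  enorm (grad_y P x y - grad_y P x' y) <= L * enorm (x - x').
Proof.
move=> Dx Dx' Dy; case: hSC => _ _ _ [_ /(_ x x' y y Dx Dx' Dy Dy)] + _.
rewrite subrr enorm20r => h; apply: le_trans (enorm_le_enorm2r _ _) (le_trans h _).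
by rewrite ler_wpM2r ?enorm_ge0.
Qed.

Lemma grad_yy_lip x y y' : Dg x -> Dh y -> Dh y' ->
  enorm (grad_y P x y - grad_y P x y') <= L * enorm (y - y').
Proof.
move=> Dx Dy Dy'; case: hSC => _ _ _ [_ /(_ x x y y' Dx Dx Dy Dy')] + _.
rewrite subrr enorm20l => h; apply: le_trans (enorm_le_enorm2r _ _) (le_trans h _).
by rewrite ler_wpM2r ?enorm_ge0.
Qed.

Lemma grad_xy_lip x y y' : Dg x -> Dh y -> Dh y' ->
  enorm (grad_x P x y - grad_x P x y') <= L * enorm (y - y').
Proof.
move=> Dx Dy Dy'; case: hSC => _ _ _ [_ /(_ x x y y' Dx Dx Dy Dy')] + _.
rewrite subrr enorm20l => h; apply: le_trans (enorm_le_enorm2l _ _) (le_trans h _).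
by rewrite ler_wpM2r ?enorm_ge0.
Qed.

Lemma line_lip k (G : 'rV[R]_k -> 'rV[R]_k) (a b : 'rV[R]_k) (t : R) :
  0 <= t -> enorm (G (a + t *: (b - a)) - G a) <= L * enorm ((a + t *: (b - a)) - a) ->
  `|dotp (G (a + t *: (b - a)) - G a) (b - a)| <= L * t * enorm (b - a) ^+ 2.
Proof.
move=> t0; rewrite addrAC subrr add0r enormZ ger0_norm // => h.
suff H v : dotp (G (a + t *: (b - a)) - G a) v <= L * t * enorm (b - a) * enorm v.
  rewrite ler_norml expr2 mulrA H andbT lerNl -dotpNr.
  by apply: le_trans (H _) _; rewrite enormN.
apply: le_trans (dotp_le _ _) _; rewrite ler_wpM2r ?enorm_ge0 //.
by apply: le_trans h _; rewrite mulrA.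
Qed.

Lemma pf_upper_x x x' y : Dg x -> Dg x' -> Dh y ->
  pf P x' y <= pf P x y + dotp (grad_x P x y) (x' - x) + L / 2 * enorm (x' - x) ^+ 2.
Proof.
move=> Dx Dx' Dy; apply: (@descent _ _ (fun u => pf P u y)) => t /[dup] t01 /andP[t0 _].
  by apply: pf_diffl => //; apply: dom_line pg_closed _ _ _.
apply: le_trans (ler_norm _) _; apply: (line_lip (G := fun u => grad_x P u y)) => //.
by apply: grad_xx_lip => //; apply: dom_line pg_closed _ _ _.
Qed.

Lemma pf_lower_y x y z : Dg x -> Dh y -> Dh z ->
  pf P x y + dotp (grad_y P x y) (z - y) - L / 2 * enorm (z - y) ^+ 2 <= pf P x z.
Proof.
move=> Dx Dy Dz.
have [|t /[dup] t01 /andP[t0 _]] := @MVT_line _ _ (pf P x) y (z - y) _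
   (dotp (grad_y P x y) (z - y)) (- (L / 2 * enorm (z - y) ^+ 2)).
  by move=> t t01; apply: pf_diffr => //; apply: dom_line ph_closed _ _ _.
have Dt := dom_line ph_closed Dy Dz t01.
have := line_lip (G := grad_y P x) t0 (grad_yy_lip Dx Dt Dy).
rewrite ler_norml dotpBl => /andP[+ _]; rewrite -/(grad_y P x (y + t *: (z - y))).
have E : y + (z - y) = z by rewrite addrC subrK.
rewrite E; lra.
Qed.

Lemma pf_upper_y x y z : Dg x -> Dh y -> Dh z ->
  pf P x z <= pf P x y + dotp (grad_y P x y) (z - y) - pmu P / 2 * enorm (z - y) ^+ 2.
Proof.
move=> Dx Dy Dz; case: hSC => _ _ _ _ [_ /(_ x Dx) sc].
by apply: strongly_concave_gradient => //; exact: pf_diffr.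
Qed.

(** The mean value theorem for [u |-> pf P u z - pf P u y], whose gradient is at most [L |z - y|].
    Through this bilinear error a dual gain at one primal point is compared with the gain at
    another. *)
Lemma pf_mixed x x' y z : Dg x -> Dg x' -> Dh y -> Dh z ->
  pf P x' z - pf P x' y <= pf P x z - pf P x y + L * enorm (x' - x) * enorm (z - y).
Proof.
move=> Dx Dx' Dy Dz; pose F (u : 'rV[R]_n) := pf P u z - pf P u y.
have dF u : Dg u -> differentiable F u.
  by move=> Du; apply: differentiableB; exact: pf_diffl.
have [|t t01] := @MVT_line _ _ F x (x' - x) _ 0 0.
  by move=> t t01; apply: dF; apply: dom_line pg_closed _ _ _.
have Dt := dom_line pg_closed Dx Dx' t01.
rewrite -derive_dotp; last exact: dF.
rewrite /F deriveB; [|exact/diff_derivable/pf_diffl..].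
rewrite !derive_dotp; [|exact: pf_diffl..].
have E : x + (x' - x) = x' by rewrite addrC subrK.
rewrite E -dotpBl -/(grad_x P _ z) -/(grad_x P _ y) mulr0 mul0r !addr0 !subr0 => H.
have : dotp (grad_x P (x + t *: (x' - x)) z - grad_x P (x + t *: (x' - x)) y) (x' - x)
   <= L * enorm (z - y) * enorm (x' - x).
  by apply: le_trans (dotp_le _ _) _; rewrite ler_wpM2r ?enorm_ge0 ?grad_xy_lip.
lra.
Qed.
End Problem.

(** * The value function and proximal ascent steps *)

Section Maximizer.
Context (R : realType) (n m : nat) (P : problem R n m).
Hypothesis hSC : SC P.
Context (L : R).
Hypothesis hL : pL P <= L.
Implicit Types (x : 'rV[R]_n) (y z w : 'rV[R]_m).

Local Notation Dg := (dom (pg P)).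
Local Notation Dh := (dom (ph P)).
Local Notation phi := (phi P).
Local Notation mu := (pmu P).

Definition ystar x : 'rV[R]_m := xget 0 [set w | Dh w /\
  forall z, Dh z -> phi x z + mu / 2 * enorm (z - w) ^+ 2 <= phi x w].

Definition Fr x : R := phi x (ystar x).

Lemma ystar_spec x : Dg x -> Dh (ystar x) /\
  forall z, Dh z -> phi x z + mu / 2 * enorm (z - ystar x) ^+ 2 <= Fr x.
Proof.
move=> Dx; rewrite /Fr /ystar; case: xgetP => [w _ //|].
have hq y : Dh y -> exists g, forall z, Dh z ->
    - pf P x y + dotp g (z - y) + mu / 2 * enorm (z - y) ^+ 2 <= - pf P x z.
  move=> Dy; exists (- grad_y P x y) => z Dz; rewrite dotpNl.
  have := pf_upper_y hSC Dx Dy Dz; lra.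
have [w Dw hw] := sum_minimizer (ph_closed hSC) (pmu_gt0 hSC) hq.
move=> /(_ w)[]; split=> // z Dz; rewrite /phi; have := hw _ Dz; lra.
Qed.

Lemma dom_ystar x : Dg x -> Dh (ystar x). Proof. by move=> /ystar_spec[]. Qed.

Lemma ystar_max x z : Dg x -> Dh z ->
  phi x z + mu / 2 * enorm (z - ystar x) ^+ 2 <= Fr x.
Proof. by move=> /ystar_spec[_]; apply. Qed.

Lemma half_mu_ge0 u : 0 <= mu / 2 * u ^+ 2.
Proof. by rewrite mulr_ge0 ?sqr_ge0 // divr_ge0 // ltW // pmu_gt0. Qed.

Lemma phi_le_Fr x z : Dg x -> Dh z -> phi x z <= Fr x.
Proof.
move=> Dx Dz; apply: le_trans (ystar_max Dx Dz); by rewrite lerDl half_mu_ge0.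
Qed.

Lemma Lag_notin x y : Dg x -> ~ Dh y -> Lag P x y = -oo%E.
Proof.
move=> Dx; rewrite /Lag (dom_fineK (pg_closed hSC) Dx) /dom /= => /negP.
by rewrite -leNgt leye_eq => /eqP ->.
Qed.

Lemma Fmax_Fr x : Dg x -> Fmax P x = (Fr x)%:E.
Proof.
move=> Dx; apply/eqP; rewrite eq_le; apply/andP; split.
  apply: ge_ereal_sup => _ [y _ <-].
  have [Dy|Dy] := pselect (Dh y); last by rewrite Lag_notin ?leNye.
  by rewrite Lag_phi // lee_fin phi_le_Fr.
apply: ereal_sup_ubound; exists (ystar x) => //.
by rewrite Lag_phi //; exact: dom_ystar.
Qed.

Lemma Fstar_le x : Dg x -> (Fstar P <= (Fr x)%:E)%E.
Proof. by move=> Dx; rewrite -Fmax_Fr //; apply: ereal_inf_lbound; exists x. Qed.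

Lemma Fmax_le_dom x y (c : R) : Dg x -> (Fmax P x <= Lag P x y + c%:E)%E ->
  Dh y /\ Fr x - phi x y <= c.
Proof.
move=> Dx; rewrite Fmax_Fr //; have [Dy|Dy] := pselect (Dh y); last by rewrite Lag_notin.
by rewrite Lag_phi // -EFinD lee_fin; split=> //; lra.
Qed.

Lemma phi_move x x' y z : Dg x -> Dg x' -> Dh y -> Dh z ->
  phi x' z - phi x' y <= phi x z - phi x y + L * enorm (x' - x) * enorm (z - y).
Proof.
move=> Dx Dx' Dy Dz; have := pf_mixed hSC hL Dx Dx' Dy Dz; rewrite /phi; lra.
Qed.

Lemma gap_move x x' y : Dg x -> Dg x' -> Dh y ->
  Fr x' - phi x' y <= Fr x - phi x y + L * enorm (x' - x) * enorm (y - ystar x').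
Proof.
move=> Dx Dx' Dy; have Ds := dom_ystar Dx'.
have := phi_move Dx Dx' Dy Ds; have := phi_le_Fr Dx Ds.
rewrite (enormBC y) /Fr; lra.
Qed.

(** The sum of the quadratic growth inequalities at the two maximisers, compared by [phi_move]. *)
Lemma ystar_lip x x' : Dg x -> Dg x' ->
  mu * enorm (ystar x - ystar x') <= L * enorm (x - x').
Proof.
move=> Dx Dx'; have Ds := dom_ystar Dx; have Ds' := dom_ystar Dx'.
have h1 := ystar_max Dx Ds'; have h2 := ystar_max Dx' Ds.
have h3 := phi_move Dx' Dx Ds' Ds.
rewrite enormBC in h1; rewrite /Fr in h1 h2.
have [d0|d0] := eqVneq (enorm (ystar x - ystar x')) 0.
  by rewrite d0 mulr0 mulr_ge0 ?enorm_ge0 // (L_ge0 hSC hL).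
have dp : 0 < enorm (ystar x - ystar x') by rewrite lt_def d0 enorm_ge0.
rewrite -(ler_pM2r dp); move: h1 h2 h3; rewrite !expr2; lra.
Qed.

Lemma ystar_VI x z : Dg x -> Dh z ->
  fine (ph P (ystar x)) + dotp (grad_y P x (ystar x)) (z - ystar x) <= fine (ph P z).
Proof.
move=> Dx Dz; have Ds := dom_ystar Dx.
apply: (@ler_of_small _ _ _ (L / 2 * enorm (z - ystar x) ^+ 2)) => t /andP[t0 t1].
have t01 : 0 <= t <= 1 by rewrite ltW.
have [Dt ht] := fine_convex (ph_closed hSC) Dz Ds t01.
have := phi_le_Fr Dx Dt; have := pf_lower_y hSC hL Dx Ds Dt.
have -> : t *: z + (1 - t) *: ystar x - ystar x = t *: (z - ystar x).
  by apply/rowP => i; rewrite !mxE; ring.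
rewrite dotpZr enormZ exprMn real_normK ?num_real // /Fr /phi => h1 h2.
rewrite -(ler_pM2l t0); lra.
Qed.

Lemma xstep x y t : Dg x -> Dh y -> 0 < t ->
  let x' := prox (escale t (pg P)) (x - t *: grad_x P x y) in
  Dg x' /\ t^-1 * enorm (x' - x) ^+ 2 - L / 2 * enorm (x' - x) ^+ 2
    <= phi x y - phi x' y.
Proof.
move=> Dx Dy t0 x'; have [Dx' /(_ x Dx)] := prox_spec (pg_closed hSC) (x - t *: grad_x P x y) t0.
rewrite -/x' => h; split=> //; have := pf_upper_x hSC hL Dx Dx' Dy.
have E : dotp (x - t *: grad_x P x y - x') (x - x') =
   enorm (x' - x) ^+ 2 + t * dotp (grad_x P x y) (x' - x).
  by rewrite sqr_enorm !dotpE (dotpC x' x); ring.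
rewrite E mulrDr mulKf ?gt_eqF // in h.
rewrite /phi; lra.
Qed.

Section YStep.
Context (x : 'rV[R]_n) (y : 'rV[R]_m) (l : R).
Hypotheses (Dx : Dg x) (Dy : Dh y) (l0 : 0 < l).

Let w := prox (escale l^-1 (ph P)) (y + l^-1 *: grad_y P x y).

Lemma ystep_VI : Dh w /\ forall z, Dh z ->
  fine (ph P w) + l * dotp (y - w) (z - w) + dotp (grad_y P x y) (z - w) <= fine (ph P z).
Proof.
have il0 : 0 < l^-1 by rewrite invr_gt0.
have [Dw hw] := prox_spec (ph_closed hSC) (y + l^-1 *: grad_y P x y) il0.
split=> // z Dz; have := hw _ Dz; rewrite -/w invrK.
have -> : y + l^-1 *: grad_y P x y - w = (y - w) + l^-1 *: grad_y P x y by rewrite addrAC.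
by rewrite dotpDl dotpZl mulrDr mulVKf ?gt_eqF // addrA.
Qed.

Lemma ystep_dom : Dh w. Proof. by have [] := ystep_VI. Qed.

(** Bounds the suboptimality of [w] by the length of the step that produced it. With [l = L_t] it
    justifies [Lambda_t] for proximal starts; with both lengths at most the diameter it gives the
    jump cost of a reset. *)
Lemma ystep_lin z : Dh z -> phi x z - phi x w <= (L + l) * enorm (w - y) * enorm (z - w).
Proof.
move=> Dz; have [Dw /(_ z Dz) h1] := ystep_VI.
have h2 := pf_upper_y hSC Dx Dw Dz; have h3 := half_mu_ge0 (enorm (z - w)).
have h4 : dotp (grad_y P x w - grad_y P x y) (z - w) <= L * enorm (w - y) * enorm (z - w).
  by apply: le_trans (dotp_le _ _) _; rewrite ler_wpM2r ?enorm_ge0 ?(grad_yy_lip hSC hL).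
have h5 : dotp (w - y) (z - w) <= enorm (w - y) * enorm (z - w) by exact: dotp_le.
have h6 : dotp (y - w) (z - w) = - dotp (w - y) (z - w) by rewrite -dotpNl opprB.
have h7 := ler_wpM2l (ltW l0) h5.
rewrite h6 in h1; move: h4; rewrite dotpBl /phi; lra.
Qed.

Hypothesis desc : pf P x y + dotp (grad_y P x y) (w - y)
   <= pf P x w + l / 2 * enorm (w - y) ^+ 2.

(** It rests on BC(ii) in place of a Lipschitz bound, so that it holds for every accepted [l_t],
    even below the Lipschitz constant. *)
Lemma three_point z : Dh z ->
  phi x z <= phi x w + (l - mu) / 2 * enorm (z - y) ^+ 2 - l / 2 * enorm (z - w) ^+ 2.
Proof.
move=> Dz; have [Dw /(_ z Dz) h1] := ystep_VI.
have h2 := pf_upper_y hSC Dx Dy Dz.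
have E1 : enorm (z - y) ^+ 2 = enorm (w - y) ^+ 2 - 2 * dotp (y - w) (z - w) + enorm (z - w) ^+ 2.
  by rewrite (enormBC w y) -sqr_enormB enormBC; congr (enorm _ ^+ 2); rewrite opprB addrA subrK.
have E2 : dotp (grad_y P x y) (z - y) = dotp (grad_y P x y) (z - w) + dotp (grad_y P x y) (w - y).
  by rewrite -dotpDr addrA subrK.
move: h1 h2 desc; rewrite /phi E2 E1; lra.
Qed.

Lemma ystep_ascent : phi x y + l / 2 * enorm (w - y) ^+ 2 <= phi x w.
Proof.
have := three_point Dy; rewrite subrr enorm0 expr0n mulr0 addr0 enormBC; lra.
Qed.

Context (nu : R).
Hypotheses (nu0 : 0 < nu) (numu : nu <= mu) (nul : nu <= l).

Lemma ystep_gap2 : Fr x - phi x w <=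
  (l - nu) / 2 * enorm (y - ystar x) ^+ 2 - l / 2 * enorm (w - ystar x) ^+ 2.
Proof.
have := three_point (dom_ystar Dx); rewrite -/(Fr x) ![enorm (ystar x - _)]enormBC.
have : 0 <= (mu - nu) * enorm (y - ystar x) ^+ 2 by rewrite mulr_ge0 ?sqr_ge0 ?subr_ge0.
lra.
Qed.

Lemma ystep_dist : enorm (w - ystar x) ^+ 2 <= (1 - nu / l) * enorm (y - ystar x) ^+ 2.
Proof.
have h1 := ystep_gap2; have h2 := phi_le_Fr Dx ystep_dom.
have E N : l * ((1 - nu / l) * N) = (l - nu) * N by field; rewrite gt_eqF.
rewrite -(ler_pM2l l0) E; lra.
Qed.

(** [w] is compared with the point at fraction [s = nu / l] from [y] to the maximiser: as
    [s l <= mu], the gain [mu s (1 - s)] of strong concavity outweighs the loss [(l - mu) s ^ 2] in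
    [three_point]. *)
Lemma ystep_gap : Fr x - phi x w <= (1 - nu / l) * (Fr x - phi x y).
Proof.
set s := nu / l; have sl : s * l = nu by rewrite /s divfK // gt_eqF.
have s0 : 0 < s by rewrite divr_gt0.
have s1 : s <= 1 by rewrite ler_pdivrMr // mul1r.
have s01 : 0 <= s <= 1 by rewrite ltW.
set d := ystar x; have Ds : Dh d := dom_ystar Dx.
have [Dz hz] := fine_convex (ph_closed hSC) Ds Dy s01.
have := three_point Dz; set z := s *: d + _ in Dz hz *.
have -> : z - y = s *: (d - y) by apply/rowP => i; rewrite !mxE; ring.
rewrite enormZ exprMn real_normK ?num_real // => h.
have sc : s * pf P x d + (1 - s) * pf P x y
    + mu / 2 * s * (1 - s) * enorm (d - y) ^+ 2 <= pf P x z.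
  by case: hSC => _ _ _ _ [_ /(_ x Dx)]; apply.
have h0 : 0 <= l / 2 * enorm (z - w) ^+ 2.
  by rewrite mulr_ge0 ?sqr_ge0 // divr_ge0 // ltW.
have N0 : 0 <= enorm (d - y) ^+ 2 by rewrite sqr_ge0.
have k1 : 0 <= s * (mu - s * l) * enorm (d - y) ^+ 2.
  by rewrite sl; apply: mulr_ge0 => //; apply: mulr_ge0; rewrite ?subr_ge0 // ltW.
move: h; rewrite /Fr /phi -/d; lra.
Qed.

(** Meant for the step taken at [x_t], where BC gives no descent inequality. The maximiser is a
    fixed point of the proximal step, and for [l <= 2 mu] strong monotonicity cancels the identity
    part, so that [|y - d + G / l| <= L / l |y - d|]. *)
Lemma ystep_disp : l <= 2 * nu -> enorm (w - y) <= (1 + L / l) * enorm (y - ystar x).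
Proof.
move=> lnu; have Ds := dom_ystar Dx.
have [Dw /(_ _ Ds) h1] := ystep_VI.
have h2 := ystar_VI Dx Dw.
set d := ystar x in Ds h1 h2 *.
pose G := grad_y P x y - grad_y P x d.
have K0 : 0 <= L / l by rewrite divr_ge0 ?(L_ge0 hSC hL) // ltW.
have hmono : dotp G (y - d) <= - (mu * enorm (y - d) ^+ 2).
  have := pf_upper_y hSC Dx Dy Ds; have := pf_upper_y hSC Dx Ds Dy.
  rewrite (enormBC d y) /G dotpBl -(opprB y d) dotpNr; lra.
have hG : enorm G <= L * enorm (y - d) by rewrite (grad_yy_lip hSC hL).
have hq : enorm (y - d + l^-1 *: G) <= L / l * enorm (y - d).
  apply: enorm_le; first by rewrite mulr_ge0 ?enorm_ge0.
  rewrite -sqr_enorm sqr_enormD dotpZr (dotpC _ G) enormZ !exprMn real_normK ?num_real //.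
  have hG2 : enorm G ^+ 2 <= L ^+ 2 * enorm (y - d) ^+ 2.
    by rewrite -exprMn ler_sqr ?nnegrE ?enorm_ge0 // mulr_ge0 ?enorm_ge0 ?(L_ge0 hSC hL).
  have h3 := ler_wpM2l (sqr_ge0 l^-1) hG2.
  have h4 : 2 * (l^-1 * dotp G (y - d)) <= - enorm (y - d) ^+ 2.
    rewrite -(ler_pM2l l0) mulrCA mulVKf ?gt_eqF //.
    have : l * enorm (y - d) ^+ 2 <= 2 * mu * enorm (y - d) ^+ 2.
      apply: ler_wpM2r; first exact: sqr_ge0.
      by apply: le_trans lnu _; rewrite ler_wpM2l.
    lra.
  lra.
have hwd : enorm (w - d) <= enorm (y - d + l^-1 *: G).
  have [->|w0] := eqVneq (enorm (w - d)) 0; first exact: enorm_ge0.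
  have wp : 0 < enorm (w - d) by rewrite lt_def w0 enorm_ge0.
  rewrite -(ler_pM2r wp) -expr2 sqr_enorm; apply: le_trans (dotp_le _ _).
  rewrite -(ler_pM2l l0) [dotp (y - d + _) _]dotpDl dotpZl mulrDr mulVKf ?gt_eqF //.
  have E : dotp (y - d) (w - d) = dotp (w - d) (w - d) - dotp (y - w) (d - w).
    rewrite -(opprB w d) dotpNr opprK -dotpDl; congr dotp.
    by apply/rowP => i; rewrite !mxE; ring.
  rewrite E /G [dotp (grad_y P x y - _) _]dotpBl; move: h1 h2.
  rewrite -(opprB w d) !dotpNr; lra.
apply: le_trans (ler_enormB _ d _) _; rewrite (enormBC d y).
by have := le_trans hwd hq; lra.
Qed.
End YStep.

Lemma ystep_nonexp x x' y l : Dg x -> Dg x' -> Dh y -> 0 < l ->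
  enorm (prox (escale l^-1 (ph P)) (y + l^-1 *: grad_y P x y)
       - prox (escale l^-1 (ph P)) (y + l^-1 *: grad_y P x' y))
   <= L / l * enorm (x - x').
Proof.
move=> Dx Dx' Dy l0.
have [Dw h1] := ystep_VI x y l0; have [Dw' h2] := ystep_VI x' y l0.
set w := prox _ _ in Dw h1 *; set w' := prox _ _ in Dw' h2 *.
have [->|w0] := eqVneq (enorm (w - w')) 0.
  by rewrite mulr_ge0 ?enorm_ge0 // divr_ge0 ?(L_ge0 hSC hL) // ltW.
have wp : 0 < enorm (w - w') by rewrite lt_def w0 enorm_ge0.
have A1 := h1 _ Dw'; have A2 := h2 _ Dw.
have B1 : dotp (grad_y P x y - grad_y P x' y) (w - w') <= L * enorm (x - x') * enorm (w - w').
  by apply: le_trans (dotp_le _ _) _; rewrite ler_wpM2r ?enorm_ge0 ?(grad_yx_lip hSC hL).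
have E : dotp (y - w') (w - w') = dotp (y - w) (w - w') + enorm (w - w') ^+ 2.
  by rewrite sqr_enorm -dotpDl addrA subrK.
rewrite dotpBl in B1; rewrite -(opprB w w') !dotpNr in A1; rewrite E in A2.
have C1 : l * enorm (w - w') ^+ 2 <= L * enorm (x - x') * enorm (w - w').
  have aux (a1 a2 p1 g1 g2 N T : R) : a1 + l * - p1 - g1 <= a2 ->
    a2 + l * (p1 + N) + g2 <= a1 -> g1 - g2 <= T -> l * N <= T by clear; lra.
  exact: aux A1 A2 B1.
rewrite -(ler_pM2r wp) -(ler_pM2l l0) -expr2; apply: le_trans C1 _.
have -> : l * (L / l * enorm (x - x') * enorm (w - w')) = L * enorm (x - x') * enorm (w - w').
  by field; rewrite gt_eqF.
by [].
Qed.
End Maximizer.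

(** * Quantities of one iteration *)

Section Translate.
Context (R : realType) (n m : nat) (P : problem R n m) (A : input R n m).
Hypothesis hA : valid_input P A.
Implicit Types s : state R n m.

Lemma gamma0_lt1 : gamma0 A < 1. Proof. by case: hA => _ _ [/andP[]]. Qed.
Lemma gamma_gt0 : 0 < gamma A. Proof. by case: hA => _ _ [_ /andP[]]. Qed.
Lemma gamma_lt1 : gamma A < 1. Proof. by case: hA => _ _ [_ /andP[]]. Qed.
Lemma zeta_gt0 : 0 < zeta A. Proof. by case: hA => _ []. Qed.
Lemma mu_tilde_gt0 : 0 < mu_tilde A. Proof. by case: hA => _ []. Qed.
Lemma mu_lt_l_tilde : mu_tilde A < l_tilde A. Proof. by case: hA => _ []. Qed.
Lemma l_tilde_gt0 : 0 < l_tilde A.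
Proof. exact: lt_trans mu_tilde_gt0 mu_lt_l_tilde. Qed.

Definition wf s := [/\ 0 < smu s, smu s < sl s & smu s <= sL s].

(** [dist_x], [dist_y], [dist_grad_y], [rat], [cond], [Bt] and [qx] are [u], [r], [rb], [s], [m],
    [BB] and [q] of the scalar inequalities. [ygrad] is the dual step from [x_t] itself, [y_next]
    the one from [x_(t+1)]. *)
Definition dist_x s := enorm (x_next P A s - sx s).
Definition dist_y s := enorm (y_next P A s - sy s).
Definition ygrad s := prox (escale (sl s)^-1 (ph P))
  (sy s + (sl s)^-1 *: grad_y P (sx s) (sy s)).
Definition dist_grad_y s := enorm (ygrad s - sy s).
Definition rat s := smu s / sl s.
Definition cond s := sL s / smu s.
Definition Bt s := BB (gamma A)^-1 (cond s) (rat s).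
Definition qx s := (tau A s)^-1 * dist_x s ^+ 2.

Definition summand s := gamma0 A * tau A s * normGx P A s ^+ 2
       + sigma s * normGy P s ^+ 2
       + smu s * sigma s ^+ 2 / 2 * normGy_next P A s ^+ 2.

Context (s : state R n m).
Hypothesis ws : wf s.

Let mu0 : 0 < smu s. Proof. by case: ws. Qed.
Let l0 : 0 < sl s. Proof. by case: ws => m0 ml _; exact: lt_trans ml. Qed.

Lemma rat_bounds : 0 < rat s < 1.
Proof. by case: ws => _ ml _; rewrite divr_gt0 //= ltr_pdivrMr // mul1r. Qed.

Lemma cond_ge1 : 1 <= cond s.
Proof. by case: ws => _ _ mL; rewrite ler_pdivlMr // mul1r. Qed.

Lemma cc_rat_ge0 : 0 <= cc (rat s).
Proof. by have /andP[a b] := rat_bounds; rewrite /cc mulr_ge0 //; lra. Qed.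

Lemma beta_ge0 : 0 <= 4 * cc (rat s) * (15 * cond s - 8) * cond s ^+ 3.
Proof.
have c1 := cond_ge1; have c0 := cc_rat_ge0.
apply: mulr_ge0; last by rewrite exprn_ge0 //; lra.
by apply: mulr_ge0; [apply: mulr_ge0|lra].
Qed.

Lemma Bt_gt0 : 0 < Bt s.
Proof.
have := beta_ge0; have := gamma_gt0; rewrite /Bt /BB -invr_gt0; lra.
Qed.

Lemma tauE : tau A s = (1 - gamma0 A) / (sl s * Bt s).
Proof.
have E : 4 + (gamma2 A)^-1 + 4 * (1 - sigma s * smu s) * (2 - sigma s * smu s)
   * (15 * sL s - 8 * smu s) * sL s ^+ 3 / smu s ^+ 4 = Bt s.
  rewrite /Bt /BB /cc /cond /rat /sigma /gamma2; field.
  by rewrite !gt_eqF ?gamma_gt0.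
by rewrite /tau E invfM mulrA.
Qed.

Lemma tau_gt0 : 0 < tau A s.
Proof. by rewrite tauE divr_gt0 ?subr_gt0 ?gamma0_lt1 // mulr_gt0 // Bt_gt0. Qed.

Lemma normGxE : normGx P A s = (tau A s)^-1 * dist_x s.
Proof.
rewrite /normGx /Gx -/(x_next P A s) enormZ gtr0_norm ?invr_gt0 ?tau_gt0 //.
by rewrite enormBC.
Qed.

Lemma normGyE : normGy P s = sl s * dist_grad_y s.
Proof.
by rewrite /normGy /Gy /sigma -/(ygrad s) enormZ invrK gtr0_norm.
Qed.

Lemma normGy_nextE : normGy_next P A s = sl s * dist_y s.
Proof.
by rewrite /normGy_next /Gy -/(y_next P A s) /sigma enormZ invrK gtr0_norm.
Qed.

(** Because [(1 - gamma0) / tau = l Bt], passing from weight 1 to weight [gamma0] on [qx] subtracts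
    exactly [l Bt u ^ 2]; [gamma0] does not appear on the right otherwise. *)
Lemma SE : summand s = qx s - sl s * Bt s * dist_x s ^+ 2 + sl s * dist_grad_y s ^+ 2
   + rat s * sl s / 2 * dist_y s ^+ 2.
Proof.
rewrite /summand normGxE normGyE normGy_nextE /qx /rat /sigma.
have -> : sl s * Bt s = (1 - gamma0 A) / tau A s.
  rewrite tauE; field; rewrite !gt_eqF ?Bt_gt0 //= subr_gt0; exact: gamma0_lt1.
field; rewrite !gt_eqF ?tau_gt0 //.
Qed.

Lemma Delta_nextE : Delta_next P A s =
  (1 - rat s / 2) * sDelta s + cc (rat s) / rat s * cond s ^+ 2 * dist_x s ^+ 2.
Proof.
rewrite /Delta_next /C_coef normGxE /rat /cond /cc /sigma.
field; rewrite !gt_eqF ?tau_gt0 //.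
Qed.

Lemma sR_advance : sR (advance P A s) = 2 * sl s * dist_x s ^+ 2 - smu s * dist_y s ^+ 2.
Proof.
rewrite /= normGxE normGy_nextE /sigma.
field; rewrite !gt_eqF ?tau_gt0 //.
Qed.

Lemma BC4E : normGy_next P A s ^+ 2
      <= 2 * (4 * (1 - sigma s * smu s) / sigma s ^+ 2 + 2 * sl s ^+ 2) * sDelta s
           + 2 * sl s ^+ 2 * tau A s ^+ 2 * normGx P A s ^+ 2
  <-> dist_y s ^+ 2 <= (12 - 8 * rat s) * sDelta s + 2 * dist_x s ^+ 2.
Proof.
rewrite normGxE normGy_nextE /sigma.
have -> : 2 * (4 * (1 - (sl s)^-1 * smu s) / (sl s)^-1 ^+ 2 + 2 * sl s ^+ 2) * sDelta s
           + 2 * sl s ^+ 2 * tau A s ^+ 2 * ((tau A s)^-1 * dist_x s) ^+ 2 =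
   sl s ^+ 2 * ((12 - 8 * rat s) * sDelta s + 2 * dist_x s ^+ 2).
  rewrite /rat; field; rewrite !gt_eqF ?tau_gt0 //.
by rewrite exprMn ler_pM2l ?exprn_gt0.
Qed.

Lemma BC1_lhsE : (tau A s - (2 + (gamma A)^-1) * tau A s ^+ 2 * sl s) * normGx P A s ^+ 2
        + sigma s * normGy P s ^+ 2
        + sigma s ^+ 2 * (smu s / 2) * normGy_next P A s ^+ 2
  = qx s - (2 + (gamma A)^-1) * sl s * dist_x s ^+ 2 + sl s * dist_grad_y s ^+ 2
    + rat s * sl s / 2 * dist_y s ^+ 2.
Proof.
rewrite normGxE normGyE normGy_nextE /sigma /rat /qx.
field; rewrite !gt_eqF ?tau_gt0 ?gamma_gt0 //.
Qed.

Hypothesis hSC : SC P.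
Hypotheses (Dx : dom (pg P) (sx s)) (Dy : dom (ph P) (sy s)).

Lemma dom_x_next : dom (pg P) (x_next P A s).
Proof. by have [] := xstep hSC (lexx _) Dx Dy tau_gt0. Qed.

Lemma dom_y_next : dom (ph P) (y_next P A s).
Proof. exact: ystep_dom. Qed.

Definition DLag := phi P (sx s) (sy s) - phi P (x_next P A s) (y_next P A s).

Lemma BC1E : (((tau A s - (2 + (gamma A)^-1) * tau A s ^+ 2 * sl s) * normGx P A s ^+ 2
        + sigma s * normGy P s ^+ 2
        + sigma s ^+ 2 * (smu s / 2) * normGy_next P A s ^+ 2)%:E
       <= (sLambda s + 4 * (3 * sl s - 2 * smu s) * sDelta s)%:E
          + Lag P (sx s) (sy s) - Lag P (x_next P A s) (y_next P A s) + (sR s)%:E)%E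
  <-> qx s - (2 + (gamma A)^-1) * sl s * dist_x s ^+ 2 + sl s * dist_grad_y s ^+ 2
    + rat s * sl s / 2 * dist_y s ^+ 2
    <= sLambda s + sR s + 4 * (3 * sl s - 2 * smu s) * sDelta s + DLag.
Proof.
rewrite BC1_lhsE (Lag_phi hSC Dx Dy) (Lag_phi hSC dom_x_next dom_y_next).
have aux (a b c d : R) : (a%:E + b%:E - c%:E + d%:E)%E = (a + b - c + d)%:E by [].
rewrite aux lee_fin /DLag; split; lra.
Qed.
End Translate.

(** * Estimates for one iteration *)

Section RealAux.
Context (R : realFieldType).
Implicit Types (q s l u r b Del : R).

(** BC(iv) with [q = sqrt (1 - s)], the contraction factor of the distance to the maximiser:
    [12 - 8 s = 4 + 8 q ^ 2] exceeds [2 (1 + q) ^ 2]. *)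
Lemma bc4_aux q s u r b Del : 0 <= q -> q ^+ 2 = 1 - s -> 0 <= Del ->
  0 <= r -> r <= b + u -> b ^+ 2 <= (1 + q) ^+ 2 * Del ->
  r ^+ 2 <= (12 - 8 * s) * Del + 2 * u ^+ 2.
Proof.
move=> q0 qs D0 r0 rbu hb.
have h1 : r ^+ 2 <= (b + u) ^+ 2 by rewrite ler_sqr ?nnegrE // (le_trans r0).
have h2 := sqr_ge0 (b - u).
have h3 : 0 <= (6 * q ^+ 2 - 4 * q + 2) * Del.
  by apply: mulr_ge0 => //; have := sqr_ge0 (q - 1); have := sqr_ge0 q; lra.
have -> : s = 1 - q ^+ 2 by rewrite qs; ring.
lra.
Qed.

(** BC(i) for [l >= L]. The [b ^ 2] terms add up to [l (3 / 2 + s) b ^ 2], and the coefficient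
    [4 (3 l - 2 mu)] covers them because [(3 / 2 + s) (1 + q) ^ 2 <= 4 + 8 q ^ 2]. *)
Lemma bc1_aux q s l L x u r b Del qq D A LR : 0 <= q -> q ^+ 2 = 1 - s -> 0 <= Del ->
  0 < l -> 0 <= s <= 1 -> L <= l -> 1 <= x -> 0 <= u ->
  0 <= r -> r <= b + u -> b ^+ 2 <= (1 + q) ^+ 2 * Del ->
  qq - L / 2 * u ^+ 2 <= D -> A <= LR + L * u * r ->
  qq - (2 + x) * l * u ^+ 2 + l * b ^+ 2 + s * l / 2 * r ^+ 2
    <= LR + 4 * (3 * l - 2 * (s * l)) * Del + (D - A).
Proof.
move=> q0 qs D0 l0 /andP[s0 s1] Ll x1 u0 r0 rbu hb hD hA.
have h1 : r ^+ 2 <= (b + u) ^+ 2 by rewrite ler_sqr ?nnegrE // (le_trans r0).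
have h2 := sqr_ge0 (b - u).
have hr : r ^+ 2 <= 2 * b ^+ 2 + 2 * u ^+ 2 by lra.
have ur : 0 <= u * r by rewrite mulr_ge0.
have hLur : L * (u * r) <= l * (u ^+ 2 + r ^+ 2 / 4).
  apply: (@le_trans _ _ (l * (u * r))); first by rewrite ler_wpM2r.
  by rewrite ler_pM2l //; have := sqr_ge0 (u - r / 2); lra.
have hLu : L * u ^+ 2 <= l * u ^+ 2 by rewrite ler_wpM2r ?sqr_ge0.
have hxu : 0 <= (x - 1) * (l * u ^+ 2).
  by rewrite mulr_ge0 ?subr_ge0 // mulr_ge0 ?sqr_ge0 // ltW.
have hsu : 0 <= (1 - s) * (l * u ^+ 2).
  by rewrite mulr_ge0 ?subr_ge0 // mulr_ge0 ?sqr_ge0 // ltW.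
have sl0 : 0 <= l * (1 / 4 + s / 2) by rewrite mulr_ge0 ?(ltW l0) //; lra.
have k1 := ler_wpM2l sl0 hr.
have k2 : l * (3 / 2 + s) * b ^+ 2 <= l * (3 / 2 + s) * ((1 + q) ^+ 2 * Del).
  by rewrite ler_wpM2l // mulr_ge0 ?(ltW l0) //; lra.
have k3 : 0 <= l * ((3 / 2 - 5 * q + 13 / 2 * q ^+ 2 + 2 * q ^+ 3 + q ^+ 4) * Del).
  apply: mulr_ge0; first exact: ltW.
  apply: mulr_ge0 => //.
  (* [5 / 13] minimises [3 / 2 - 5 q + 13 / 2 q ^ 2], which is positive there. *)
  have := sqr_ge0 (q - 5 / 13); have := exprn_ge0 3 q0; have := exprn_ge0 4 q0; lra.
have k4 : l * (3 / 2 + s) * ((1 + q) ^+ 2 * Del)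
   = l * ((4 + 8 * q ^+ 2) * Del)
      - l * ((3 / 2 - 5 * q + 13 / 2 * q ^+ 2 + 2 * q ^+ 3 + q ^+ 4) * Del).
  have -> : s = 1 - q ^+ 2 by rewrite qs; ring.
  by field.
have k5 : l * ((4 + 8 * q ^+ 2) * Del) = 4 * (3 * l - 2 * (s * l)) * Del.
  by rewrite qs; ring.
lra.
Qed.
End RealAux.

Section Facts.
Context (R : realType) (n m : nat) (P : problem R n m) (A : input R n m).
Hypotheses (hA : valid_input P A) (hSC : SC P).
Context (s : state R n m).
Hypotheses (ws : wf s) (Dx : dom (pg P) (sx s)) (Dy : dom (ph P) (sy s)).
Hypothesis numu : smu s <= pmu P.

Let x := sx s.
Let y := sy s.
Let x' := x_next P A s.
Let y' := y_next P A s.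
Let l := sl s.
Let u := dist_x P A s.
Let r := dist_y P A s.

Let mu0 : 0 < smu s. Proof. by case: ws. Qed.
Let mul : smu s < l. Proof. by case: ws. Qed.
Let l0 : 0 < l. Proof. exact: lt_trans mul. Qed.
Let Dx' : dom (pg P) x'. Proof. exact: dom_x_next. Qed.
Let Dy' : dom (ph P) y'. Proof. exact: dom_y_next. Qed.

Lemma rat_slE : rat s * sl s = smu s.
Proof. by rewrite /rat divfK // gt_eqF. Qed.

Section LipConst.
Context (L : R).
Hypothesis hL : pL P <= L.

Lemma grad_step_le : dist_grad_y P s <= r + L / l * u.
Proof.
apply: le_trans (ler_enormB _ y' _) _; rewrite addrC lerD2l.
apply: le_trans (ystep_nonexp hSC hL Dx Dx' Dy l0) _.
by rewrite /u /dist_x enormBC.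
Qed.

Lemma next_step_le : r <= dist_grad_y P s + L / l * u.
Proof.
apply: le_trans (ler_enormB _ (ygrad P s) _) _; rewrite addrC lerD2l.
exact: (ystep_nonexp hSC hL Dx' Dx Dy l0).
Qed.

Lemma descent_x : qx P A s - L / 2 * u ^+ 2 <= phi P x y - phi P x' y.
Proof. by have [] := xstep hSC hL Dx Dy (tau_gt0 hA ws). Qed.

Lemma mixed_gain_le : phi P x' y' - phi P x' y <= phi P x y' - phi P x y + L * u * r.
Proof. exact: phi_move. Qed.

Lemma gap_next_le : Fr P x' - phi P x' y' <=
  Fr P x - phi P x y + L * u * enorm (y - ystar P x') - (phi P x' y' - phi P x' y).
Proof.
have h : Fr P x' - phi P x' y <= Fr P x - phi P x y + L * u * enorm (y - ystar P x').
  exact: gap_move.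
by move: h; lra.
Qed.

Lemma dist_ystar_next_le : enorm (y - ystar P x') ^+ 2 <=
  2 * (enorm (y - ystar P x) ^+ 2 + (L / smu s) ^+ 2 * u ^+ 2).
Proof.
have h1 := ler_enormB y (ystar P x) (ystar P x').
have h2 := ystar_lip hSC hL Dx Dx'.
have h3 : enorm (ystar P x - ystar P x') <= L / smu s * u.
  rewrite mulrAC ler_pdivlMr // mulrC.
  apply: (@le_trans _ _ (pmu P * enorm (ystar P x - ystar P x'))).
    by apply: ler_wpM2r => //; exact: enorm_ge0.
  by apply: le_trans h2 _; rewrite /u /dist_x enormBC.
have h4 : enorm (y - ystar P x') <= enorm (y - ystar P x) + L / smu s * u.
  by apply: le_trans h1 _; rewrite lerD2l.
have h5 : enorm (y - ystar P x') ^+ 2 <= (enorm (y - ystar P x) + L / smu s * u) ^+ 2.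
  by rewrite ler_sqr ?nnegrE ?enorm_ge0 // (le_trans (enorm_ge0 _) h4).
have := sqr_ge0 (enorm (y - ystar P x) - L / smu s * u).
lra.
Qed.

Lemma grad_step_sqr_le : 0 <= L -> l <= 2 * smu s ->
  dist_grad_y P s ^+ 2 <= (1 + L / l) ^+ 2 * enorm (y - ystar P x) ^+ 2.
Proof.
move=> L0 h; have h1 := ystep_disp hSC hL Dx Dy l0 numu h.
rewrite -exprMn ler_sqr ?nnegrE ?enorm_ge0 //.
exact: le_trans (enorm_ge0 _) h1.
Qed.

(** Young's inequality with parameter [s / (2 (1 - s))] in [(1 - s) (a + b) ^ 2], where [b] bounds
    the motion of the maximiser. It yields both the factor [1 - s / 2] and the coefficient [C_t];
    the slack is a perfect square. *)
Lemma Delta_next_valid : L <= sL s -> enorm (y - ystar P x) ^+ 2 <= sDelta s ->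
  enorm (y' - ystar P x') ^+ 2 <= (1 - rat s) * enorm (y - ystar P x') ^+ 2 ->
  enorm (y' - ystar P x') ^+ 2 <= Delta_next P A s.
Proof.
move=> LM hd hc; rewrite (Delta_nextE hA ws).
have /andP[s0 s1] := rat_bounds ws.
have h1 := ler_enormB y (ystar P x) (ystar P x').
have h2 := ystar_lip hSC hL Dx Dx'.
have h3 : enorm (ystar P x - ystar P x') <= cond s * u.
  rewrite /cond mulrAC ler_pdivlMr // mulrC.
  apply: (@le_trans _ _ (pmu P * enorm (ystar P x - ystar P x'))).
    by apply: ler_wpM2r => //; exact: enorm_ge0.
  apply: le_trans h2 _; rewrite /u /dist_x enormBC; apply: ler_wpM2r => //; exact: enorm_ge0.
have h4 : enorm (y - ystar P x') <= enorm (y - ystar P x) + cond s * u.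
  by apply: le_trans h1 _; rewrite lerD2l.
apply: le_trans hc _.
have h5 : enorm (y - ystar P x') ^+ 2 <= (enorm (y - ystar P x) + cond s * u) ^+ 2.
  by rewrite ler_sqr ?nnegrE ?enorm_ge0 // (le_trans (enorm_ge0 _) h4).
have t0 : 0 <= 1 - rat s by rewrite subr_ge0 ltW.
apply: le_trans (ler_wpM2l t0 h5) _.
set a := enorm (y - ystar P x) in hd *; set b := cond s * u.
have -> : cc (rat s) / rat s * cond s ^+ 2 * dist_x P A s ^+ 2 = cc (rat s) / rat s * b ^+ 2.
  by rewrite /b [(cond s * u) ^+ 2]exprMn [RHS]mulrA.
have t1 : 0 <= 1 - rat s / 2 by lra.
have hd' := ler_wpM2l t1 hd.
apply: (@le_trans _ _ ((1 - rat s / 2) * a ^+ 2 + cc (rat s) / rat s * b ^+ 2)); last first.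
  by rewrite lerD2r; exact: hd'.
rewrite -(ler_pM2l s0) -subr_ge0.
have -> : rat s * ((1 - rat s / 2) * a ^+ 2 + cc (rat s) / rat s * b ^+ 2) -
   rat s * ((1 - rat s) * (a + b) ^+ 2) =
   2^-1 * (rat s * a - 2 * (1 - rat s) * b) ^+ 2.
  by rewrite /cc; field; rewrite gt_eqF.
by rewrite mulr_ge0 ?sqr_ge0.
Qed.
End LipConst.

Lemma gain_le_gap : phi P x y' - phi P x y <= Fr P x - phi P x y.
Proof. by rewrite lerD2r phi_le_Fr. Qed.

Section Accepted.
Hypothesis desc : pf P x' y + dotp (grad_y P x' y) (y' - y)
        <= pf P x' y' + l / 2 * enorm (y' - y) ^+ 2.

Lemma gain_ge : l / 2 * r ^+ 2 <= phi P x' y' - phi P x' y.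
Proof. by have := ystep_ascent hSC Dx' Dy l0 desc; rewrite addrC -lerBrDr. Qed.

Lemma dist_ystar_contract :
  enorm (y' - ystar P x') ^+ 2 <= (1 - rat s) * enorm (y - ystar P x') ^+ 2.
Proof. exact: ystep_dist. Qed.

Lemma gap_three_point : Fr P x' - phi P x' y' <=
   (l - smu s) / 2 * enorm (y - ystar P x') ^+ 2 - l / 2 * enorm (y' - ystar P x') ^+ 2.
Proof. exact: ystep_gap2. Qed.

Lemma gap_next_le_dist : Fr P x' - phi P x' y' <= l / 2 * (1 - rat s) * enorm (y - ystar P x') ^+ 2.
Proof.
have := gap_three_point; rewrite -rat_slE -/l.
have : 0 <= l / 2 * enorm (y' - ystar P x') ^+ 2.
  by rewrite mulr_ge0 ?sqr_ge0 // divr_ge0 // ltW.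
lra.
Qed.

(** The contraction of the gap says that the ascent is at least the fraction [s] of the gap before
    it, and that gap is at least [mu_t / 2] times the squared distance. *)
Lemma dist_ystar_le_gain : rat s * (rat s * l / 2) * enorm (y - ystar P x') ^+ 2 <=
  phi P x' y' - phi P x' y.
Proof.
have /andP[s0 s1] := rat_bounds ws.
have h1 := ystep_gap hSC Dx' Dy l0 desc mu0 numu (ltW mul).
have h2 := ystar_max hSC Dx' Dy.
have h3 : smu s / 2 * enorm (y - ystar P x') ^+ 2 <= Fr P x' - phi P x' y.
  have : 0 <= (pmu P - smu s) * enorm (y - ystar P x') ^+ 2.
    by rewrite mulr_ge0 ?sqr_ge0 // subr_ge0.
  lra.
rewrite rat_slE; rewrite -/(rat s) -/x' -/y' in h1.
have := ler_wpM2l (ltW s0) h3; lra.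
Qed.
End Accepted.

(** The reason why backtracking ends: trusted constants imply all four conditions. The last
    hypothesis concerns the gain at the old [x]; [mixed_gain_le] transfers it to [x_(t+1)]. *)
Lemma BC_true : pL P <= l -> enorm (y - ystar P x) ^+ 2 <= sDelta s ->
  phi P x y' - phi P x y <= sLambda s + sR s -> BC P A s.
Proof.
move=> Ll hd hLR; have /andP[s0 s1] := rat_bounds ws.
have LL := lexx (pL P).
have LP0 := L_ge0 hSC LL.
have Dw : dom (ph P) (ygrad P s) by exact: ystep_dom.
have desc0 z z' : dom (pg P) z -> dom (ph P) z' -> pf P z y + dotp (grad_y P z y) (z' - y)
        <= pf P z z' + l / 2 * enorm (z' - y) ^+ 2.
  move=> Dz Dz'; have := pf_lower_y hSC LL Dz Dy Dz'.
  have : 0 <= (l - pL P) * enorm (z' - y) ^+ 2 by rewrite mulr_ge0 ?sqr_ge0 // subr_ge0.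
  lra.
have t0 : 0 <= 1 - rat s by rewrite subr_ge0 ltW.
set q := Num.sqrt (1 - rat s); have q0 : 0 <= q by exact: sqrtr_ge0.
have qq : q ^+ 2 = 1 - rat s by rewrite sqr_sqrtr.
have hb : dist_grad_y P s ^+ 2 <= (1 + q) ^+ 2 * sDelta s.
  apply: (@le_trans _ _ ((1 + q) ^+ 2 * enorm (y - ystar P x) ^+ 2)); last first.
    by rewrite ler_wpM2l ?sqr_ge0.
  rewrite -exprMn ler_sqr ?nnegrE ?enorm_ge0 // ?mulr_ge0 ?enorm_ge0 ?addr_ge0 //.
  apply: le_trans (ler_enormB _ (ystar P x) _) _; rewrite (enormBC _ y) mulrDl mul1r addrC lerD2l.
  rewrite -ler_sqr ?nnegrE ?enorm_ge0 ?mulr_ge0 ?enorm_ge0 // exprMn qq.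
  exact: (ystep_dist hSC Dx Dy l0 (desc0 _ _ Dx Dw) numu).
have D0 : 0 <= sDelta s by apply: le_trans hd; exact: sqr_ge0.
have u0 : 0 <= u by exact: enorm_ge0.
have r0 : 0 <= r by exact: enorm_ge0.
have rbu : r <= dist_grad_y P s + u.
  apply: le_trans (next_step_le LL) _; rewrite lerD2l ler_piMl //.
  by rewrite ler_pdivrMr // mul1r.
split.
- apply/(BC1E hA ws hSC Dx Dy).
  have x1 : 1 <= (gamma A)^-1 by rewrite invf_ge1 ?(gamma_gt0 hA) // ltW // (gamma_lt1 hA).
  have s01 : 0 <= rat s <= 1 by rewrite !ltW.
  have hA2 : phi P x' y' - phi P x' y <= (sLambda s + sR s) + pL P * u * r.
    by apply: le_trans (mixed_gain_le LL) _; rewrite lerD2r.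
  have := bc1_aux q0 qq D0 l0 s01 Ll x1 u0 r0 rbu hb (descent_x LL) hA2.
  rewrite rat_slE /DLag -/x -/y -/x' -/y' => h; apply: le_trans h _.
  by rewrite lerD2l; lra.
- exact: (desc0 x' y' Dx' Dy').
- apply: le_trans (grad_yy_lip hSC LL Dx' Dy' Dy) _.
  by apply: ler_wpM2r => //; exact: enorm_ge0.
- by apply/(BC4E hA ws); apply: bc4_aux rbu hb.
Qed.
End Facts.

(** * The backtracking search *)

Section Search.
Context (R : realType) (n m : nat) (P : problem R n m) (A : input R n m).
Hypotheses (hA : valid_input P A) (hSC : SC P).
Implicit Types s a p : state R n m.

(** All values taken by [L_t], [mu_t] and [l_t] lie on these grids, with [k] the number of resets.
    As [Lk k = lj (r k)], comparing [l_t] with [L_t] amounts to comparing natural numbers. *)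
Definition Lk (k : nat) : R := l_tilde A * (gamma1 A)^-1 ^+ k.
Definition nuk (k : nat) : R := if mu_known A then pmu P else mu_tilde A * gamma1 A ^+ k.
Definition lj (j : nat) : R := l_tilde A * (gamma A)^-1 ^+ j.

Lemma igamma_gt1 : 1 < (gamma A)^-1.
Proof. by rewrite invf_gt1 ?(gamma_gt0 hA) // (gamma_lt1 hA). Qed.

Lemma Lk_lj k : Lk k = lj (rexp A * k).
Proof. by rewrite /Lk /lj /gamma1 -exprVn -exprM. Qed.

Lemma lj_gt0 j : 0 < lj j.
Proof.
rewrite mulr_gt0 ?(l_tilde_gt0 hA) // exprn_gt0 // (lt_trans ltr01) //.
exact: igamma_gt1.
Qed.

Lemma lj_le i j : (lj i <= lj j) = (i <= j)%N.
Proof. by rewrite ler_pM2l ?(l_tilde_gt0 hA) // ler_eXn2l ?igamma_gt1. Qed.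

Lemma lj_ge j : l_tilde A <= lj j.
Proof. by rewrite -[X in X <= _]mulr1 -(expr0 (gamma A)^-1) -/(lj 0) lj_le. Qed.

Lemma gamma1_gt0 : 0 < gamma1 A. Proof. by rewrite exprn_gt0 // (gamma_gt0 hA). Qed.
Lemma gamma1_lt1 : gamma1 A < 1.
Proof.
rewrite exprn_ilt1 ?ltW ?(gamma_gt0 hA) ?(gamma_lt1 hA) //.
by case: hA => _ _ _ + _; case: (rexp A).
Qed.

Lemma nuk_gt0 k : 0 < nuk k.
Proof.
rewrite /nuk; case: ifP => _; first exact: pmu_gt0.
by rewrite mulr_gt0 ?(mu_tilde_gt0 hA) // exprn_gt0 // gamma1_gt0.
Qed.

Lemma nuk_le k : nuk k <= mu_tilde A.
Proof.
rewrite /nuk; case: ifP => hk; first by case: hA => _ _ _ _ /(_ hk) ->.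
rewrite ler_piMr //; first by rewrite ltW // (mu_tilde_gt0 hA).
by apply: exprn_ile1; rewrite ltW // ?gamma1_gt0 ?gamma1_lt1.
Qed.

Lemma nuk_S k : Num.max (nuk k * gamma1 A) (mu_low P A) = nuk k.+1.
Proof.
rewrite /nuk /mu_low; case: ifP => hk.
  apply/max_idPr; rewrite ler_piMr //; first by rewrite ltW // (pmu_gt0 hSC).
  by rewrite ltW // gamma1_lt1.
rewrite -mulrA -exprSr; apply/max_idPl.
by rewrite ltW // mulr_gt0 ?(mu_tilde_gt0 hA) // exprn_gt0 // gamma1_gt0.
Qed.

Context (N : nat).
Hypothesis hD : (diam P < +oo)%E.
Hypotheses (hLN : pL P <= Lk N) (hnuN : nuk N <= pmu P).

(** [inv_j] allows [l] to overshoot [L] by one grid step, the situation that triggers a reset;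
    [inv_jN] forbids this in epoch [N], so there is no further reset. *)
Record inv (k j : nat) s : Prop := Inv {
  inv_x : dom (pg P) (sx s);
  inv_y : dom (ph P) (sy s);
  inv_L : sL s = Lk k;
  inv_mu : smu s = nuk k;
  inv_l : sl s = lj j;
  inv_k : (k <= N)%N;
  inv_j : (j <= (rexp A * k).+1)%N;
  inv_jN : k = N -> (j <= rexp A * N)%N }.

Lemma inv_wf k j s : inv k j s -> wf s.
Proof.
move=> I; have h := le_lt_trans (nuk_le k) (mu_lt_l_tilde hA).
split; rewrite (inv_mu I) ?(inv_l I) ?(inv_L I) ?nuk_gt0 //.
  exact: lt_le_trans (lj_ge _).
by rewrite Lk_lj; apply/ltW/(lt_le_trans h)/lj_ge.
Qed.

(* What [refresh] guarantees about [y_t]. *)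
Definition start_ok s := if max_solver A then is_true (Fr P (sx s) - phi P (sx s) (sy s) <= zeta A)
  else exists y0, [/\ dom (ph P) y0,
    sy s = prox (escale (sL s)^-1 (ph P)) (y0 + (sL s)^-1 *: grad_y P (sx s) y0) &
    sd s = enorm (sy s - y0)].

Lemma bounds_sx s : sx (bounds P A s) = sx s. Proof. by rewrite /bounds; case: ifP. Qed.
Lemma bounds_sy s : sy (bounds P A s) = sy s. Proof. by rewrite /bounds; case: ifP. Qed.
Lemma bounds_sl s : sl (bounds P A s) = sl s. Proof. by rewrite /bounds; case: ifP. Qed.
Lemma bounds_sL s : sL (bounds P A s) = sL s. Proof. by rewrite /bounds; case: ifP. Qed.
Lemma bounds_smu s : smu (bounds P A s) = smu s. Proof. by rewrite /bounds; case: ifP. Qed.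
Lemma bounds_sd s : sd (bounds P A s) = sd s. Proof. by rewrite /bounds; case: ifP. Qed.
Lemma bounds_sflag s : sflag (bounds P A s) = sflag s. Proof. by rewrite /bounds; case: ifP. Qed.
Lemma bounds_idem s : bounds P A (bounds P A s) = bounds P A s.
Proof. by rewrite {2 3}/bounds; case: ifP => h; rewrite /bounds /= h. Qed.
Lemma bounds_unflagged s : ~~ sflag s -> bounds P A s = s.
Proof. by rewrite /bounds => /negbTE ->. Qed.

Lemma rexp_gt0 : (0 < rexp A)%N. Proof. by case: hA. Qed.

Lemma inv_bounds k j s : inv k j s -> inv k j (bounds P A s).
Proof.
by case=> *; split; rewrite ?bounds_sx ?bounds_sy ?bounds_sl ?bounds_sL ?bounds_smu.
Qed.

Lemma start_ok_bounds s : start_ok s -> start_ok (bounds P A s).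
Proof. by rewrite /start_ok bounds_sx bounds_sy bounds_sL bounds_sd. Qed.

Lemma diam_fine : diam P = (fine (diam P))%:E /\ 0 <= fine (diam P).
Proof.
case: (ph_closed hSC) => [[_ [y Dy]] _ _].
have d0 : (0 <= diam P)%E.
  by apply: ereal_sup_ubound; exists y => //; exists y => //; rewrite subrr enorm0.
by rewrite fineK ?fine_ge0 // fin_numE gt_eqF ?(lt_le_trans _ d0) ?ltNye // lt_eqF.
Qed.

Lemma diam_le y z : dom (ph P) y -> dom (ph P) z -> enorm (y - z) <= fine (diam P).
Proof.
move=> Dy Dz; rewrite -lee_fin; have [<- _] := diam_fine.
by apply: ereal_sup_ubound; exists y => //; exists z.
Qed.

Lemma min_bar_ge (c a : R) b : c <= a -> (c%:E <= b)%E -> c <= min_bar a b.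
Proof.
move=> ca cb; rewrite /min_bar.
have h : (c%:E <= mine a%:E b)%E by rewrite le_min lee_fin ca.
rewrite -lee_fin fineK // fin_numE gt_eqF ?(lt_le_trans _ h) ?ltNyr //= lt_eqF //.
by apply: (@le_lt_trans _ _ a%:E); rewrite ?ltry // ge_min lexx.
Qed.

Lemma diam_bar_sqr : (diam_bar P A ^+ 2)%E =
  if diam_known A then (fine (diam P) ^+ 2)%:E else +oo%E.
Proof.
rewrite /diam_bar; case: ifP => _; last by rewrite expe2 mulyy.
by have [-> _] := diam_fine; rewrite EFin_expe.
Qed.

(** With a maximisation oracle this is quadratic growth. With a proximal start, the contraction of
    the step from [y0] bounds the distance to the maximiser by a multiple of the step length [d_t],
    and [ystep_lin] bounds the gain. *)
Lemma start_trusted k j s : inv k j s -> sflag s -> start_ok s ->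
  pL P <= sL s -> smu s <= pmu P ->
  enorm (sy s - ystar P (sx s)) ^+ 2 <= sDelta (bounds P A s) /\
  phi P (sx s) (y_next P A s) - phi P (sx s) (sy s) <= sLambda (bounds P A s).
Proof.
move=> I fs; have [mu0 mul muL] := inv_wf I; have Dx := inv_x I; have Dy := inv_y I.
have l0 : 0 < sl s := lt_trans mu0 mul; have L0 : 0 < sL s := lt_le_trans mu0 muL.
have Dy' : dom (ph P) (y_next P A s) by exact: ystep_dom.
rewrite /start_ok /bounds fs /=; case: ifP => _ => [hz|[y0 [Dy0 yE dE]]] LsL mus.
  split.
    rewrite ler_pdivlMr //.
    have h1 := ystar_max hSC Dx Dy.
    have : 0 <= (pmu P - smu s) * enorm (sy s - ystar P (sx s)) ^+ 2.
      by rewrite mulr_ge0 ?sqr_ge0 // subr_ge0.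
    lra.
  have h1 := phi_le_Fr hSC Dx Dy'.
  apply: (@le_trans _ _ (zeta A)); first lra.
  by rewrite lerDl !mulr_ge0 ?sqrtr_ge0 ?enorm_ge0 // ltW.
have desc : pf P (sx s) y0 + dotp (grad_y P (sx s) y0) (sy s - y0)
        <= pf P (sx s) (sy s) + sL s / 2 * enorm (sy s - y0) ^+ 2.
  have := pf_lower_y hSC (lexx _) Dx Dy0 Dy.
  have : 0 <= (sL s - pL P) * enorm (sy s - y0) ^+ 2 by rewrite mulr_ge0 ?sqr_ge0 // subr_ge0.
  lra.
split; last first.
  have := ystep_lin hSC (lexx _) Dx Dy0 L0 Dy'; rewrite -yE => h; apply: le_trans h _.
  rewrite dE (enormBC (sy s) (y_next P A s)) ler_wpM2r ?enorm_ge0 //.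
  have : 0 <= (sL s - pL P) * enorm (sy s - y0) by rewrite mulr_ge0 ?enorm_ge0 // subr_ge0.
  lra.
have hd := ystep_dist hSC Dx Dy0 L0 _ mus; rewrite -yE in hd; have {hd} := hd desc.
set t := smu s / sL s => hd.
set a := enorm (sy s - ystar P (sx s)) in hd *.
have t0 : 0 < t by rewrite divr_gt0.
have t1 : t <= 1 by rewrite ler_pdivrMr // mul1r.
have a0 : 0 <= a by exact: enorm_ge0.
apply: min_bar_ge; last first.
  have E := diam_bar_sqr; rewrite expe2 in E; rewrite ?expe2 E.
  case: ifP => _; rewrite ?leey // lee_fin ler_sqr ?nnegrE //.
    by apply: diam_le => //; exact: dom_ystar.
  by have [] := diam_fine.
have d0 : 0 <= sd s by rewrite dE enorm_ge0.
have hb : enorm (y0 - ystar P (sx s)) <= sd s + a.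
  by rewrite dE (enormBC (sy s) y0); exact: ler_enormB.
have hb2 : enorm (y0 - ystar P (sx s)) ^+ 2 <= (sd s + a) ^+ 2.
  by rewrite ler_sqr ?nnegrE ?enorm_ge0 // addr_ge0.
have h1 : a ^+ 2 <= (1 - t) * (sd s + a) ^+ 2.
  by apply: le_trans hd _; rewrite ler_wpM2l // subr_ge0.
rewrite -exprMn ler_sqr ?nnegrE //; last first.
  by rewrite mulr_ge0 // addr_ge0 // divr_ge0 ?mulr_ge0 // ltW.
(* Otherwise [d + a < (1 + t / 2) a], but [(1 - t) (1 + t / 2) ^ 2 < 1], against the contraction. *)
have ta : t * a <= 2 * sd s.
  rewrite leNgt; apply/negP => h.
  have ap : 0 < a by rewrite lt_def a0 andbT; apply: contraTneq h => ->; rewrite mulr0; lra.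
  have k2 : (sd s + a) ^+ 2 <= ((1 + t / 2) * a) ^+ 2.
    by rewrite ler_sqr ?nnegrE ?addr_ge0 ?mulr_ge0 ?addr_ge0 ?divr_ge0 ?(ltW t0) //; lra.
  have t1' : 0 <= 1 - t by rewrite subr_ge0.
  have k3 := le_trans h1 (ler_wpM2l t1' k2).
  have k4 : 0 < (3 / 4 * t ^+ 2 + t ^+ 3 / 4) * a ^+ 2.
    have t2 : 0 < t ^+ 2 by rewrite exprn_gt0.
    have t3 : 0 < t ^+ 3 by rewrite exprn_gt0.
    by apply: mulr_gt0; [lra|rewrite exprn_gt0].
  lra.
have -> : 2 * sL s / smu s = 2 / t by rewrite /t; field; rewrite !gt_eqF.
rewrite -(ler_pM2l t0); apply: le_trans ta _.
have -> : t * ((1 + 2 / t) * sd s) = t * sd s + 2 * sd s by field; rewrite gt_eqF.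
by rewrite lerDr mulr_ge0 // ltW.
Qed.

(** The counterpart of [start_ok] for states with the flag down, whose [Delta], [Lambda] and [R]
    come from the recursions. It is established in epoch [N], where the constants are trusted. *)
Definition gap_ok s := enorm (sy s - ystar P (sx s)) ^+ 2 <= sDelta s /\
  Fr P (sx s) - phi P (sx s) (sy s) <= sLambda s + sR s.

Lemma y_next_bounds s : y_next P A (bounds P A s) = y_next P A s.
Proof. by rewrite /bounds; case: ifP. Qed.

Lemma inv_top k j s : k = N -> inv k j s -> pL P <= sL s /\ smu s <= pmu P.
Proof. by move=> -> I; rewrite (inv_L I) (inv_mu I). Qed.

Lemma inv_sl_le k j s : inv k j s -> (sl s <= sL s) = (j <= rexp A * k)%N.
Proof. by move=> I; rewrite (inv_l I) (inv_L I) Lk_lj lj_le. Qed.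

Lemma BC_at_top j s : inv N j s -> (sflag s -> start_ok s) -> (~~ sflag s -> gap_ok s) ->
  sL s <= sl s -> BC P A (bounds P A s).
Proof.
move=> I hf hu Ll; have [LL mm] := inv_top (erefl N) I; have I' := inv_bounds I.
have hl : pL P <= sl (bounds P A s) by rewrite bounds_sl; apply: le_trans Ll.
have hm : smu (bounds P A s) <= pmu P by rewrite bounds_smu.
apply: (BC_true hA hSC (inv_wf I') (inv_x I') (inv_y I') hm hl);
  rewrite ?y_next_bounds bounds_sx bounds_sy; have [fs|fs] := boolP (sflag s).
- by have [] := start_trusted I fs (hf fs) LL mm.
- by rewrite bounds_unflagged //; case: (hu fs).
- have [_ h] := start_trusted I fs (hf fs) LL mm; apply: le_trans h _.
  by rewrite lerDl /bounds fs.
- have [_ h] := hu fs; rewrite bounds_unflagged //; apply: le_trans h.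
  have Dy' : dom (ph P) (y_next P A s).
    by apply: ystep_dom => //; case: (inv_wf I) => m0 ml _; exact: lt_trans ml.
  by rewrite lerD2r phi_le_Fr //; exact: inv_x I.
Qed.

Record accepted (k j : nat) a : Prop := Accepted {
  acc_inv : inv k j a;
  acc_j : (j <= rexp A * k)%N;
  acc_BC : BC P A a;
  acc_bounds : bounds P A a = a;
  acc_start : sflag a -> start_ok a;
  acc_Delta_ge0 : 0 <= sDelta a;
  acc_delta : k = N -> enorm (sy a - ystar P (sx a)) ^+ 2 <= sDelta a }.

Lemma start_Delta_ge0 k j s : inv k j s -> sflag s -> 0 <= sDelta (bounds P A s).
Proof.
move=> I fs; rewrite /bounds fs /=; case: ifP => _.
  by rewrite divr_ge0 ?mulr_ge0 // ltW // ?(zeta_gt0 hA) // (inv_mu I) nuk_gt0.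
apply: min_bar_ge; first by rewrite mulr_ge0 ?sqr_ge0.
have E := diam_bar_sqr; rewrite expe2 in E; rewrite ?expe2 E.
by case: ifP => _; rewrite ?leey // lee_fin sqr_ge0.
Qed.

(** In epoch [N], [BC_at_top] rules out a failed trial at [l = L] and [inv_jN] rules out a reset.
    The two outcomes separate iterations that continue an epoch, where only [l] has changed if the
    flag was down, from those that open a new one with refreshed [y]. *)
Lemma search_spec s a : search P A s a -> forall k j, inv k j s ->
  (sflag s -> start_ok s) -> (~~ sflag s -> k = N -> gap_ok s) -> (~~ sflag s -> 0 <= sDelta s) ->
  exists k' j', [/\ accepted k' j' a, sx a = sx s &
    [/\ k' = k, sflag a = sflag s, sl s <= sl a &
        (~~ sflag s -> a = State (sx s) (sy s) (sl a) (sL s) (smu s)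
          (sd s) (sflag s) (sDelta s) (sLambda s) (sR s))]
    \/ (k < k')%N /\ sflag a].
Proof.
elim=> {s a} [s hl hBC|s a hl nBC _ IH|s s' a hl hr _ IH] k j I hf hu hn.
- exists k, j; split; [|by rewrite bounds_sx|left; split => //].
  + split; rewrite ?bounds_idem ?bounds_sflag -?(inv_sl_le I) //; first exact: inv_bounds.
      by move=> /hf; exact: start_ok_bounds.
      have [fs|fs] := boolP (sflag s); first exact: start_Delta_ge0 I fs.
      by rewrite bounds_unflagged // hn.
    move=> kN; rewrite bounds_sy bounds_sx; have [LL mm] := inv_top kN I.
    have [fs|fs] := boolP (sflag s); first by have [] := start_trusted I fs (hf fs) LL mm.
    by rewrite bounds_unflagged //; case: (hu fs kN).
  + exact: bounds_sflag.
  + by rewrite bounds_sl.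
  + by move=> /bounds_unflagged ->; case: s {hl hBC I hf hu hn}.
- have I' := inv_bounds I.
  have jk : (j <= rexp A * k)%N by rewrite -(inv_sl_le I).
  have jN : k = N -> (j < rexp A * N)%N.
    move=> kN; rewrite ltn_neqAle (inv_jN I kN) andbT; apply/eqP => jE; apply: nBC.
    have IN : inv N j s by rewrite -kN.
    apply: (BC_at_top IN hf (fun h => hu h kN)).
    by rewrite (inv_l IN) (inv_L IN) Lk_lj lj_le jE.
  have I2 : inv k j.+1 (shrink_step A (bounds P A s)).
    case: I' => [b1 b2 b3 b4 b5 b6 b7 b8]; split=> //=.
    by rewrite b5 /lj /gamma2 exprSr mulrA.
  have hf2 : sflag (shrink_step A (bounds P A s)) -> start_ok (shrink_step A (bounds P A s)).
    by rewrite /= bounds_sflag => /hf /start_ok_bounds.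
  have hu2 : ~~ sflag (shrink_step A (bounds P A s)) -> k = N ->
      gap_ok (shrink_step A (bounds P A s)).
    by rewrite /= bounds_sflag => fs; rewrite /gap_ok /= bounds_unflagged //; exact: hu.
  have hn2 : ~~ sflag (shrink_step A (bounds P A s)) -> 0 <= sDelta (shrink_step A (bounds P A s)).
    by rewrite /= bounds_sflag => fs; rewrite bounds_unflagged //; exact: hn.
  have [k' [j' [ac sxE alt]]] := IH _ _ I2 hf2 hu2 hn2.
  exists k', j'; split => //; first by rewrite sxE /= bounds_sx.
  case: alt => [[kE fE lE aE]|h]; [left|by right].
  split=> //; first by rewrite fE /= bounds_sflag.
    apply: le_trans lE; rewrite /= bounds_sl /gamma2 ler_pdivlMr ?(gamma_gt0 hA) //.
    rewrite ler_piMr ?ltW ?(gamma_lt1 hA) // (inv_l I) lj_gt0 //.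
  by move=> fs; rewrite aE /= ?bounds_sflag // bounds_unflagged.
- have rk : (rexp A * k < j)%N by rewrite ltnNge -(inv_sl_le I) -ltNge.
  have kN : (k < N)%N.
    rewrite ltn_neqAle (inv_k I) andbT; apply/eqP => kN.
    by have := inv_jN I kN; rewrite -kN leqNgt rk.
  have r0 := rexp_gt0.
  have jk1 : (j <= rexp A * k.+1)%N by apply: leq_trans (inv_j I) _; rewrite mulnS; lia.
  have Ie y d f D Lam r : dom (ph P) y ->
      inv k.+1 j (State (sx (enlarge P A s)) y (sl (enlarge P A s)) (sL (enlarge P A s))
        (smu (enlarge P A s)) d f D Lam r).
    move=> Dy; case: I => b1 b2 b3 b4 b5 b6 b7 b8; split=> //=.
    - by rewrite b3 /Lk exprSr mulrA.
    - by rewrite b4 nuk_S.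
    - exact: leq_trans jk1 _.
    - by move=> <-.
  have [I' fs' st' sxE'] : [/\ inv k.+1 j s', sflag s', start_ok s' & sx s' = sx s].
    have Dx : dom (pg P) (sx (enlarge P A s)) := inv_x I.
    case: hr => [y' ms nf hF|ms fs|nms].
    - have [Dy' hz] := Fmax_le_dom hSC Dx hF.
      by split => //; [exact: Ie|rewrite /start_ok ms].
    - split => //; [exact: (Ie _ _ _ _ _ _ (inv_y I))|].
      by have := hf fs; rewrite /start_ok ms.
    - have Dy : dom (ph P) (y_hat P (enlarge P A s)).
        apply: ystep_dom => //=; rewrite (inv_L I) divr_gt0 ?gamma1_gt0 // Lk_lj lj_gt0 //.
      split => //; first exact: Ie.
      by rewrite /start_ok (negbTE nms) /=; exists (sy s); split => //; exact: inv_y I.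
  have [||k' [j' [ac sxE alt]]] := IH _ _ I' (fun _ => st'); rewrite ?fs' //.
  exists k', j'; split => //; first by rewrite sxE.
  right; case: alt => [[-> -> _ _]|[kk ->]]; first by split.
  by split => //; apply: ltn_trans kk.
Qed.
End Search.

(** * Summation over the generated sequence *)

(** Shows why [Lambda_(t+1) + R_(t+1)] bounds the new gap: in the three-point bound
    [d ^ 2 <= 2 r ^ 2 + 2 dl ^ 2], then BC(iv) replaces [l r ^ 2] while [- nu r ^ 2] survives as the
    negative part of [R_(t+1)]. *)
Lemma gap_aux (R : realFieldType) (l nu d r dl Del u e Delp : R) :
  0 < nu -> nu < l -> 0 <= d -> 0 <= r -> 0 <= dl -> d <= r + dl ->
  e <= (l - nu) / 2 * d ^+ 2 - l / 2 * dl ^+ 2 ->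
  l * r ^+ 2 <= (12 * l - 8 * nu) * Del + 2 * l * u ^+ 2 -> dl ^+ 2 <= Delp ->
  e <= 6 * l * (Delp + 2 * Del) - 8 * nu * Del + (2 * l * u ^+ 2 - nu * r ^+ 2).
Proof.
move=> nu0 nul d0 r0 dl0 hd he hr hD.
have h1 : d ^+ 2 <= 2 * r ^+ 2 + 2 * dl ^+ 2.
  have : d ^+ 2 <= (r + dl) ^+ 2 by rewrite ler_sqr ?nnegrE // (le_trans d0).
  by have := sqr_ge0 (r - dl); lra.
have l0 : 0 <= (l - nu) / 2 by lra.
have h2 := ler_wpM2l l0 h1.
have l1 : 0 <= l by lra.
have h3 := ler_wpM2l l1 hD.
have h4 : 0 <= nu * dl ^+ 2 by rewrite mulr_ge0 ?sqr_ge0 // ltW.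
have h5 : 0 <= l * Delp by rewrite mulr_ge0 // (le_trans _ hD) // sqr_ge0.
lra.
Qed.

Section Sum.
Context (R : realType) (n m : nat) (P : problem R n m) (A : input R n m).
Hypotheses (hA : valid_input P A) (hSC : SC P) (hD : (diam P < +oo)%E).
Context (N : nat).
Hypotheses (hLN : pL P <= Lk A N) (hnuN : nuk P A N <= pmu P).
Implicit Types s a p : state R n m.

Local Notation accepted := (accepted P A N).
Local Notation inv := (inv P A N).

Lemma acc_wf k j a : accepted k j a -> wf a.
Proof. by move=> /acc_inv; apply: inv_wf. Qed.

Lemma acc_desc k j a : accepted k j a ->
  pf P (x_next P A a) (sy a) + dotp (grad_y P (x_next P A a) (sy a)) (y_next P A a - sy a)
        <= pf P (x_next P A a) (y_next P A a) + sl a / 2 * enorm (y_next P A a - sy a) ^+ 2.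
Proof. by move=> /acc_BC[]. Qed.

Lemma acc_iv k j a : accepted k j a ->
  dist_y P A a ^+ 2 <= (12 - 8 * rat a) * sDelta a + 2 * dist_x P A a ^+ 2.
Proof. by move=> ac; case: (acc_BC ac) => _ _ _ /(BC4E hA (acc_wf ac)). Qed.

Lemma acc_i k j a : accepted k j a ->
  qx P A a - (2 + (gamma A)^-1) * sl a * dist_x P A a ^+ 2 + sl a * dist_grad_y P a ^+ 2
    + rat a * sl a / 2 * dist_y P A a ^+ 2
    <= sLambda a + sR a + 4 * (3 * sl a - 2 * smu a) * sDelta a + DLag P A a.
Proof.
move=> ac; case: (acc_BC ac) => + _ _ _.
by move/(BC1E hA (acc_wf ac) hSC (inv_x (acc_inv ac)) (inv_y (acc_inv ac))).
Qed.

Lemma acc_domx k j a : accepted k j a -> dom (pg P) (x_next P A a).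
Proof.
move=> ac; have I := acc_inv ac.
exact: (dom_x_next hA (acc_wf ac) hSC (inv_x I) (inv_y I)).
Qed.

Lemma acc_domy k j a : accepted k j a -> dom (ph P) (y_next P A a).
Proof. by move=> ac; apply: (dom_y_next A (acc_wf ac) hSC). Qed.

Lemma Delta_next_ge0 s : wf s -> 0 <= sDelta s -> 0 <= Delta_next P A s.
Proof.
move=> ws h; have /andP[s0 s1] := rat_bounds ws.
rewrite (Delta_nextE hA ws); apply: addr_ge0; first by apply: mulr_ge0 => //; lra.
apply: mulr_ge0; last exact: sqr_ge0.
by apply: mulr_ge0 (sqr_ge0 _); apply: divr_ge0 (cc_rat_ge0 ws) (ltW s0).
Qed.

Lemma gap_advance j a : accepted N j a -> gap_ok P (advance P A a).
Proof.
move=> ac; have wa := acc_wf ac; have Ia := acc_inv ac.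
have Dx := inv_x Ia; have Dy := inv_y Ia; have Dx' := acc_domx ac; have Dy' := acc_domy ac.
have [LL mm] := inv_top hLN hnuN (erefl N) Ia; have hd := acc_desc ac.
have [mu0 mul muL] := wa; have l0 : 0 < sl a := lt_trans mu0 mul.
have hdist := dist_ystar_contract hA hSC wa Dx Dy mm hd.
have hDel := Delta_next_valid hA hSC wa Dx Dy mm (lexx _) LL (acc_delta ac (erefl N)) hdist.
split; first exact: hDel.
have hg := gap_three_point hA hSC wa Dx Dy mm hd.
rewrite (sR_advance hA wa) /=.
apply: (gap_aux mu0 mul (enorm_ge0 _) (enorm_ge0 (y_next P A a - sy a)) (enorm_ge0 _) _ hg _ hDel).
  by rewrite (enormBC (y_next P A a)); exact: ler_enormB.
have := ler_wpM2l (ltW l0) (acc_iv ac); rewrite -(rat_slE wa) /dist_y; lra.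
Qed.

Lemma inv_advance k j a : accepted k j a -> inv k j.-1 (advance P A a).
Proof.
move=> ac; have [b1 b2 b3 b4 b5 b6 b7 b8] := acc_inv ac.
have jk := acc_j ac.
split=> //=.
- exact: acc_domx ac.
- exact: acc_domy ac.

(* At [j = 0] the maximum with [l_tilde] is attained by [l_tilde], which matches the truncated
   predecessor. *)
- rewrite b5 /gamma2; case: (j) => [|i].
    rewrite /lj expr0 mulr1; apply/max_idPr; rewrite ler_piMl ?ltW ?(l_tilde_gt0 hA) //.
    exact: gamma_lt1 hA.
  have -> : gamma A * lj A i.+1 = lj A i.
    by rewrite /lj exprS; field; rewrite gt_eqF ?(gamma_gt0 hA).
  by apply/max_idPl; exact: (lj_ge hA).
- exact: leq_trans (leq_pred _) b7.
- by move=> /b8; exact: leq_trans (leq_pred _).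
Qed.

(** The fields of [advance] survive the search since [bounds] leaves unflagged states alone.
    [cont_l] limits the decrease of [l] and is the source of [x] in the factor [18 x]. *)
Record continues p a : Prop := Continues {
  cont_flag : ~~ sflag a;
  cont_x : sx a = x_next P A p;
  cont_y : sy a = y_next P A p;
  cont_Delta : sDelta a = Delta_next P A p;
  cont_Lambda : sLambda a = 6 * sl p * (Delta_next P A p + 2 * sDelta p) - 8 * smu p * sDelta p;
  cont_R : sR a = 2 * sl p * dist_x P A p ^+ 2 - smu p * dist_y P A p ^+ 2;
  cont_mu : smu a = smu p;
  cont_L : sL a = sL p;
  cont_l : gamma A * sl p <= sl a }.

Lemma search_advance k j p a : accepted k j p -> search P A (advance P A p) a ->
  exists k' j', [/\ accepted k' j' a, sx a = x_next P A p &
    (k' = k /\ continues p a) \/ ((k < k')%N /\ sflag a)].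
Proof.
move=> ac hs; have Ip := inv_advance ac.
have hu : ~~ sflag (advance P A p) -> k = N -> gap_ok P (advance P A p).
  by move=> _ kN; rewrite kN in ac; exact: gap_advance ac.
have hf : sflag (advance P A p) -> start_ok P A (advance P A p) by [].
have h0 : ~~ sflag (advance P A p) -> 0 <= sDelta (advance P A p).
  by move=> _; apply: Delta_next_ge0 (acc_wf ac) (acc_Delta_ge0 ac).
have [k' [j' [aa sxE alt]]] := search_spec hA hSC hD hLN hnuN hs Ip hf hu h0.
exists k', j'; split => //; case: alt => [[-> fE lE /(_ isT) aE]|h]; [left|by right].
split => //; have RE := sR_advance hA (acc_wf ac).
split; try by rewrite aE.
- by apply: le_trans lE; rewrite /= le_max lexx.
Qed.

Lemma first_search s a : refresh P A (init_state A) s -> search P A s a ->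
  exists k j, accepted k j a /\ sflag a.
Proof.
move=> hr hs.
have mu00 : mu_tilde A = nuk P A 0.
  rewrite /nuk expr0 mulr1; case: ifP => // h.
  by case: hA => _ _ _ _ /(_ h).
have L00 : l_tilde A = Lk A 0 by rewrite /Lk expr0 mulr1.
have l00 : l_tilde A = lj A 0 by rewrite /lj expr0 mulr1.
have [[Dx Dy] _ _ _ _] := hA.
have Ie y d f D Lam r : dom (ph P) y ->
  inv 0 0 (State (x_init A) y (l_tilde A) (l_tilde A) (mu_tilde A) d f D Lam r).
  by move=> Dy'; split.
have [I fs st] : [/\ inv 0 0 s, sflag s & start_ok P A s].
  case: hr => [y' ms nf hF|ms //|nms].
  - have [Dy' hz] := Fmax_le_dom hSC Dx hF.
    by split => //; rewrite /start_ok ms.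
  - have Dy' : dom (ph P) (y_hat P (init_state A)).
      by apply: ystep_dom => //=; exact: l_tilde_gt0 hA.
    split => //.
    by rewrite /start_ok (negbTE nms) /=; exists (y_init A); split.
have [|||k [j [ac _ alt]]] := search_spec hA hSC hD hLN hnuN hs I; rewrite ?fs //.
by exists k, j; split => //; case: alt => [[_ -> _ _]|[]].
Qed.

Context (Pot : nat -> state R n m -> R) (E : nat -> R) (J Jend Fs : R).
Hypotheses (E0 : forall k, (k <= N)%N -> 0 <= E k) (J0 : 0 <= J) (Jend0 : 0 <= Jend).
Hypothesis hP1 : forall k j a, accepted k j a -> sflag a ->
  summand P A a + Pot k a <= phi P (sx a) (sy a) + E k.
Hypothesis hP2 : forall k j j' p a, accepted k j p -> accepted k j' a -> continues p a ->
  summand P A a + Pot k a <= Pot k p.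
Hypothesis hP3 : forall k j p y, (k < N)%N -> accepted k j p -> dom (ph P) y ->
  phi P (x_next P A p) y <= Pot k p + J.
Hypothesis hP4 : forall k j p, accepted k j p -> Fs <= Pot k p + (if k == N then Jend else J).

(** Telescoping over epochs: [E k] is the price of entering epoch [k], [J] that of leaving an epoch,
    [Jend] that of stopping in epoch [N]. A reset replaces [y_t], so [hP3] must hold for every [y]
    in the domain. *)
Lemma sum_bound (T : nat) (z : nat -> state R n m) : generated P A T z ->
  \sum_(0 <= t < T.+1) summand P A (z t) <=
  phi P (sx (z 0%N)) (sy (z 0%N)) - Fs + (\sum_(i < N.+1) E i + N%:R * J + Jend).
Proof.
move=> [[s hr hs] hz]; set f0 := phi P _ _.
(* Several resets may occur within one iteration; the epochs skipped have nonnegative cost. *)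
have Emono k k' : (k < k')%N -> (k' <= N)%N ->
    \sum_(i < k.+1) E i + E k' <= \sum_(i < k'.+1) E i.
  move=> kk kN; rewrite [X in _ <= X]big_ord_recr /= lerD2r.
  rewrite -!(big_mkord xpredT) (big_cat_nat (leq0n k.+1) kk) //= lerDl.
  rewrite big_nat_cond sumr_ge0 // => i /andP[/andP[_ ik] _].
  by apply: E0; apply: leq_trans kN; exact: ltnW.
have Ele k : (k <= N)%N -> 0 <= \sum_(i < k.+1) E i.
  by move=> kN; apply: sumr_ge0 => i _; apply: E0; apply: leq_trans kN; rewrite -ltnS.
have key t : (t <= T)%N -> exists k j, accepted k j (z t) /\
    \sum_(0 <= i < t.+1) summand P A (z i) + Pot k (z t)
      <= f0 + (\sum_(i < k.+1) E i + k%:R * J).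
  elim: t => [_|t IH tT].
    have [k [j [ac fz]]] := first_search hr hs.
    exists k, j; split => //; rewrite big_nat1.
    have := hP1 ac fz; rewrite -/f0 => h; apply: le_trans h _; rewrite lerD2l.
    rewrite big_ord_recr /=.
    have h1 : 0 <= k%:R * J by rewrite mulr_ge0 // ler0n.
    have : 0 <= \sum_(i < k) E i; last lra.
    case: (k) (inv_k (acc_inv ac)) => [|k'] h'; first by rewrite big_ord0.
    exact/Ele/ltnW.
  have [k [j [ac hk]]] := IH (ltnW tT).
  have [k' [j' [aa sxE alt]]] := search_advance ac (hz _ tT).
  exists k', j'; split => //; rewrite big_nat_recr //=.
  case: alt aa => [[-> hc]|[kk fz]] aa.
    have := hP2 ac aa hc; lra.
  have k'N := inv_k (acc_inv aa).
  have h1 := hP1 aa fz; have h2 := hP3 (leq_trans kk k'N) ac (inv_y (acc_inv aa)).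
  rewrite -sxE in h2; have h3 := Emono _ _ kk k'N.
  have h4 : (k%:R + 1) * J <= k'%:R * J by rewrite ler_wpM2r // natr1 ler_nat.
  lra.
have [k [j [ac hk]]] := key T (leqnn T); have kN := inv_k (acc_inv ac).
have := hP4 ac; case: eqP hk => [->|/eqP nkN] hk h; first by lra.
have kN' : (k < N)%N by rewrite ltn_neqAle nkN.
have h3 := Emono _ _ kN' (leqnn N); have h4 := E0 (leqnn N).
have h5 : k%:R * J + J <= N%:R * J by rewrite -[X in _ + X]mul1r -mulrDl ler_wpM2r // natr1 ler_nat.
move: hk h h3 h4 h5 Jend0; move: (k%:R * J) (N%:R * J) (\sum_(i < k.+1) E i) => a b c; lra.
Qed.
End Sum.

(** * Constants *)

Section Constants.
Context (R : realType) (n m : nat) (P : problem R n m) (A : input R n m).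
Hypotheses (hA : valid_input P A) (hSC : SC P) (hD : (diam P < +oo)%E).
Implicit Types s a p : state R n m.

Definition reset_num := `|reset_bound P A|%N.
Local Notation N := reset_num.
Local Notation g := (gamma1 A)^-1.
Local Notation D := (fine (diam P)).

Let g0 : 0 < gamma1 A. Proof. exact: gamma1_gt0 hA. Qed.
Let lt0 : 0 < l_tilde A. Proof. exact: l_tilde_gt0 hA. Qed.
Let mt0 : 0 < mu_tilde A. Proof. exact: mu_tilde_gt0 hA. Qed.
Let mu0 : 0 < pmu P. Proof. exact: pmu_gt0. Qed.
Let D0 : 0 <= D. Proof. by have [] := diam_fine hSC hD. Qed.
Let ze0 : 0 < zeta A. Proof. exact: zeta_gt0 hA. Qed.

Lemma igamma1_gt1 : 1 < g.
Proof. by rewrite invf_gt1 ?gamma1_gt0 // (gamma1_lt1 hA). Qed.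
Let g1 := igamma1_gt1.
Let gp : 0 < g. Proof. exact: lt_trans ltr01 g1. Qed.

Lemma Rcal_ge1 : 1 <= Rcal P A. Proof. by rewrite le_max lexx orbT. Qed.
Let R1 := Rcal_ge1.
Let Rp : 0 < Rcal P A. Proof. exact: lt_le_trans ltr01 R1. Qed.

Lemma pL_le_L_bar : pL P <= L_bar P A.
Proof. by rewrite /L_bar -ler_pdivrMr // !le_max lexx orbT. Qed.

Lemma mu_tilde_le : mu_tilde A <= Rcal P A * pmu P.
Proof. by rewrite -ler_pdivrMr // !le_max lexx. Qed.

Let q := (rexp A)%:R^-1 * (ln (Rcal P A) / ln (gamma A)^-1).

Let lnx : 0 < ln (gamma A)^-1. Proof. by rewrite ln_gt0 // (igamma_gt1 hA). Qed.
Let rr : (0 : R) < (rexp A)%:R. Proof. by rewrite ltr0n (rexp_gt0 hA). Qed.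

Let q0 : 0 <= q.
Proof.
by apply: mulr_ge0; [rewrite invr_ge0 ler0n|apply: divr_ge0; [exact: ln_ge0|exact: ltW]].
Qed.

Lemma reset_boundE : (reset_bound P A)%:~R = N%:R :> R.
Proof.
have h : 0 <= reset_bound P A by rewrite ceil_ge0; apply: lt_le_trans q0; exact: ltrN10.
by rewrite /reset_num -[in LHS](gez0_abs h).
Qed.

Let lnRE : ln (Rcal P A) = q * ln g.
Proof.
rewrite /gamma1 -exprVn lnXn ?invr_gt0 ?(gamma_gt0 hA) // -[_ *+ rexp A]mulr_natr /q.
by field; rewrite !gt_eqF.
Qed.

Let lng : 0 < ln g. Proof. by rewrite ln_gt0. Qed.

Lemma Rcal_le : Rcal P A <= g ^+ N.
Proof.
rewrite -ler_ln ?posrE ?exprn_gt0 // lnXn // lnRE -[ln g *+ _]mulr_natl.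
by rewrite ler_pM2r // -reset_boundE; exact: ceil_ge.
Qed.

Lemma Rcal_gt N' : N = N'.+1 -> g ^+ N' < Rcal P A.
Proof.
move=> NE; rewrite -ltr_ln ?posrE ?exprn_gt0 // lnXn // lnRE -[ln g *+ _]mulr_natl.
rewrite ltr_pM2r //; have := ceilB1_lt q.
rewrite intrD mulrNz -/(reset_bound P A) reset_boundE NE -natr1 addrK //.
Qed.

Lemma L_bar_le : L_bar P A <= Lk A N.
Proof. by rewrite /L_bar /Lk mulrC ler_pM2l // Rcal_le. Qed.

Lemma pL_le_Lk : pL P <= Lk A N.
Proof. exact: le_trans pL_le_L_bar L_bar_le. Qed.

Lemma nuk_le_pmu : nuk P A N <= pmu P.
Proof.
rewrite /nuk; case: ifP => // _.
rewrite -[gamma1 A]invrK exprVn ler_pdivrMr ?exprn_gt0 // mulrC.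
by apply: le_trans mu_tilde_le _; rewrite ler_pM2r // Rcal_le.
Qed.

(** By minimality of the ceiling, [g ^ N] exceeds [Rcal] by at most one factor [g]; hence the factor
    [gamma ^ -r] that accompanies [L_bar]. *)
Lemma gN : g ^+ N <= Rcal P A * g.
Proof.
case E : N => [|N']; first by rewrite expr0 mulr_ege1 // ltW.
by rewrite exprSr ler_pM2r // ltW // Rcal_gt.
Qed.

Lemma Lk_mono i j : (i <= j)%N -> Lk A i <= Lk A j.
Proof. by move=> ij; rewrite ler_pM2l // ler_eXn2l. Qed.

Lemma Lk_le k : (k <= N)%N -> Lk A k <= L_bar P A / gamma A ^+ rexp A.
Proof.
move=> kN; apply: le_trans (Lk_mono kN) _.
by rewrite /Lk /L_bar [Rcal _ _ * _]mulrC -mulrA ler_pM2l // gN.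
Qed.

Lemma mu_bar_gt0 : 0 < mu_bar P A.
Proof. by rewrite lt_max (divr_gt0 mt0 Rp) orbT. Qed.

Lemma nuk_ge k : (k <= N)%N -> gamma A ^+ rexp A * mu_bar P A <= nuk P A k.
Proof.
move=> kN; rewrite -/(gamma1 A) /nuk /mu_bar /mu_low; case: ifP => hk.
  have mE : mu_tilde A = pmu P by case: hA => _ _ _ _ /(_ hk).
  rewrite mulrC -ler_pdivlMr // ge_max lexx /= mE.
  by rewrite ler_pM2l // lef_pV2 ?posrE //; apply: le_trans R1; apply: ltW; apply: (gamma1_lt1 hA).
rewrite mul0r; have -> : Num.max 0 (mu_tilde A / Rcal P A) = mu_tilde A / Rcal P A.
  by apply/max_idPr; rewrite divr_ge0 // ltW.
rewrite mulrCA ler_pM2l //.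
apply: (@le_trans _ _ (gamma1 A ^+ N)); last first.
  by rewrite ler_iXn2l //; exact: (gamma1_lt1 hA).
rewrite -[X in X / _]invrK -invfM -[gamma1 A in X in _ <= X]invrK exprVn.
by rewrite lef_pV2 ?posrE ?exprn_gt0 ?mulr_gt0 // mulrC gN.
Qed.

Lemma Delta_bar_ge0 : 0 <= Delta_bar P A.
Proof.
rewrite /Delta_bar; case: ifP => _; last exact: sqr_ge0.
by rewrite !divr_ge0 ?mulr_ge0 ?exprn_ge0 ?(ltW (gamma_gt0 hA)) // ltW // mu_bar_gt0.
Qed.

Lemma zeta_Delta_bar k : max_solver A -> (k <= N)%N -> 2 * zeta A / nuk P A k <= Delta_bar P A.
Proof.
move=> ms kN; rewrite /Delta_bar ms.
rewrite [X in _ <= X](_ : _ = 2 * zeta A / (gamma A ^+ rexp A * mu_bar P A)).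
  rewrite ler_pM2l ?mulr_gt0 //.
  have := nuk_ge kN; have := mu_bar_gt0; have := nuk_gt0 hA hSC k => n0 b0 h.
  by rewrite lef_pV2 ?posrE // mulr_gt0 // exprn_gt0 // (gamma_gt0 hA).
by rewrite invfM mulrA.
Qed.

Lemma min_bar_sqr_le (a b : R) : 0 <= a -> a <= b ->
  min_bar (a ^+ 2) (diam_bar P A ^+ 2)%E <= min_bar b (diam_bar P A) ^+ 2.
Proof.
move=> a0 ab; have b0 := le_trans a0 ab.
have E := diam_bar_sqr A hSC hD; rewrite expe2 in E; rewrite /min_bar ?expe2 E /diam_bar.
case: ifP => _; last first.
  rewrite (min_idPl _) ?leey // (min_idPl _) ?leey //=.
  by rewrite ler_sqr ?nnegrE.
have [-> _] := diam_fine hSC hD; rewrite -!EFin_min /=.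
have [bD|Db] := leP b D.
  by rewrite (le_trans _ (_ : a ^+ 2 <= _)) ?ge_min ?lexx // ler_sqr ?nnegrE.
by rewrite ge_min lexx orbT.
Qed.

Lemma start_bounds k j a : accepted P A N k j a -> sflag a ->
  [/\ sDelta a <= Delta_bar P A, sLambda a <= Lambda_bar P A & sR a = 0].
Proof.
move=> ac fa; have I := acc_inv ac; have kN := inv_k I.
have n0 := nuk_gt0 hA hSC k; have M0 : 0 < Lk A k by rewrite Lk_lj; exact: (lj_gt0 hA).
have ML := Lk_le kN; have nG := nuk_ge kN; have b0 := mu_bar_gt0.
have gr0 : 0 < gamma A ^+ rexp A by rewrite exprn_gt0 // (gamma_gt0 hA).
have [/inv_wf wa Dy Dx] : [/\ inv P A N k j a, dom (ph P) (sy a) & dom (pg P) (sx a)].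
  by split => //; case: I.
have Dy' : dom (ph P) (y_next P A a) := dom_y_next A (wa hA hSC) hSC.
have rD : enorm (sy a - y_next P A a) <= D by exact: (diam_le hSC hD).
have := acc_start ac fa; have := acc_bounds ac; rewrite /start_ok /bounds fa /Lambda_bar.
case: ifP => ms <- /=; rewrite (inv_L I) (inv_mu I).
  move=> _; split => //; first exact: zeta_Delta_bar.
  rewrite lerD2l.
  set G := gamma A ^+ rexp A in gr0 nG ML *; set b := mu_bar P A in b0 nG *.
  rewrite mulnC exprM -/G.
  have sb0 : 0 < Num.sqrt b by rewrite sqrtr_gt0.
  set v := Num.sqrt (2 * zeta A / (G * b)).
  (* Of the exponent [3 r] under the root, [2 r] bounds [L_t] by [L_bar] and [r] bounds [mu_t] by
     [mu_bar]. *)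
  have -> : Num.sqrt (2 * zeta A / G ^+ 3) = v * (Num.sqrt b * G^-1).
    have -> : 2 * zeta A / G ^+ 3 = 2 * zeta A / (G * b) * (b * G^-1 ^+ 2).
      by field; rewrite !gt_eqF.
    rewrite sqrtrM ?divr_ge0 ?mulr_ge0 ?(ltW ze0) ?(ltW gr0) ?(ltW b0) //.
    by rewrite (sqrtrM _ (ltW b0)) sqrtr_sqr ger0_norm ?invr_ge0 ?(ltW gr0).
  have -> : L_bar P A / Num.sqrt b * D * (v * (Num.sqrt b * G^-1)) = v * (L_bar P A / G) * D.
    by field; rewrite !gt_eqF.
  have v0 : 0 <= v := sqrtr_ge0 _.
  apply: ler_pM rD; rewrite ?enorm_ge0 //; first by rewrite mulr_ge0 ?sqrtr_ge0 // ltW.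
  apply: ler_pM ML; rewrite ?sqrtr_ge0 ?(ltW M0) //.
  rewrite ler_wsqrtr // ler_pM2l ?mulr_gt0 // lef_pV2 ?posrE ?mulr_gt0 //.
move=> [y0 [Dy0 _ dE]].
have dD : sd a <= D by rewrite dE; exact: (diam_le hSC hD).
have d0 : 0 <= sd a by rewrite dE enorm_ge0.
have c0 : 0 <= 2 * Lk A k / nuk P A k.
  by apply: divr_ge0 (ltW n0); apply: mulr_ge0 (ltW M0).
split => //.
  rewrite /Delta_bar ms -exprMn; apply: min_bar_sqr_le.
    by apply: mulr_ge0 => //; exact: addr_ge0.
  apply: ler_pM dD => //; first exact: addr_ge0.
  rewrite lerD2l mulnC exprM -mulrA.
  set G := gamma A ^+ rexp A in gr0 nG ML *; set b := mu_bar P A in b0 nG *.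
  have -> : 2 / G ^+ 2 * (L_bar P A / b) = 2 * (L_bar P A / G * (G * b)^-1).
    by field; rewrite !gt_eqF.
  rewrite ler_pM2l //; apply: ler_pM ML _; rewrite ?invr_ge0 ?(ltW M0) ?(ltW n0) //.
  by rewrite lef_pV2 ?posrE ?mulr_gt0.
have -> : 2 / gamma A ^+ rexp A * L_bar P A * D ^+ 2
    = 2 * D * (L_bar P A / gamma A ^+ rexp A) * D by ring.
apply: ler_pM rD; rewrite ?enorm_ge0 //; first by apply: mulr_ge0 (ltW M0); exact: mulr_ge0.
by apply: ler_pM ML; [exact: mulr_ge0|exact: ltW|rewrite ler_pM2l].
Qed.

End Constants.

(** * Potential before the last reset *)

Lemma PotEarly_aux (R : realFieldType) (q x l u dist_grad_y s r LR nu Del f f' b H c : R) :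
  q - (2 + x) * l * u + l * dist_grad_y + s * l / 2 * r
    <= LR + 4 * (3 * l - 2 * nu) * Del + (f - f') ->
  (24 * l - 16 * nu + H * (1 - s / 2)) * Del <= c * Del ->
  q - l * (4 + x + b) * u + l * dist_grad_y + s * l / 2 * r
   + (f' + (H * ((1 - s / 2) * Del) + l * b * u) + 2 * l * u + (12 * l - 8 * nu) * Del)
   <= f + LR + c * Del.
Proof. lra. Qed.

Lemma PotEarly_aux2 (R : realFieldType) (S f H M D Dp l nu u2 nr Q Pt : R) :
  S + Pt <= f + (6 * l * (D + 2 * Dp) - 8 * nu * Dp + (2 * l * u2 - nr)) + (Q - 38 * M) * D ->
  0 <= nr -> 6 * l * D <= 6 * M * D -> H = Q - 32 * M ->
  S + Pt <= f + H * D + 2 * l * u2 + (12 * l - 8 * nu) * Dp.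
Proof. move=> h1 h2 h3 ->; lra. Qed.

Section Potential.
Context (R : realType) (n m : nat) (P : problem R n m) (A : input R n m).
Hypotheses (hA : valid_input P A) (hSC : SC P) (hD : (diam P < +oo)%E).
Implicit Types s a p : state R n m.

Local Notation N := (reset_num P A).
Local Notation accepted := (accepted P A N).
Local Notation D := (fine (diam P)).
Local Notation Lk := (Lk A).
Local Notation nuk := (nuk P A).

Definition weightEarly k : R := 60 * Lk k ^+ 2 / nuk k - 32 * Lk k.
Definition jump_cost : R := (L_bar P A / gamma A ^+ rexp A + pL P) * D ^+ 2.
Definition epoch_cost k : R := 60 * Lk k ^+ 2 / nuk k - 38 * Lk k.
(** The last two terms reserve the part of [Lambda_(t+1) + R_(t+1)] that is fixed by iteration [t].
    The remaining [6 l Delta_(t+1)] is covered by [weightEarly k - epoch_cost k = 6 Lk k]. *)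
Definition PotEarly k a : R := phi P (x_next P A a) (y_next P A a)
  + weightEarly k * Delta_next P A a
  + 2 * sl a * dist_x P A a ^+ 2 + (12 * sl a - 8 * smu a) * sDelta a.

Lemma acc_lt k j a : accepted k j a -> [/\ 0 < nuk k, nuk k < sl a & sl a <= Lk k].
Proof.
move=> ac; have I := acc_inv ac; have [m0 ml _] := inv_wf hA hSC I.
rewrite -(inv_mu I) -(inv_L I); split => //.
by rewrite (inv_sl_le hA I) (acc_j ac).
Qed.

Lemma epoch_cost_ge0 k : nuk k <= Lk k -> 0 <= epoch_cost k.
Proof.
have n0 := nuk_gt0 hA hSC k => h; rewrite /epoch_cost.
have -> : 60 * Lk k ^+ 2 / nuk k = 60 * (Lk k * (Lk k / nuk k)) by ring.
have : Lk k * 1 <= Lk k * (Lk k / nuk k).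
  by rewrite ler_pM2l ?ler_pdivlMr ?mul1r // (lt_le_trans n0).
have := lt_le_trans n0 h; lra.
Qed.

Lemma PotEarly_step k j a : accepted k j a -> summand P A a + PotEarly k a <=
  phi P (sx a) (sy a) + (sLambda a + sR a) + epoch_cost k * sDelta a.
Proof.
move=> ac; have I := acc_inv ac; have wa := inv_wf hA hSC I.
have [n0 nl lM] := acc_lt ac; have l0 : 0 < sl a := lt_trans n0 nl.
have := acc_i hA hSC ac.
rewrite (SE hA wa) /PotEarly (Delta_nextE hA wa) /Bt /BB /DLag.
have sE : rat a = nuk k / sl a by rewrite /rat (inv_mu I).
have mE : cond a = Lk k / nuk k by rewrite /cond (inv_mu I) (inv_L I).
have Dl := acc_Delta_ge0 ac.
set c := cc (rat a); rewrite (inv_mu I) => hi.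
have bE : weightEarly k * (c / rat a * cond a ^+ 2 * dist_x P A a ^+ 2) =
   sl a * (4 * c * (15 * cond a - 8) * cond a ^+ 3) * dist_x P A a ^+ 2.
  by rewrite /weightEarly sE mE; field; rewrite !gt_eqF.
have hD' : (24 * sl a - 16 * nuk k + weightEarly k * (1 - rat a / 2)) * sDelta a
    <= epoch_cost k * sDelta a.
  apply: ler_wpM2r => //.
  (* The two multipliers agree at [sl a = Lk k], so [epoch_cost] is the exact worst case; the
     difference factors through [Lk k - sl a]. *)
  rewrite -subr_ge0 /weightEarly /epoch_cost sE.
  have -> : 60 * Lk k ^+ 2 / nuk k - 38 * Lk k - (24 * sl a - 16 * nuk k +
    (60 * Lk k ^+ 2 / nuk k - 32 * Lk k) * (1 - nuk k / sl a / 2)) =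
     ((Lk k - sl a) * (30 * Lk k + 24 * sl a - 16 * nuk k)) / sl a.
    by field; rewrite !gt_eqF.
  apply: divr_ge0 (ltW l0); apply: mulr_ge0; lra.
by rewrite [weightEarly k * _]mulrDr bE; exact: PotEarly_aux hi hD'.
Qed.

Lemma PotEarly_start k j a : accepted k j a -> sflag a -> summand P A a + PotEarly k a <=
  phi P (sx a) (sy a) + (Lambda_bar P A + epoch_cost k * Delta_bar P A).
Proof.
move=> ac fa; have h := PotEarly_step ac; have [hDl hL hR] := start_bounds hA hSC hD ac fa.
have [n0 nl lM] := acc_lt ac.
have := ler_wpM2l (epoch_cost_ge0 (ltW (lt_le_trans nl lM))) hDl.
rewrite hR in h; lra.
Qed.

Lemma PotEarly_continue k j j' p a : accepted k j p -> accepted k j' a ->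
  continues P A p a -> summand P A a + PotEarly k a <= PotEarly k p.
Proof.
move=> ap ac [_ xE yE DE LE RE _ _ _]; have h := PotEarly_step ac.
rewrite xE yE DE LE RE in h; have [n0 nl lM] := acc_lt ap.
have D0 := Delta_next_ge0 hA (acc_wf hA hSC ap) (acc_Delta_ge0 ap).
have r0 : 0 <= smu p * dist_y P A p ^+ 2.
  by rewrite mulr_ge0 ?sqr_ge0 // (inv_mu (acc_inv ap)) ltW.
apply: (PotEarly_aux2 h r0) => //.
by apply: ler_wpM2r => //; lra.
Qed.

Lemma phi_le_PotEarly k j p : accepted k j p ->
  phi P (x_next P A p) (y_next P A p) <= PotEarly k p.
Proof.
move=> ap; have [n0 nl lM] := acc_lt ap.
have D0 := Delta_next_ge0 hA (acc_wf hA hSC ap) (acc_Delta_ge0 ap).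
have h1 : 0 <= weightEarly k * Delta_next P A p.
  apply: mulr_ge0 => //; have := epoch_cost_ge0 (ltW (lt_le_trans nl lM)).
  rewrite /weightEarly /epoch_cost; lra.
have h2 : 0 <= 2 * sl p * dist_x P A p ^+ 2 by rewrite mulr_ge0 ?sqr_ge0 // mulr_ge0 //; lra.
have h3 : 0 <= (12 * sl p - 8 * smu p) * sDelta p.
  by rewrite mulr_ge0 ?(acc_Delta_ge0 ap) // (inv_mu (acc_inv ap)); lra.
rewrite /PotEarly; lra.
Qed.

Let pL0 : 0 <= pL P. Proof. by case: hSC => _ _ _ []. Qed.

Lemma jump_cost_ge0 : 0 <= jump_cost.
Proof.
apply: mulr_ge0 (sqr_ge0 _); apply: addr_ge0 pL0.
apply: divr_ge0; last by rewrite exprn_ge0 // (ltW (gamma_gt0 hA)).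
by apply: mulr_ge0 (ltW (l_tilde_gt0 hA)); apply: le_trans ler01 (Rcal_ge1 P A).
Qed.

(** A refresh may move [y] anywhere in the domain, and [y_next] was itself a proximal ascent step at
    [x_next]: [ystep_lin] applies with both lengths at most the diameter. *)
Lemma jump k j p y : accepted k j p -> dom (ph P) y ->
  phi P (x_next P A p) y <= phi P (x_next P A p) (y_next P A p) + jump_cost.
Proof.
move=> ap Dyy; have I := acc_inv ap; have [n0 nl lM] := acc_lt ap; have Dy := inv_y I.
have l0 : 0 < sl p := lt_trans n0 nl.
have Dx' := acc_domx hA hSC ap; have Dy' := acc_domy hA hSC ap.
have h := ystep_lin hSC (lexx _) Dx' Dy l0 Dyy.
rewrite -/(y_next P A p) in h.
rewrite -lerBlDl; apply: le_trans h _.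
rewrite /jump_cost expr2 mulrA; apply: ler_pM; rewrite ?enorm_ge0 //.
- by rewrite mulr_ge0 ?enorm_ge0 // addr_ge0 ?pL0 // ltW.
- apply: ler_pM; rewrite ?enorm_ge0 //; first by rewrite addr_ge0 ?pL0 // ltW.
    have := Lk_le hA (inv_k I); lra.
  exact: (diam_le hSC hD).
- exact: (diam_le hSC hD).
Qed.
End Potential.

(** * Potential after the last reset *)

Section Hybrid.
Context (R : realType) (n m : nat) (P : problem R n m) (A : input R n m).
Hypotheses (hA : valid_input P A) (hSC : SC P) (hD : (diam P < +oo)%E).
Implicit Types s a p : state R n m.

Local Notation N := (reset_num P A).
Local Notation accepted := (accepted P A N).
Local Notation D := (fine (diam P)).
Local Notation nu := (nuk P A N).
Local Notation x := (gamma A)^-1.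

(** The ratio [w] of the scalar inequalities. It uses [L_bar], already a valid Lipschitz constant,
    while [cond] uses the possibly larger [L_t]. *)
Definition kappa_bar : R := L_bar P A / nu.

Definition PotLast h rt a : R := phi P (x_next P A a) (y_next P A a)
  + 6 * (Fr P (x_next P A a) - phi P (x_next P A a) (y_next P A a))
  + h * nu * Delta_next P A a + rt * sl a * dist_x P A a ^+ 2.

Lemma PotLast_aux (S q f f' e6 hdl r B D' F : R) : S = q -> B - D' = f' - f ->
  q + (B - D') + e6 + hdl + r <= F -> S + (f' + e6 + hdl + r) <= f + F.
Proof. by move=> -> ->; lra. Qed.

Variables (j : nat) (a : state R n m) (h : R).
Hypotheses (ac : accepted N j a) (h0 : 0 <= h).

Let I := acc_inv ac.
Let wa : wf a. Proof. exact: acc_wf ac. Qed.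
Let l0 : 0 < sl a. Proof. by have [n0 nl _] := acc_lt hA hSC ac; exact: lt_trans nl. Qed.
Let nu0 : 0 < nu. Proof. exact: nuk_gt0. Qed.
Let LE : kappa_bar * rat a * sl a = L_bar P A.
Proof. by rewrite /kappa_bar /rat (inv_mu I); field; rewrite !gt_eqF. Qed.
Let LlE : L_bar P A / sl a = kappa_bar * rat a.
Proof. by rewrite -LE mulfK // gt_eqF. Qed.
Let LnE : L_bar P A / smu a = kappa_bar. Proof. by rewrite (inv_mu I). Qed.
Let nE : nu = rat a * sl a. Proof. by rewrite rat_slE // (inv_mu I). Qed.
Let Dx := inv_x I.
Let Dy := inv_y I.
Let hL := pL_le_L_bar hA.
Let mm : smu a <= pmu P. Proof. by rewrite (inv_mu I); exact: nuk_le_pmu. Qed.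
Let desc := acc_desc ac.
Let Dl : 0 <= sDelta a. Proof. exact: acc_Delta_ge0 ac. Qed.
Let hdel : enorm (sy a - ystar P (sx a)) ^+ 2 <= sDelta a := acc_delta ac (erefl N).
Let Lb0 : 0 <= L_bar P A. Proof. by apply: le_trans hL; case: hSC => _ _ _ []. Qed.
Let w0 : 0 <= kappa_bar. Proof. exact: divr_ge0 Lb0 (ltW nu0). Qed.

Let hD0 := descent_x hA hSC wa Dx Dy hL.
Let hA0 := gain_ge hA hSC wa Dx Dy desc.
Let hdb := grad_step_le hA hSC wa Dx Dy hL.

Let d2 : enorm (sy a - ystar P (x_next P A a)) ^+ 2
  <= 2 * (sDelta a + kappa_bar ^+ 2 * dist_x P A a ^+ 2).
Proof.
have := dist_ystar_next_le hA hSC wa Dx Dy mm hL; rewrite LnE => hh; apply: le_trans hh _.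
by rewrite ler_pM2l // lerD2r.
Qed.

Lemma PotLast_good rt : condG (rat a) (cond a) kappa_bar x h rt ->
  summand P A a + PotLast h rt a <=
  phi P (sx a) (sy a) + (6 * (Fr P (sx a) - phi P (sx a) (sy a)) + h * nu * sDelta a).
Proof.
move=> hG.
have he := gap_next_le hA hSC wa Dx Dy hL.
have hd := dist_ystar_le_gain hA hSC wa Dx Dy mm desc.
apply: (PotLast_aux (SE hA wa) _ _); last first.
  rewrite nE.
  apply: (step_good (rat_bounds wa) l0 h0 Dl (enorm_ge0 _) (enorm_ge0 _) (enorm_ge0 _) w0
    _ _ hA0 hd _ (Delta_nextE hA wa) hG).
  - by rewrite LE; exact: hD0.
  - by rewrite LE; exact: he.
  - by rewrite -LlE; exact: hdb.
by ring.
Qed.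

Let e0 : 0 <= Fr P (sx a) - phi P (sx a) (sy a).
Proof. by rewrite subr_ge0 phi_le_Fr. Qed.

Lemma PotLast_mid : 1 / 2 <= rat a -> condI (rat a) (cond a) kappa_bar x h ->
  summand P A a + PotLast h 0 a <=
  phi P (sx a) (sy a) + (6 * (Fr P (sx a) - phi P (sx a) (sy a)) + h * nu * sDelta a).
Proof.
move=> s2 [hI1 hI2].
have he2 := gap_next_le_dist hA hSC wa Dx Dy mm desc.
have hA2 := mixed_gain_le hA hSC wa Dx Dy hL.
have hle := gain_le_gap A hSC wa Dx.
have hl : sl a <= 2 * smu a.
  by move: s2; rewrite /rat ler_pdivlMr // => ?; lra.
have hb2 := grad_step_sqr_le hSC wa Dx Dy mm hL Lb0 hl.
apply: (PotLast_aux (SE hA wa) _ _); last first.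
  rewrite nE mul0r mul0r addr0.
  apply: (step_mid (rat_bounds wa) l0 h0 e0 w0 _ _ he2 d2 _ (acc_iv hA hSC ac) Dl
    (Delta_nextE hA wa) hI1 hI2).
  - by rewrite LE; exact: hD0.
  - by rewrite LE; apply: le_trans hA2 _; rewrite lerD2r.
  - rewrite -LlE; apply: le_trans hb2 _; apply: ler_wpM2l => //; exact: sqr_ge0.
by ring.
Qed.

Lemma PotLast_bad Z : kappa_bar <= cond a -> condD (rat a) (cond a) x h ->
  sLambda a + sR a <= Z + (18 * x - 2 * rat a) * sl a * sDelta a ->
  summand P A a + PotLast h 2 a <= phi P (sx a) (sy a) + (Z + h * nu * sDelta a).
Proof.
move=> wm [hD1 hD2] hZ.
have he2 := gap_next_le_dist hA hSC wa Dx Dy mm desc.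
apply: (PotLast_aux (SE hA wa) _ _); last first.
  rewrite nE.
  apply: (step_bad (rat_bounds wa) l0 Dl (le_trans w0 wm) _ _ hZ he2 d2
    (Delta_nextE hA wa) hD1 hD2); first by rewrite w0.
  have := acc_i hA hSC ac; rewrite -(rat_slE wa) => hi; apply: le_trans hi _; exact: lexx.
by rewrite opprB /DLag; ring.
Qed.
End Hybrid.

(** Origin of [18 x - 2 s]: the recursion for [Delta] gives
    [(12 lp - 8 nu) Dp <= (12 lp - 2 nu) Da], to which [6 lp Da] is added, and [lp <= x l]. *)
Lemma continue_aux (R : realFieldType) (x s l lp nu Dp Da u2 r2 : R) :
  0 < lp -> 0 < nu -> nu < lp -> lp <= x * l -> 0 <= Da -> 0 <= Dp -> 0 <= r2 -> s * l = nu ->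
  (1 - nu / lp / 2) * Dp <= Da ->
  6 * lp * (Da + 2 * Dp) - 8 * nu * Dp + (2 * lp * u2 - nu * r2)
    <= 2 * lp * u2 + (18 * x - 2 * s) * l * Da.
Proof.
move=> l0 nu0 nul lx Da0 Dp0 r0 sE h.
have h1 : (lp - nu / 2) * Dp <= lp * Da.
  have -> : lp - nu / 2 = lp * (1 - nu / lp / 2) by field; rewrite gt_eqF.
  by rewrite -mulrA ler_pM2l.
have h2 : lp * Da <= x * l * Da by rewrite ler_wpM2r.
have h3 : 0 <= nu * r2 by rewrite mulr_ge0 // ltW.
have h4 : (12 * lp - 8 * nu) * Dp <= (12 * lp - 2 * nu) * Da.
  have p : 0 < lp - nu / 2 by lra.
  rewrite -(ler_pM2l p).
  have k1 : (12 * lp - 8 * nu) * ((lp - nu / 2) * Dp) <= (12 * lp - 8 * nu) * (lp * Da).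
    by rewrite ler_wpM2l //; lra.
  have k2 : 0 <= nu ^+ 2 * Da by rewrite mulr_ge0 ?sqr_ge0.
  lra.
rewrite (_ : (18 * x - 2 * s) * l * Da = 18 * (x * l * Da) - 2 * ((s * l) * Da)); last by ring.
rewrite sE; lra.
Qed.

Lemma start_gap_aux (R : realFieldType) (M mu F f d D2 b LD pD nD : R) :
  F <= f + (M - mu) / 2 * d - M / 2 * b -> 0 <= M / 2 * b -> 0 <= mu / 2 * d ->
  M / 2 * d <= M / 2 * D2 -> M * D2 <= LD * D2 -> 0 <= pD * D2 -> 0 <= nD ->
  6 * (F - f) <= 2 * (LD * D2) + (LD + pD) * D2 + 5 / 2 * nD.
Proof. lra. Qed.

Section HybridPotential.
Context (R : realType) (n m : nat) (P : problem R n m) (A : input R n m).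
Hypotheses (hA : valid_input P A) (hSC : SC P) (hD : (diam P < +oo)%E).
Implicit Types s a p : state R n m.

Local Notation N := (reset_num P A).
Local Notation accepted := (accepted P A N).
Local Notation D := (fine (diam P)).
Local Notation nu := (nuk P A N).
Local Notation x := (gamma A)^-1.
Local Notation kappa_bar := (kappa_bar P A).

Lemma kappa_bar_le j a : accepted N j a -> kappa_bar <= cond a.
Proof.
move=> ac; rewrite /cond (inv_L (acc_inv ac)) (inv_mu (acc_inv ac)).
by rewrite ler_pM2r ?invr_gt0 ?(nuk_gt0 hA hSC) // L_bar_le.
Qed.

(** With the oracle, [6 zeta] splits into [zeta], at most [Lambda_bar], and [5 zeta], at most
    [5 / 2] times [nu Delta_bar]. With a proximal start, six gaps cost [3 L_N D ^ 2]: two thirds fit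
    into [Lambda_bar], one third into the jump cost. *)
Lemma start_gap j a : accepted N j a -> sflag a ->
  6 * (Fr P (sx a) - phi P (sx a) (sy a)) <=
  Lambda_bar P A + jump_cost P A + 5 / 2 * (nu * Delta_bar P A).
Proof.
move=> ac fa; have I := acc_inv ac; have kN := inv_k I.
have Dx := inv_x I; have Dy := inv_y I.
have n0 := nuk_gt0 hA hSC N; have M0 : 0 < Lk A N by rewrite Lk_lj; exact: (lj_gt0 hA).
have J0 := jump_cost_ge0 hA hSC; have Db := Delta_bar_ge0 hA.
have ML := Lk_le hA kN.
have nD : 0 <= nu * Delta_bar P A by rewrite mulr_ge0 // ltW.
have := acc_start ac fa; rewrite /start_ok; case: ifP => ms.
  move=> hz; have := zeta_Delta_bar hA hSC ms kN; rewrite ler_pdivrMr // => hz2.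
  have : zeta A <= Lambda_bar P A.
    rewrite /Lambda_bar ms lerDl; apply: mulr_ge0 (sqrtr_ge0 _).
    apply: mulr_ge0; last by have [] := diam_fine hSC hD.
    apply: divr_ge0 (sqrtr_ge0 _); apply: mulr_ge0 (ltW (l_tilde_gt0 hA)).
    by apply: le_trans ler01 (Rcal_ge1 P A).
  lra.
move=> [y0 [Dy0 yE dE]].
rewrite (inv_L I) in yE.
have desc : pf P (sx a) y0 + dotp (grad_y P (sx a) y0) (sy a - y0)
        <= pf P (sx a) (sy a) + Lk A N / 2 * enorm (sy a - y0) ^+ 2.
  have := pf_lower_y hSC (lexx _) Dx Dy0 Dy.
  have : 0 <= (Lk A N - pL P) * enorm (sy a - y0) ^+ 2.
    by rewrite mulr_ge0 ?sqr_ge0 // subr_ge0 pL_le_Lk.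
  lra.
have := three_point hSC Dx Dy0 M0; rewrite -yE => /(_ desc _ (dom_ystar hSC Dx)) h.
have d2 : enorm (ystar P (sx a) - y0) ^+ 2 <= D ^+ 2.
  rewrite ler_sqr ?nnegrE ?enorm_ge0 //; first exact: (diam_le hSC hD (dom_ystar hSC Dx) Dy0).
  by have [] := diam_fine hSC hD.
have h2 : 0 <= Lk A N / 2 * enorm (ystar P (sx a) - sy a) ^+ 2.
  by apply: mulr_ge0 (sqr_ge0 _); exact: divr_ge0 (ltW M0) _.
have h3 : 0 <= pmu P / 2 * enorm (ystar P (sx a) - y0) ^+ 2 := half_mu_ge0 hSC _.
have h4 : Lk A N / 2 * enorm (ystar P (sx a) - y0) ^+ 2 <= Lk A N / 2 * D ^+ 2.
  by rewrite ler_pM2l // divr_gt0.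
have h5 : Lk A N * D ^+ 2 <= L_bar P A / gamma A ^+ rexp A * D ^+ 2.
  by rewrite ler_wpM2r ?sqr_ge0.
have h6 : 0 <= pL P * D ^+ 2 by rewrite mulr_ge0 ?sqr_ge0 //; case: hSC => _ _ _ [].
have -> : Lambda_bar P A = 2 * (L_bar P A / gamma A ^+ rexp A * D ^+ 2).
  by rewrite /Lambda_bar ms; ring.
exact: (start_gap_aux h h2 h3 h4 h5 h6 nD).
Qed.

Definition okstep h rt a := condG (rat a) (cond a) kappa_bar x h rt \/
  [/\ rt = 0, 1 / 2 <= rat a & condI (rat a) (cond a) kappa_bar x h] \/
  (rt = 2 /\ condD (rat a) (cond a) x h).

Lemma PotLast_step j a (h rt Z : R) : accepted N j a -> 0 <= h -> okstep h rt a ->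
  (rt = 2 -> sLambda a + sR a <= Z + (18 * x - 2 * rat a) * sl a * sDelta a) ->
  summand P A a + PotLast P A h rt a <= phi P (sx a) (sy a) +
    (6 * (Fr P (sx a) - phi P (sx a) (sy a)) + h * nu * sDelta a) \/
  rt = 2 /\ summand P A a + PotLast P A h rt a <= phi P (sx a) (sy a) + (Z + h * nu * sDelta a).
Proof.
move=> ac h0 [hG|[[-> s2 hI]|[rt2 hDD]]] hZ.
- by left; exact: (PotLast_good hA hSC ac h0 hG).
- by left; exact: (PotLast_mid hA hSC ac h0 s2 hI).
- by right; split; rewrite // rt2; exact: (PotLast_bad hA hSC ac (kappa_bar_le ac) hDD (hZ rt2)).
Qed.

Lemma PotLast_start j a (h rt : R) : accepted N j a -> sflag a -> 0 <= h -> okstep h rt a ->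
  summand P A a + PotLast P A h rt a <= phi P (sx a) (sy a) +
    (Lambda_bar P A + jump_cost P A + (h + 5 / 2) * nu * Delta_bar P A).
Proof.
move=> ac fa h0 ok; have [hDl hL hR] := start_bounds hA hSC hD ac fa.
have [n0 nl lM] := acc_lt hA hSC ac; have Db := Delta_bar_ge0 hA (P := P).
have J0 := jump_cost_ge0 hA hSC.
have hg := start_gap ac fa.
have h1 : h * nu * sDelta a <= h * nu * Delta_bar P A.
  by rewrite ler_wpM2l // mulr_ge0 // ltW.
have h2 : 0 <= nu * Delta_bar P A by rewrite mulr_ge0 // ltW.
have hZ : rt = 2 -> sLambda a + sR a <= Lambda_bar P A + (18 * x - 2 * rat a) * sl a * sDelta a.
  move=> _; rewrite hR addr0; apply: le_trans hL _; rewrite lerDl.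
  apply: mulr_ge0 (acc_Delta_ge0 ac); apply: mulr_ge0; last by apply: ltW; exact: lt_trans nl.
  have /andP[_ s1] := rat_bounds (acc_wf hA hSC ac); have := igamma_gt1 hA; lra.
case: (PotLast_step ac h0 ok hZ) => [h3|[_ h3]]; apply: (le_trans h3); rewrite lerD2l; lra.
Qed.

Lemma PotLast_continue j j' p a (h rt : R) : accepted N j p -> accepted N j' a ->
  continues P A p a -> 0 <= h -> 0 <= rt -> okstep h rt a ->
  summand P A a + PotLast P A h rt a <= PotLast P A h rt p.
Proof.
move=> ap ac [_ xE yE DE LE RE mE _ lE] h0 rt0 ok.
have [n0 nlp lMp] := acc_lt hA hSC ap; have [_ nl lM] := acc_lt hA hSC ac.
have wp := acc_wf hA hSC ap; have wa := acc_wf hA hSC ac.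
have lp0 : 0 < sl p := lt_trans n0 nlp.
have mpE : smu p = nu := inv_mu (acc_inv ap).
have D0 := acc_Delta_ge0 ap; have Dn := Delta_next_ge0 hA wp D0.
have e0 : 0 <= Fr P (x_next P A p) - phi P (x_next P A p) (y_next P A p).
  by rewrite subr_ge0; exact: (phi_le_Fr hSC (acc_domx hA hSC ap) (acc_domy hA hSC ap)).
have ru : 0 <= rt * sl p * dist_x P A p ^+ 2.
  by apply: mulr_ge0 (sqr_ge0 _); apply: mulr_ge0 (ltW lp0).
have hZ : rt = 2 -> sLambda a + sR a <=
    2 * sl p * dist_x P A p ^+ 2 + (18 * x - 2 * rat a) * sl a * sDelta a.
  move=> _; rewrite LE RE DE mpE; apply: continue_aux => //; rewrite ?sqr_ge0 //.
  - by rewrite mulrC ler_pdivlMr ?(gamma_gt0 hA) // mulrC.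
  - by rewrite rat_slE // (inv_mu (acc_inv ac)).
  - rewrite (Delta_nextE hA wp) {1}/rat mpE lerDl.
    apply: mulr_ge0 (sqr_ge0 _); apply: mulr_ge0 (sqr_ge0 _).
    by apply: divr_ge0 (cc_rat_ge0 wp) _; have /andP[/ltW] := rat_bounds wp.
case: (PotLast_step ac h0 ok hZ) => [h3|[rt2 h3]]; apply: (le_trans h3); rewrite /PotLast xE yE DE.
  by rewrite addrA lerDl.
have aux (f e b c : R) : 0 <= e -> f + (c + b) <= f + 6 * e + b + c by lra.
by rewrite rt2; exact: aux.
Qed.

Lemma Fr_le_PotLast j p (h rt : R) : accepted N j p -> 0 <= h -> 0 <= rt ->
  Fr P (x_next P A p) <= PotLast P A h rt p.
Proof.
move=> ap h0 rt0; have [n0 nl lM] := acc_lt hA hSC ap.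
have wp := acc_wf hA hSC ap.
have Dn := Delta_next_ge0 hA wp (acc_Delta_ge0 ap).
have e0 : 0 <= Fr P (x_next P A p) - phi P (x_next P A p) (y_next P A p).
  by rewrite subr_ge0; exact: (phi_le_Fr hSC (acc_domx hA hSC ap) (acc_domy hA hSC ap)).
have ru : 0 <= rt * sl p * dist_x P A p ^+ 2.
  by apply: mulr_ge0 (sqr_ge0 _); apply: mulr_ge0 => //; apply: ltW; exact: lt_trans nl.
have hn : 0 <= h * nu * Delta_next P A p.
  by apply: mulr_ge0 => //; apply: mulr_ge0 => //; exact: ltW.
rewrite /PotLast; lra.
Qed.
End HybridPotential.

(** * Budget for the last epoch *)

Section BudgetReals.
Context (R : realFieldType).
Implicit Types r l X nu Q : R.

Lemma budget_unknown_aux r l : 1 <= r -> r <= l -> 1 <= l -> l < 10 / 7 ->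
  hI (r * l) + 5 / 2 <= 38 * l.
Proof.
move=> r1 rl l1 l2.
have h : r * l <= l * l by rewrite ler_wpM2r //; lra.
have h0 : 0 <= r * l by rewrite mulr_ge0; lra.
have h2 : (r * l) ^+ 2 <= (l * l) ^+ 2 by rewrite ler_sqr ?nnegrE // (le_trans h0 h).
have k1 : 0 <= (l - 1) * (10 / 7 - l) by rewrite mulr_ge0 //; lra.
have k2 : l * l <= 10 / 7 * (10 / 7) by rewrite ler_pM //; lra.
have k3 : 1 * 1 <= l * l by rewrite ler_pM.
have k4 : 0 <= (l * l - 1) * (100 / 49 - l * l) by rewrite mulr_ge0 //; lra.
rewrite /hI; lra.
Qed.

Lemma budget_one_aux r l : 1 <= r -> 1 <= l -> l < 10 / 7 ->
  hI (r * l) + 5 / 2 <= 38 * l + 60 * l ^+ 2 * (r ^+ 2 - 1).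
Proof.
move=> r1 l1 l2.
have w1 : l <= r * l by rewrite ler_peMl //; lra.
have h : 0 <= (r * l - l) * (58 * (r * l + l) - 103 / 10) by rewrite mulr_ge0 //; lra.
have h2 : 0 <= (l - 1) * (10 / 7 - l) by rewrite mulr_ge0 //; lra.
rewrite /hI; lra.
Qed.

Lemma budget_one_aux2 r l : 2 <= r -> 1 <= l ->
  72 * r - 60 + 5 / 2 <= 38 * l + 60 * l ^+ 2 * (r ^+ 2 - 1).
Proof.
move=> r2 l1.
have rr : 0 <= r ^+ 2 - 1 by nra.
have : 1 * (r ^+ 2 - 1) <= l ^+ 2 * (r ^+ 2 - 1) by rewrite ler_wpM2r // exprn_ege1.
have : 0 <= (r - 2) * r by rewrite mulr_ge0; lra.
lra.
Qed.

(** The saved terms reach [38 l (1 + X) nu] with [X = g ^ (N - 1)] just below [Rcal]; the remainder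
    of the geometric series raises [X] to [r]. *)
Lemma budget_many_aux r l nu X Q : l * nu * (1 + X) <= Q -> X < r -> 1 <= X -> 1 <= l -> 0 < nu ->
  38 * l * (1 + r) * nu <= 38 * Q + 60 * l ^+ 2 * nu * (r ^+ 2 - X ^+ 2).
Proof.
move=> h Xr X1 l1 n0.
have h1 : 0 <= l * nu * (r - X) * (60 * l * (r + X) - 38).
  apply: mulr_ge0; first by rewrite !mulr_ge0 // ?ltW // ?subr_ge0; lra.
  have : 1 * 1 <= l * (r + X) by rewrite ler_pM //; lra.
  lra.
lra.
Qed.

Lemma budget_many_aux1 r l : 1 <= r -> r <= 3 -> 1 <= l -> l < 10 / 7 ->
  hI (r * l) + 5 / 2 <= 38 * l * (1 + r).
Proof.
move=> r1 r3 l1 l2.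
have w1 : r * l <= 3 * (10 / 7) by rewrite ler_pM //; lra.
have w0 : 0 <= r * l by rewrite mulr_ge0; lra.
have h : r * l * (r * l) <= r * l * (3 * (10 / 7)) by rewrite ler_wpM2l.
rewrite /hI; lra.
Qed.

End BudgetReals.

Section Budget.
Context (R : realType) (n m : nat) (P : problem R n m) (A : input R n m).
Hypotheses (hA : valid_input P A) (hSC : SC P) (hD : (diam P < +oo)%E).
Implicit Types s a p : state R n m.

Local Notation N := (reset_num P A).
Local Notation accepted := (accepted P A N).
Local Notation g := (gamma1 A)^-1.
Local Notation nu := (nuk P A N).
Local Notation x := (gamma A)^-1.
Local Notation kappa_bar := (kappa_bar P A).
Local Notation Rc := (Rcal P A).
Local Notation lt := (l_tilde A).
Local Notation mt := (mu_tilde A).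

Definition lambda_last : R := lt / nu.
Definition geoS : R := \sum_(k < N) g ^+ k.

Definition sum_budget : R := 60 * lt * (lt / mt)
  * (Rc ^+ (2 + varsigma A) / (1 - gamma A ^+ ((2 + varsigma A) * rexp A))).

Let g1 : 1 < g := igamma1_gt1 hA.
Let gp : 0 < g. Proof. exact: lt_trans ltr01 g1. Qed.
Let g0 : 0 < gamma1 A. Proof. exact: (gamma1_gt0 hA). Qed.
Let lt0 : 0 < lt := l_tilde_gt0 hA.
Let mt0 : 0 < mt := mu_tilde_gt0 hA.
Let n0 : 0 < nu := nuk_gt0 hA hSC N.
Let R1 : 1 <= Rc := Rcal_ge1 P A.

Let gpow e : (0 < e)%N -> 1 - gamma A ^+ (e * rexp A) = (g ^+ e - 1) / g ^+ e.
Proof.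
move=> e0; rewrite mulnC exprM -/(gamma1 A) exprVn; field.
by rewrite expf_neq0 // gt_eqF.
Qed.

Let gpow1 e : (0 < e)%N -> 0 < g ^+ e - 1.
Proof. by move=> e0; rewrite subr_gt0 exprn_egt1 // -lt0n. Qed.

Lemma geo_le e : (0 < e)%N -> \sum_(k < N) (g ^+ e) ^+ k
  <= Rc ^+ e / (1 - gamma A ^+ (e * rexp A)).
Proof.
move=> e0; have q0 := gpow1 e0; rewrite gpow // invf_div mulrA ler_pdivlMr //.
rewrite mulrC -subrX1 -exprM mulnC exprM -exprMn.
have : (g ^+ N) ^+ e <= (Rc * g) ^+ e.
  by rewrite lerXn2r ?nnegrE ?(gN hA) ?exprn_ge0 ?mulr_ge0 ?(ltW gp) // (le_trans ler01 R1).
lra.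
Qed.

(** Up to its term [- 38 Lk k], the cost of epoch [k] is geometric of ratio [g ^ 2] for known mu and
    [g ^ 3] otherwise, since [mu_k] then shrinks too. The saved terms sum to [38 lt geoS]. *)
Lemma budget : \sum_(k < N) epoch_cost P A k + 38 * lt * geoS <= sum_budget.
Proof.
rewrite /geoS mulr_sumr -big_split /=.
apply: (@le_trans _ _ (60 * lt * (lt / mt) * \sum_(k < N) (g ^+ (2 + varsigma A)) ^+ k)).
  rewrite mulr_sumr; apply: ler_sum => k _.
  rewrite /epoch_cost /Lk /nuk /varsigma; case: ifP => hk.
    have <- : mt = pmu P by case: hA => _ _ _ _ /(_ hk).
    rewrite addn0 -exprM mulnC exprM le_eqVlt; apply/orP; left; apply/eqP.
    by field; rewrite !gt_eqF.
  rewrite -exprM mulnC exprM le_eqVlt; apply/orP; left; apply/eqP.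
  rewrite exprVn; field.
  by rewrite !gt_eqF // exprn_gt0.
rewrite /sum_budget ler_pM2l; first exact: geo_le.
by rewrite !mulr_gt0 // invr_gt0.
Qed.

Lemma budget0 : epoch_cost P A 0 <= sum_budget.
Proof.
have m0 : nuk P A 0 = mt.
  rewrite /nuk expr0 mulr1; case: ifP => // h; by case: hA => _ _ _ _ /(_ h).
rewrite /epoch_cost m0 /Lk expr0 mulr1.
have c0 : 0 < 60 * lt * (lt / mt) by rewrite !mulr_gt0 // invr_gt0.
have : 60 * lt * (lt / mt) * 1 <= sum_budget; last first.
  have -> : 60 * lt ^+ 2 / mt = 60 * lt * (lt / mt) by ring.
  have := lt0; lra.
rewrite /sum_budget ler_pM2l //.
have e0 : (0 < 2 + varsigma A)%N by [].
have q0 := gpow1 e0; rewrite gpow // invf_div mulrA ler_pdivlMr // mul1r.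
have h1 : 1 <= Rc ^+ (2 + varsigma A) by exact: exprn_ege1.
have h2 : g ^+ (2 + varsigma A) * 1 <= g ^+ (2 + varsigma A) * Rc ^+ (2 + varsigma A).
  by rewrite ler_pM2l // exprn_gt0.
lra.
Qed.

(** Here the slack of [geo_le] is kept: the series stops at [g ^ (2 N)], whereas the asserted
    constant allows [(Rcal g) ^ 2], and [g ^ 2 / (g ^ 2 - 1) >= 1]. *)
Lemma budget_known N' : mu_known A -> N = N'.+1 ->
  \sum_(k < N) epoch_cost P A k + 38 * lt * geoS
    + 60 * lt * (lt / mt) * (Rc ^+ 2 - (g ^+ N') ^+ 2) <= sum_budget.
Proof.
move=> hk NE; have mE : mt = pmu P by case: hA => _ _ _ _ /(_ hk).
rewrite /sum_budget /varsigma hk addn0 /geoS mulr_sumr -big_split /=.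
have -> : \sum_(i < N) (epoch_cost P A i + 38 * lt * g ^+ i) =
    60 * lt * (lt / mt) * \sum_(k < N) (g ^+ 2) ^+ k.
  rewrite mulr_sumr; apply: eq_bigr => k _.
  rewrite /epoch_cost /Lk /nuk hk -mE -exprM mulnC exprM.
  by field; rewrite !gt_eqF.
rewrite -mulrDr ler_pM2l; last by rewrite !mulr_gt0 // invr_gt0.
have q0 := gpow1 (isT : (0 < 2)%N); rewrite gpow // invf_div mulrA ler_pdivlMr //.
rewrite mulrDl [X in X + _]mulrC -subrX1 -exprM mulnC exprM NE exprSr.
have h : (g ^+ N') ^+ 2 <= Rc ^+ 2.
  rewrite ler_sqr ?nnegrE ?exprn_ge0 ?(ltW gp) ?(le_trans ler01 R1) //.
  by rewrite ltW // (Rcal_gt hA).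
rewrite exprMn; lra.
Qed.

Let lamE : lt = lambda_last * nu. Proof. by rewrite /lambda_last divfK // gt_eqF. Qed.

Lemma lam_ge1 : 1 <= lambda_last.
Proof.
rewrite ler_pdivlMr // mul1r; apply: le_trans (nuk_le hA N) _.
exact: ltW (mu_lt_l_tilde hA).
Qed.

Lemma lam_unknown : ~~ mu_known A -> Rc <= lambda_last.
Proof.
move=> hk; apply: le_trans (Rcal_le (P := P) hA) _.
have -> : lambda_last = lt / mt * g ^+ N.
  by rewrite /lambda_last /nuk (negbTE hk) exprVn invfM mulrA.
rewrite ler_peMl ?exprn_ge0 ?(ltW gp) //.
by rewrite ler_pdivlMr // mul1r ltW // (mu_lt_l_tilde hA).
Qed.

Lemma kappa_barE : kappa_bar = Rc * lambda_last.
Proof. by rewrite /kappa_bar /L_bar /lambda_last mulrA. Qed.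

Lemma geoS_ge1 : (0 < N)%N -> 1 <= geoS.
Proof.
rewrite /geoS; case: (N) => // k _; rewrite big_ord_recl expr0 lerDl.
by apply: sumr_ge0 => i _; rewrite exprn_ge0 // ltW.
Qed.

Lemma geoS_ge2 k : N = k.+2 -> 1 + g ^+ k.+1 <= geoS.
Proof.
rewrite /geoS => ->; rewrite big_ord_recl big_ord_recr /= expr0 lerD2l lerDr.
by apply: sumr_ge0 => i _; rewrite exprn_ge0 // ltW.
Qed.

Lemma acc_facts j a : accepted N j a ->
  [/\ 0 < rat a < 1, 1 <= cond a * rat a, 0 <= kappa_bar <= cond a &
      [/\ kappa_bar * rat a <= Rc, Rc <= cond a & rat a * lambda_last <= 1]].
Proof.
move=> ac; have I := acc_inv ac; have wa := acc_wf hA hSC ac.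
have [_ nl lM] := acc_lt hA hSC ac; have l0 : 0 < sl a := lt_trans n0 nl.
have ll : lt <= sl a by rewrite (inv_l I) (lj_ge hA).
have w0 : 0 <= kappa_bar by rewrite kappa_barE mulr_ge0 ?(le_trans ler01) ?lam_ge1.
have wc := kappa_bar_le hA hSC ac.
split; [exact: rat_bounds| |by rewrite w0| split].
- rewrite /cond /rat (inv_L I) (inv_mu I).
  by rewrite mulrA divfK ?gt_eqF // ler_pdivlMr // mul1r.
- rewrite kappa_barE /lambda_last /rat (inv_mu I).
  have -> : Rc * (lt / nu) * (nu / sl a) = Rc * (lt / sl a) by field; rewrite !gt_eqF.
  by rewrite ler_piMr ?(le_trans ler01 R1) // ler_pdivrMr // mul1r.
- by apply: le_trans wc; rewrite kappa_barE ler_peMr ?lam_ge1 // (le_trans ler01 R1).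
- rewrite /rat (inv_mu I) /lambda_last.
  have -> : nu / sl a * (lt / nu) = lt / sl a by field; rewrite !gt_eqF.
  by rewrite ler_pdivrMr // mul1r.
Qed.

Lemma regime_slow : 10 / 7 <= lambda_last -> forall j a, accepted N j a -> okstep P A 0 0 a.
Proof.
move=> hl j a ac; have [/andP[s0 s1] ms wc [_ _ sl]] := acc_facts ac; left.
have s7 : 0 < rat a <= 7 / 10.
  rewrite s0; have := ler_wpM2l (ltW s0) hl; lra.
have := condG_slow s7 ms wc (ltW (igamma_gt1 hA)).
rewrite /condG => h; apply: le_trans h; rewrite lerD2l -subr_ge0 -mulrBl -mulrBl subr0.
apply: mulr_ge0 (sqr_ge0 _); apply: mulr_ge0; last by rewrite /cc mulr_ge0 //; lra.
by case/andP: wc => w0 _; have := sqr_ge0 kappa_bar; rewrite /hI; lra.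
Qed.

Lemma regime_mid : 2 * Rc <= 3 + x -> forall j a, accepted N j a -> okstep P A (hI kappa_bar) 0 a.
Proof.
move=> hl j a ac; have [/andP[s0 s1] ms wc [wR _ sl]] := acc_facts ac.
have x1 := ltW (igamma_gt1 hA).
have [s7|s7] := leP (7 / 10) (rat a); [right; left|left].
  split => //; first lra.
  apply: condI_fast => //; first by rewrite s7.
  lra.
by apply: condG_slow => //; rewrite s0 ltW.
Qed.

Lemma regime_one : 3 + x < 2 * Rc -> forall j a, accepted N j a -> okstep P A (72 * Rc - 60) 2 a.
Proof.
move=> hl j a ac; have [s01 ms wc [wR Rm sl]] := acc_facts ac.
have x1 := ltW (igamma_gt1 hA).
have r2 : 2 <= Rc by lra.
have xr : x <= 2 * Rc - 3 by lra.
have [h|h] := condG_or_D1 s01 r2 Rm wc x1 xr; [by left|by right; right].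
Qed.

Lemma regime_many : 3 + x < 2 * Rc -> x <= Rc ->
  forall j a, accepted N j a -> okstep P A (38 * Rc + 35) 2 a.
Proof.
move=> hl xR j a ac; have [s01 ms wc [wR Rm sl]] := acc_facts ac.
have x1 := ltW (igamma_gt1 hA).
have r2 : 2 <= Rc by lra.
have xr : x <= 2 * Rc - 3 \/ 3 <= Rc by left; lra.
have [h|h] := condG_or_D2 s01 r2 Rm wc x1 xR xr; [by left|by right; right].
Qed.

Lemma x_le_Rcal k : N = k.+2 -> x <= Rc.
Proof.
move=> NE; apply: (@le_trans _ _ (g ^+ k.+1)); last by rewrite ltW // (Rcal_gt hA).
rewrite /gamma1 -exprVn -exprM -[X in X <= _]expr1 ler_eXn2l ?(igamma_gt1 hA) //.
by rewrite muln_gt0 (rexp_gt0 hA).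
Qed.

(** For [lambda_last < 10 / 7] the test [2 Rcal <= 3 + x] decides whether [condI_fast] applies, as
    [w s <= Rcal]. With mu unknown it always does, because [Rcal <= lambda_last]. With mu known the
    sum affords, in units of [nu], [38 lambda + 60 lambda ^ 2 (Rcal ^ 2 - 1)] after one reset and
    [38 lambda (1 + Rcal)] after several. *)
Lemma regime : (0 < N)%N -> exists h rt : R,
  [/\ 0 <= h, 0 <= rt, forall j a, accepted N j a -> okstep P A h rt a &
      \sum_(k < N) epoch_cost P A k + (h + 5 / 2) * nu <= sum_budget].
Proof.
move=> N0; have l1 := lam_ge1; have S1 := geoS_ge1 N0; have bd := budget.
have x1 := ltW (igamma_gt1 hA); have Rc1 := Rcal_ge1 P A; have nu0 := n0.
have suf B h : h + 5 / 2 <= B -> \sum_(k < N) epoch_cost P A k + B * nu <= sum_budget ->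
    \sum_(k < N) epoch_cost P A k + (h + 5 / 2) * nu <= sum_budget.
  by move=> hB; apply: le_trans; rewrite lerD2l ler_wpM2r // ltW.
have bd1 : \sum_(k < N) epoch_cost P A k + 38 * lambda_last * nu <= sum_budget.
  apply: le_trans bd; rewrite lerD2l -[38 * lambda_last * nu]mulrA -lamE ler_peMr //.
  by rewrite mulr_ge0 // ltW.
have [hl|hl] := leP (10 / 7) lambda_last.
  exists 0, 0; split => //; first exact: regime_slow.
  by apply: suf bd1; lra.
have hw : kappa_bar = Rc * lambda_last := kappa_barE.
have hI0 : 0 <= hI kappa_bar.
  have : 0 <= kappa_bar by rewrite hw mulr_ge0; lra.
  by have := sqr_ge0 kappa_bar; rewrite /hI; lra.
have [hk|hk] := boolP (mu_known A); last first.
  have Rl := lam_unknown hk.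
  exists (hI kappa_bar), 0; split => //; first by apply: regime_mid; lra.
  by apply: suf bd1; rewrite hw; exact: budget_unknown_aux.
have [N' NE] : exists N', N = N'.+1 by case: (N) N0 => // k; exists k.
have bk := budget_known hk NE.
have ltE : 60 * lt * (lt / mt) = 60 * lambda_last ^+ 2 * nu.
  have <- : nu = mt by rewrite /nuk hk; case: hA => _ _ _ _ /(_ hk) ->.
  by rewrite /lambda_last; field; rewrite gt_eqF.
case: N' NE bk => [|k] NE bk.
  have bk1 : \sum_(k < N) epoch_cost P A k
      + (38 * lambda_last + 60 * lambda_last ^+ 2 * (Rc ^+ 2 - 1)) * nu <= sum_budget.
    apply: le_trans bk; rewrite expr0 expr1n ltE -addrA lerD2l mulrDl.
    rewrite [60 * _ * nu * _]mulrAC lerD2r -[38 * lambda_last * nu]mulrA -lamE ler_peMr //.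
    by rewrite mulr_ge0 // ltW.
  have [hR|hR] := leP (2 * Rc) (3 + x).
    exists (hI kappa_bar), 0; split => //; first exact: regime_mid.
    by apply: suf bk1; rewrite hw; exact: budget_one_aux.
  exists (72 * Rc - 60), 2; split => //; [lra|exact: regime_one|].
  by apply: suf bk1; apply: budget_one_aux2; lra.
have xR := x_le_Rcal NE.
have bk2 : \sum_(k < N) epoch_cost P A k + 38 * lambda_last * (1 + Rc) * nu <= sum_budget.
  apply: le_trans bk; rewrite -addrA lerD2l ltE.
  have hX := Rcal_gt hA NE; have S2 := geoS_ge2 NE.
  have h1 : lt * (1 + g ^+ k.+1) <= lt * geoS by rewrite ler_pM2l.
  have X1 : 1 <= g ^+ k.+1 by apply: exprn_ege1; exact: ltW.
  move: h1 hX X1; rewrite {1}lamE; set X := g ^+ k.+1; set Q := lt * geoS => h1 hX X1.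
  rewrite -[38 * lt * geoS]mulrA -/Q; exact: budget_many_aux.
have [hR|hR] := leP (2 * Rc) (3 + x).
  exists (hI kappa_bar), 0; split => //; first exact: regime_mid.
  by apply: suf bk2; rewrite hw; apply: budget_many_aux1 => //; lra.
exists (38 * Rc + 35), 2; split => //; [lra|exact: regime_many|].
apply: suf bk2.
by have : 1 * (1 + Rc) <= lambda_last * (1 + Rc) by [rewrite ler_wpM2r //; lra]; lra.
Qed.
End Budget.

(** * Assembling the epochs *)

Section Final.
Context (R : realType) (n m : nat) (P : problem R n m) (A : input R n m).
Hypotheses (hA : valid_input P A) (hSC : SC P) (hD : (diam P < +oo)%E).
Local Notation N := (reset_num P A).
Local Notation nu := (nuk P A N).

Let hLN := pL_le_Lk hA (P := P).
Let hnuN := nuk_le_pmu hA hSC.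

Lemma Lambda_bar_ge0 : 0 <= Lambda_bar P A.
Proof.
have Lb0 : 0 <= L_bar P A.
  by apply: mulr_ge0 (ltW (l_tilde_gt0 hA)); apply: le_trans ler01 (Rcal_ge1 P A).
rewrite /Lambda_bar; case: ifP => _.
  apply: addr_ge0 (ltW (zeta_gt0 hA)) _; apply: mulr_ge0 (sqrtr_ge0 _).
  apply: mulr_ge0; last by have [] := diam_fine hSC hD.
  exact: divr_ge0 Lb0 (sqrtr_ge0 _).
apply: mulr_ge0 (sqr_ge0 _); apply: mulr_ge0 Lb0; apply: divr_ge0 => //.
by rewrite exprn_ge0 // ltW // (gamma_gt0 hA).
Qed.

Lemma nuk_le_Lk k : nuk P A k <= Lk A k.
Proof.
apply: le_trans (nuk_le hA k) _; apply: le_trans (ltW (mu_lt_l_tilde hA)) _.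
by rewrite Lk_lj; exact: (lj_ge hA).
Qed.

Lemma real_bound (Fs : R) (T : nat) (z : nat -> state R n m) :
  (forall x, dom (pg P) x -> Fs <= Fr P x) -> generated P A T z ->
  \sum_(0 <= t < T.+1) summand P A (z t) <=
  phi P (sx (z 0%N)) (sy (z 0%N)) - Fs
   + ((N%:R + 1) * (jump_cost P A + Lambda_bar P A) + sum_budget P A * Delta_bar P A).
Proof.
move=> hFs hz; have J0 := jump_cost_ge0 hA hSC; have Db := Delta_bar_ge0 hA (P := P).
have L0 : 0 <= Lambda_bar P A by exact: Lambda_bar_ge0.
have cE k : 0 <= epoch_cost P A k * Delta_bar P A.
  apply: mulr_ge0 Db; apply: epoch_cost_ge0 => //; exact: nuk_le_Lk.
have F4 k j p : accepted P A N k j p -> Fs <= phi P (x_next P A p) (y_next P A p) + jump_cost P A.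
  move=> ap; have Dx := acc_domx hA hSC ap; apply: le_trans (hFs _ Dx) _.
  exact: (jump hA hSC hD ap (dom_ystar hSC Dx)).
(* If [N = 0] there are no savings to spend; [PotEarly] serves for the whole run, and its cost fits
   by [budget0]. *)
have [N0|N0] := posnP N.
  have := sum_bound hA hSC hD hLN hnuN (Pot := PotEarly P A)
    (E := fun k => Lambda_bar P A + epoch_cost P A k * Delta_bar P A) (J := jump_cost P A)
    (Jend := jump_cost P A)
    (Fs := Fs) _ J0 J0 _ _ _ _ hz.
  move=> h; apply: le_trans (h _ _ _ _ _) _.
  - by move=> k _; exact: addr_ge0.
  - exact: (PotEarly_start hA hSC hD).
  - exact: (PotEarly_continue hA hSC).
  - by move=> k j p y; rewrite N0.
  - move=> k j p ap; rewrite if_same; apply: le_trans (F4 _ _ _ ap) _.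
    by rewrite lerD2r (phi_le_PotEarly hA hSC ap).
  rewrite lerD2l N0 big_ord_recl big_ord0 addr0 mul0r addr0 add0r mul1r.
  have := ler_wpM2r Db (budget0 hA); lra.
have [h [rt [h0 rt0 hok hbud]]] := regime hA hSC N0.
pose Pot k := if (k < N)%N then PotEarly P A k else PotLast P A h rt.
pose E k := Lambda_bar P A + if (k < N)%N then epoch_cost P A k * Delta_bar P A
  else jump_cost P A + (h + 5 / 2) * nu * Delta_bar P A.
have kN k j p : accepted P A N k j p -> ~~ (k < N)%N -> k = N.
  move=> ap; rewrite -leqNgt => Nk; apply/eqP; rewrite eqn_leq Nk andbT.
  exact: inv_k (acc_inv ap).
have hn : 0 <= (h + 5 / 2) * nu * Delta_bar P A.
  by rewrite !mulr_ge0 ?(ltW (nuk_gt0 hA hSC _)) // addr_ge0.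
have := sum_bound hA hSC hD hLN hnuN (Pot := Pot) (E := E) (J := jump_cost P A) (Jend := 0)
    (Fs := Fs) _ J0 (lexx _) _ _ _ _ hz.
move=> hs; apply: le_trans (hs _ _ _ _ _) _.
- by move=> k _; rewrite /E; case: ifP => _; rewrite !addr_ge0.
- move=> k j a ac fa; rewrite /Pot /E; case: ifPn => hk; first exact: (PotEarly_start hA hSC hD ac).
  have E0 := kN _ _ _ ac hk; rewrite E0 in ac.
  by have := PotLast_start hA hSC hD ac fa h0 (hok _ _ ac); rewrite -[Lambda_bar P A + _ + _]addrA.
- move=> k j j' p a ap ac hc; rewrite /Pot; case: ifPn => hk.
    exact: (PotEarly_continue hA hSC ap ac hc).
  have E0 := kN _ _ _ ac hk; rewrite E0 in ac ap.
  exact: (PotLast_continue hA hSC ap ac hc h0 rt0 (hok _ _ ac)).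
- move=> k j p y hk ap Dy; rewrite /Pot hk.
  apply: le_trans (jump hA hSC hD ap Dy) _; by rewrite lerD2r (phi_le_PotEarly hA hSC ap).
- move=> k j p ap; rewrite /Pot; case: ifPn => hk.
    rewrite ltn_eqF //; apply: le_trans (F4 _ _ _ ap) _.
    by rewrite lerD2r (phi_le_PotEarly hA hSC ap).
  have E0 := kN _ _ _ ap hk; rewrite E0 eqxx addr0 in ap *.
  apply: le_trans (hFs _ (acc_domx hA hSC ap)) _.
  exact: (Fr_le_PotLast hA hSC ap).
rewrite lerD2l addr0 big_ord_recr /= /E ltnn.
have -> : \sum_(i < N) (Lambda_bar P A + (if (i < N)%N then epoch_cost P A i * Delta_bar P A
      else jump_cost P A + (h + 5 / 2) * nu * Delta_bar P A)) =
   N%:R * Lambda_bar P A + (\sum_(i < N) epoch_cost P A i) * Delta_bar P A.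
  rewrite big_split /= sumr_const card_ord -[_ *+ N]mulr_natl mulr_suml.
  by congr (_ + _); apply: eq_bigr => i _; rewrite ltn_ord.
have := ler_wpM2r Db hbud; rewrite mulrDl; lra.
Qed.
End Final.

Theorem theorem3p4 (R : realType) (n m : nat)
    (P : problem R n m) (A : input R n m)
    (hSC : SC P) (hA : valid_input P A)
    (hD : (diam P < +oo)%E) (hF : (-oo < Fstar P)%E)
    (T : nat) (hT : (0 < T)%N)
    (z : nat -> state R n m) (hz : generated P A T z) :
  ((\sum_(0 <= t < T.+1)
      (gamma0 A * tau A (z t) * normGx P A (z t) ^+ 2
       + sigma (z t) * normGy P (z t) ^+ 2
       + smu (z t) * sigma (z t) ^+ 2 / 2 * normGy_next P A (z t) ^+ 2))%:E
   <= Lag P (sx (z 0%N)) (sy (z 0%N)) - Fstar P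
      + (((reset_bound P A)%:~R + 1)
           * ((L_bar P A / gamma A ^+ rexp A + pL P) * fine (diam P) ^+ 2
              + Lambda_bar P A)
         + 60 * l_tilde A * (l_tilde A / mu_tilde A)
           * (Rcal P A ^+ (2 + varsigma A)
              / (1 - gamma A ^+ ((2 + varsigma A) * rexp A)))
           * Delta_bar P A)%:E)%E.
Proof.
have [[s hr hs] _] := hz.
have [k [j [ac _]]] := first_search hA hSC hD (pL_le_Lk hA) (nuk_le_pmu hA hSC) hr hs.
have Dx := inv_x (acc_inv ac); have Dy := inv_y (acc_inv ac).
have FsE : Fstar P = (fine (Fstar P))%:E.
  rewrite fineK // fin_numE (gt_eqF hF) /= lt_eqF //.
  exact: le_lt_trans (Fstar_le hSC Dx) (ltry _).
rewrite (Lag_phi hSC Dx Dy) FsE reset_boundE //.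
have aux (a b c d : R) : a <= b - c + d -> (a%:E <= b%:E - c%:E + d%:E)%E by [].
apply: aux; apply: real_bound => // x Dx'.
by rewrite -lee_fin -FsE; exact: Fstar_le.
Qed.
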